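(* Let $\mathcal{F}$ be a family of meromorphic functions on a domain $D\subset\mathbb{C}$, and let $n,k$ be positive integers such that $n>2$. Let $b$ be a non-zero finite complex number and let $a$ be a non-vanishing holomorphic function on $D$. If for each function $f\in\mathcal{F}$ all zeros of $f$ have multiplicity at least $2k+1$, and $f(z)+a(z)\left(f^{(k)}\right)^n(z)-b$ has at most one zero IM (that is, at most one distinct zero, ignoring multiplicity) in $D$, then $\mathcal{F}$ is normal in $D$.
   Context: A family of meromorphic functions on a domain $D\subset\mathbb{C}$ is normal in $D$ if every sequence in the family has a subsequence which converges spherically uniformly on compact subsets of $D$ to a meromorphic function or to $\infty$. $f^{(k)}$ denotes the $k$-th derivative of $f$, and $\left(f^{(k)}\right)^n$ its $n$-th power. *)

(* Defs.v *)
From mathcomp Require Import all_boot all_order all_algebra.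
From mathcomp Require Import complex.
From mathcomp Require Import all_classical all_reals all_analysis.

Set Implicit Arguments.
Unset Strict Implicit.
Unset Printing Implicit Defensive.

Import Order.TTheory GRing.Theory Num.Theory.
Import numFieldNormedType.Exports.
Import ComplexField.Normc.

Local Open Scope classical_set_scope.
Local Open Scope ring_scope.
Local Open Scope complex_scope.

(* The complex plane is [R[i]^o], so that [derivable] and [f^`(k)] are complex
   differentiation.  The Riemann sphere is its one-point compactification, with
   [None] the point at infinity. *)
Definition sphere (R : realType) : topologicalType :=
  one_point_compactification R[i]^o.

Section Meromorphic.
Context {R : realType}.
Local Notation C := R[i]^o.
Implicit Types (D K : set C) (f g : C -> sphere R).

Definition domain D := [/\ open D, connected D & D !=set0].

Definition holomorphic_on D (a : C -> C) :=
  forall z, D z -> derivable a z 1.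

Definition holomorphic_at (a : C -> C) (z0 : C) :=
  \forall z \near z0, derivable a z 1.

(* The value 0 at poles is a dummy: it is only used near points where the
   function is finite. *)
Definition finite_part f : C -> C := fun z => odflt 0 (f z : option C).

Definition regular_at f z0 :=
  (\forall z \near z0, f z <> None) /\ holomorphic_at (finite_part f) z0.

Definition pole_at f z0 :=
  [/\ f z0 = None,
      \forall z \near z0^', f z <> None /\ derivable (finite_part f) z 1
    & f z @[z --> z0^'] --> (None : sphere R)].

Definition meromorphic_on D f :=
  forall z0, D z0 -> regular_at f z0 \/ pole_at f z0.

(* f^(k): it has the same poles as f. *)
Definition mderiv (k : nat) f : C -> sphere R := fun z =>
  if f z is Some _ then Some ((finite_part f)^`(k)%classic z) else None.

Definition is_zero f z0 := f z0 = Some 0.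

Definition zero_of_multiplicity f z0 (m : nat) :=
  is_zero f z0 /\
  exists h : C -> C, [/\ holomorphic_at h z0, h z0 != 0
    & \forall z \near z0, f z = Some ((z - z0) ^+ m * h z)].

(* A zero at which f vanishes identically has no finite multiplicity; it
   counts as having infinite multiplicity. *)
Definition zeros_multiplicity_ge D f (m : nat) :=
  forall z0 p, D z0 -> zero_of_multiplicity f z0 p -> (m <= p)%N.

(* f + a (f^(k))^n - b.  A pole of f of order p is a pole of order n (p + k) of
   a (f^(k))^n when a is holomorphic and does not vanish there, and n (p + k) > p
   for n, k > 0: no cancellation can occur, and the value is infinity exactly at
   the poles of f. *)
Definition diff_poly (a : C -> C) (b : C) (n k : nat) f :
    C -> sphere R := fun z =>
  match f z, mderiv k f z with
  | Some w, Some v => Some (w + a z * v ^+ n - b)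
  | _, _ => None
  end.

Definition at_most_one_zero D f :=
  forall z w, D z -> D w -> is_zero f z -> is_zero f w -> z = w.

Definition chordal (p q : sphere R) : R :=
  match p, q with
  | Some z, Some w =>
      normc (z - w) /
        (Num.sqrt (1 + normc z ^+ 2) * Num.sqrt (1 + normc w ^+ 2))
  | Some z, None | None, Some z => (Num.sqrt (1 + normc z ^+ 2))^-1
  | None, None => 0
  end.

Definition spherically_locally_uniform_cvg D (u : nat -> C -> sphere R) g :=
  forall K, compact K -> K `<=` D -> forall e : R, 0 < e ->
    \forall j \near \oo, forall z, K z -> chordal (u j z) (g z) < e.

Definition normal_family D (F : set (C -> sphere R)) :=
  forall u : nat -> C -> sphere R, (forall j, F (u j)) ->
    exists phi : nat -> nat, increasing_seq phi /\
      exists g, (meromorphic_on D g \/ forall z, D z -> g z = None) /\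
        spherically_locally_uniform_cvg D (u \o phi) g.

End Meromorphic.

(* Main.v *)
Require Import Defs.
From mathcomp Require Import all_boot all_order all_algebra.
From mathcomp Require Import complex.
From mathcomp Require Import all_classical all_reals all_analysis.
From mathcomp Require Import ring lra.
Import Order.TTheory GRing.Theory Num.Theory.
Import numFieldNormedType.Exports.
Import ComplexField.Normc.
Local Open Scope classical_set_scope.
Local Open Scope ring_scope.
Local Open Scope complex_scope.

Set Implicit Arguments.
Unset Strict Implicit.
Unset Printing Implicit Defensive.

(** Zalcman's rescaling, in Pang's form with exponent [k], reduces normality to a
   statement about the plane.  If spherical derivatives were not locally bounded on
   the family, then some [g_j(x) = t_j^-k f_j(z_j + t_j x)] with [t_j -> 0] would
   converge locally spherically uniformly to a limit [g] with
   [|g'(0)| >= 1 + |g(0)|^2] (when [g(0)] is finite).  Put [G := g^(k)].  By Hurwitz,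
   [G^n = b / a(lim z_j)] at one point at most, unless [G] is constant.  As [n > 2],
   two of the [n]-th roots [c, c'] of this number are omitted by [G] and a third [c'']
   is taken at most once, so [1 / (G - c)], which extends to an entire function by [0]
   at the poles, omits [1 / (c' - c)] and takes [1 / (c'' - c)] at most once; by
   Picard it is constant.  So [G] is constant and [g] is a polynomial; by Hurwitz the
   derivatives of [g] up to order [k] vanish at any root of [g], so [g = 0], against
   [|g'(0)| >= 1].  Locally bounded spherical derivatives give normality by Marty's
   criterion.

   Picard in this form: if [h] is entire, omits [p] and takes [q] at most once, then
   [h] is normalised by a logarithm to a function that omits the natural numbers; a
   further logarithm omits a grid with bounded mesh (Landau), against Bloch's theorem.
   Cauchy's estimates come from averages over the [N]-th roots of unity instead of
   contour integrals. *)

(** The exponent [k] in the rescaling makes [g_j^(k)] at [x] equal to [f_j^(k)] at [z_j + t_j x],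
    with no factor, while [f_j = t_j^k g_j] tends to 0 wherever the limit is finite. In the rescaled
    variable [f_j + a (f_j^(k))^n - b] therefore tends to [a(lim z_j) G^n - b], to which Hurwitz
    applies. The price is that the rescaled spherical derivative [t^(k+1) |f'| / (t^(2k) + |f|^2)]
    has to be less than 1 for small [t] near every point; at a zero of [f] this holds because the
    multiplicity exceeds [k].

    The averages over roots of unity compare increments of a function with a Riemann sum of its
    derivative, so they need that derivative to be continuous. This is why Goursat's theorem
    precedes them: it provides a primitive of class C^1, and the averages, applied to the primitive,
    show that its derivative is again differentiable with a continuous derivative. Goursat's theorem
    is proved with one exceptional point where only continuity is known; removable singularities
    come from the same argument. *)

Local Notation nm := normc.
Local Notation Re := complex.Re.
Local Notation Im := complex.Im.

(** * Complex differentiation *)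

Section Modulus.
Context {R : realType}.
Implicit Types (z w : R[i]) (x : R).

Lemma nmE z : `|z| = (nm z)%:C. Proof. by []. Qed.

Lemma nm_ge0 z : 0 <= nm z. Proof. by rewrite -ler0c -nmE normr_ge0. Qed.

Lemma nm0 : nm (0 : R[i]) = 0. Proof. by rewrite normc0. Qed.

Lemma nm_eq0 z : (nm z == 0) = (z == 0).
Proof. by apply/eqP/eqP => [/eq0_normc|->] //; rewrite nm0. Qed.

Lemma nm_gt0 z : (0 < nm z) = (z != 0).
Proof. by rewrite lt_def nm_ge0 andbT nm_eq0. Qed.

Lemma nmX z k : nm (z ^+ k) = nm z ^+ k.
Proof. by elim: k => [|k IH]; rewrite ?expr0 ?normc1 // !exprS normcM IH. Qed.

Lemma nmC (x : R) : nm x%:C = `|x|.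
Proof. by rewrite /normc /= expr0n addr0 sqrtr_sqr. Qed.

Lemma nm_nat k : nm (k%:R : R[i]) = k%:R.
Proof. by rewrite -(rmorph_nat (real_complex R)) nmC normr_nat. Qed.

Lemma nmBC z w : nm (z - w) = nm (w - z).
Proof. by rewrite -normcN opprB. Qed.

Lemma nm_triB z w : nm z - nm w <= nm (z - w).
Proof. by rewrite lerBlDr; apply: le_trans (le_normcD _ _); rewrite subrK. Qed.

Lemma nm_triD z w : nm (z - w) <= nm z + nm w.
Proof. by apply: le_trans (le_normcD _ _) _; rewrite normcN. Qed.

Lemma nm_tri w z t : nm (z - t) <= nm (z - w) + nm (w - t).
Proof. by apply: le_trans (le_normcD _ _); rewrite addrA subrK. Qed.

Lemma nm_sum (I : Type) (r : seq I) (F : I -> R[i]) :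
  nm (\sum_(i <- r) F i) <= \sum_(i <- r) nm (F i).
Proof.
elim: r => [|a r IH]; first by rewrite !big_nil nm0.
by rewrite !big_cons; apply: le_trans (le_normcD _ _) _; rewrite lerD2l.
Qed.

Lemma nmRe z : `|Re z| <= nm z.
Proof. by rewrite -lecR; exact: normc_ge_Re. Qed.

Lemma nmi : nm 'i%C = 1 :> R.
Proof. by rewrite /normc /= expr0n add0r expr1n sqrtr1. Qed.

Lemma nmIm z : `|Im z| <= nm z.
Proof.
have := nmRe (z * 'i%C); by rewrite ReiNIm normrN normcM nmi mulr1.
Qed.

Lemma nm_ReIm z : nm z <= `|Re z| + `|Im z|.
Proof.
rewrite {1}(complexE z); apply: le_trans (le_normcD _ _) _.
by rewrite normcM !nmC nmi mul1r.
Qed.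

Lemma nbhsC_P (z : R[i]^o) (P : set R[i]^o) :
  nbhs z P <-> exists2 e : R, 0 < e & forall w : R[i], nm (w - z) < e -> P w.
Proof.
split.
- move=> /nbhs_ballP [e /= e0 H]; exists (Re e).
    by move: e0; rewrite ltcE => /andP[].
  move=> w hw; apply: H; rewrite /ball /= -opprB normrN nmE.
  have -> : e = (Re e)%:C.
    by rewrite RRe_real // gtr0_real.
  by rewrite ltcR.
- move=> [e e0 H]; apply/nbhs_ballP; exists e%:C; first by rewrite /= ltcR.
  move=> w /=; rewrite /ball /= -opprB normrN nmE ltcR; exact: H.
Qed.

End Modulus.

Section Derivative.
Context {R : realType}.
Local Notation C := R[i].
Implicit Types (f g : C -> C) (z w d : C).

(** The remainder form of the derivative, with a non-strict bound so that [w = z] is no exception.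
    The norm of [R[i]] takes complex values; [nm] and real radii keep all estimates in [R]. *)
Definition cdiff f z d := forall e : R, 0 < e -> exists2 del : R, 0 < del &
  forall w, nm (w - z) < del -> nm (f w - f z - d * (w - z)) <= e * nm (w - z).

Lemma cdiff_derive f z d : cdiff f z d <-> is_derive (z : C^o) 1 (f : C^o -> C^o) d.
Proof.
suff H : cdiff f z d <->
    (fun h : C^o => h^-1 *: (f (h *: 1 + z) - f z) : C^o) @ 0^' --> (d : C^o).
  split=> [cd|[dv dE]].
    have cv := proj1 H cd.
    by split; [apply/cvg_ex; exists d; exact: cv|exact: (cvg_lim _ cv)].
  by apply: (proj2 H); rewrite -dE; exact: dv.
split.
- move=> H; apply/cvgrPdist_lt => /= e e0.
  have eE : e = (Re e)%:C by rewrite RRe_real // gtr0_real.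
  have e'0 : 0 < Re e by rewrite eE ltcR in e0.
  have [del del0 Hd] := H (Re e / 2) ltac:(by rewrite divr_gt0).
  rewrite /dnbhs /within /=; apply/nbhsC_P; exists del => // h.
  rewrite subr0 => hd h0.
  have hn : 0 < nm h by rewrite nm_gt0.
  have := Hd (h + z); rewrite addrK => /(_ hd).
  rewrite nmE eE ltcR -[h *: 1]/(h * 1) mulr1 => Hh.
  suff : nm (d - h^-1 * (f (h + z) - f z)) * nm h <= Re e / 2 * nm h.
    by rewrite ler_pM2r // => /le_lt_trans; apply; rewrite ltr_pdivrMr // ltr_pMr // ltr1n.
  rewrite -normcM; apply: le_trans Hh; rewrite -normcN le_eqVlt; apply/orP; left.
  by apply/eqP; congr nm; field.
- move=> /cvgrPdist_lt H e e0.
  have /H : (0 : C) < e%:C by rewrite ltcR.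
  rewrite /= /dnbhs /within /= => /nbhsC_P [del del0 Hd]; exists del => // w hw.
  have [->|wz] := eqVneq w z; first by rewrite !subrr mulr0 subr0 nm0 mulr0.
  have wz0 : w - z != 0 by rewrite subr_eq0.
  have := Hd (w - z); rewrite subr0 => /(_ hw wz0).
  rewrite nmE ltcR -[_ *: 1]/(_ * 1) mulr1 subrK => Hh.
  rewrite (_ : f w - f z - d * (w - z) = - (d - (w - z)^-1 * (f w - f z)) * (w - z)).
    by rewrite normcM ler_wpM2r ?nm_ge0 // normcN; exact: ltW.
  by field.
Qed.

Lemma cdiff_derivable f z d : cdiff f z d -> derivable (f : C^o -> C^o) z 1.
Proof. by move=> /cdiff_derive []. Qed.

Lemma cdiff_derive1 f z d : cdiff f z d -> (f : C^o -> C^o)^`()%classic z = d.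
Proof. by move=> /cdiff_derive [_ <-]; rewrite derive1E. Qed.

Lemma derivable_cdiff f z : derivable (f : C^o -> C^o) z 1 ->
  cdiff f z ((f : C^o -> C^o)^`()%classic z).
Proof. by move=> df; apply/cdiff_derive; rewrite derive1E; split. Qed.

Lemma cdiff_unique f z d d' : cdiff f z d -> cdiff f z d' -> d = d'.
Proof. by move=> /cdiff_derive1 <- /cdiff_derive1 <-. Qed.

Lemma cdiff_near f g z d (r : R) : 0 < r ->
  (forall w, nm (w - z) < r -> f w = g w) -> cdiff f z d -> cdiff g z d.
Proof.
move=> r0 fg H e e0; have [del del0 Hd] := H e e0.
exists (Num.min del r); first by rewrite lt_min del0.
move=> w; rewrite lt_min => /andP[h1 h2]; rewrite -!fg ?subrr ?nm0 //; exact: Hd.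
Qed.

Lemma cdiff_cst c z : cdiff (fun=> c) z 0.
Proof. by apply/cdiff_derive; exact: is_derive_cst. Qed.

Lemma cdiff_id z : cdiff id z 1.
Proof. by apply/cdiff_derive; exact: is_derive_id. Qed.

Lemma cdiffD f g z d d' : cdiff f z d -> cdiff g z d' ->
  cdiff (fun w => f w + g w) z (d + d').
Proof. by move=> /cdiff_derive ? /cdiff_derive ?; apply/cdiff_derive; exact: is_deriveD. Qed.

Lemma cdiffN f z d : cdiff f z d -> cdiff (fun w => - f w) z (- d).
Proof. by move=> /cdiff_derive ?; apply/cdiff_derive; exact: is_deriveN. Qed.

Lemma cdiffB f g z d d' : cdiff f z d -> cdiff g z d' ->
  cdiff (fun w => f w - g w) z (d - d').
Proof. by move=> ? ?; apply: cdiffD => //; exact: cdiffN. Qed.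

Lemma cdiffM f g z d d' : cdiff f z d -> cdiff g z d' ->
  cdiff (fun w => f w * g w) z (f z * d' + g z * d).
Proof. by move=> /cdiff_derive ? /cdiff_derive ?; apply/cdiff_derive; exact: is_deriveM. Qed.

Lemma cdiffZ c f z d : cdiff f z d -> cdiff (fun w => c * f w) z (c * d).
Proof. by move=> H; have := cdiffM (cdiff_cst c z) H; rewrite mulr0 addr0. Qed.

Lemma cdiff_eq f z d d' : cdiff f z d -> d = d' -> cdiff f z d'.
Proof. by move=> + <-. Qed.

Lemma cdiffX f n z d : cdiff f z d ->
  cdiff (fun w => f w ^+ n) z (n%:R * f z ^+ n.-1 * d).
Proof.
move=> H; elim: n => [|n IH].
  by apply: (cdiff_eq (cdiff_cst 1 z)); rewrite !mul0r.
have E w : f w * f w ^+ n = f w ^+ n.+1 by rewrite exprS.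
apply: (cdiff_eq (cdiff_near ltr01 (fun w _ => E w) (cdiffM H IH))) => /=.
case: n {IH E} => [|n] /=; first by ring.
by rewrite !exprS; ring.
Qed.

Lemma cdiff_cont f z d : cdiff f z d -> forall e : R, 0 < e ->
  exists2 del : R, 0 < del & forall w, nm (w - z) < del -> nm (f w - f z) < e.
Proof.
move=> H e e0; have [del del0 Hd] := H 1 ltr01.
have K0 : 0 < 1 + nm d by rewrite ltr_pwDl // nm_ge0.
exists (Num.min del (e / (1 + nm d))); first by rewrite lt_min del0 divr_gt0.
move=> w; rewrite lt_min ltr_pdivlMr // => /andP[/Hd h1 h2].
apply: le_lt_trans h2; rewrite mulrDr mulr1.
rewrite (_ : f w - f z = (f w - f z - d * (w - z)) + d * (w - z)); last by ring.
apply: le_trans (le_normcD _ _) _; rewrite normcM [nm d * _]mulrC.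
by rewrite lerD2r -[leRHS]mul1r.
Qed.

Lemma cdiff_comp f g z d d' : cdiff f z d -> cdiff g (f z) d' ->
  cdiff (fun w => g (f w)) z (d' * d).
Proof.
move=> Hf Hg e e0.
have K0 : 0 < 1 + nm d + nm d' by rewrite -addrA ltr_pwDl // addr_ge0 // nm_ge0.
(* The remainder is at most [u (u + |d|) + |d'| u] times [|w - z|], and [u <= 1] bounds this factor
   by [u (1 + |d| + |d'|)]. *)
set u := Num.min 1 (e / (1 + nm d + nm d')).
have u0 : 0 < u by rewrite /u lt_min ltr01 divr_gt0.
have u1 : u <= 1 by rewrite /u ge_min lexx.
have ue : u * (1 + nm d + nm d') <= e.
  by rewrite -ler_pdivlMr // /u ge_min lexx orbT.
have [d1 d10 H1] := Hf u u0; have [d2 d20 H2] := Hg u u0.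
have [d3 d30 H3] := cdiff_cont Hf d20.
exists (Num.min d1 d3); first by rewrite lt_min d10.
move=> w; rewrite lt_min => /andP[/H1 h1 /H3 /H2 h2].
rewrite (_ : g (f w) - g (f z) - d' * d * (w - z) =
  (g (f w) - g (f z) - d' * (f w - f z)) + d' * (f w - f z - d * (w - z))); last by ring.
apply: le_trans (le_normcD _ _) _; rewrite normcM.
have h3 : nm (f w - f z) <= (u + nm d) * nm (w - z).
  rewrite (_ : f w - f z = (f w - f z - d * (w - z)) + d * (w - z)); last by ring.
  by apply: le_trans (le_normcD _ _) _; rewrite normcM mulrDl lerD2r.
have p0 := nm_ge0 (w - z); have p1 := nm_ge0 d; have p2 := nm_ge0 d'.
have h4 : u * nm (f w - f z) <= u * ((u + nm d) * nm (w - z)) by rewrite ler_pM2l.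
have h5 : nm d' * nm (f w - f z - d * (w - z)) <= nm d' * (u * nm (w - z)).
  by rewrite ler_wpM2l.
apply: le_trans (lerD (le_trans h2 h4) h5) _.
rewrite (_ : _ + _ = (u * (u + nm d + nm d')) * nm (w - z)); last by ring.
rewrite ler_wpM2r //; apply: le_trans ue; rewrite ler_pM2l //; lra.
Qed.

Lemma cdiff_inv z : z != 0 -> cdiff GRing.inv z (- z ^- 2).
Proof.
move=> z0 e e0; have nz : 0 < nm z by rewrite nm_gt0.
have z20 : 0 < nm z / 2 by rewrite divr_gt0.
have z30 : 0 < nm z ^+ 3 by rewrite exprn_gt0.
(* The remainder is [(w - z)^2 / (w z^2)]. The first radius gives [|w| >= |z| / 2], and the second
   then makes [|w - z| / (|w| |z|^2)] at most [e]. *)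
exists (Num.min (nm z / 2) (e * nm z ^+ 3 / 2)).
  by rewrite lt_min z20 divr_gt0 // mulr_gt0.
move=> w; rewrite lt_min => /andP[h1 h2].
have hw : nm z / 2 <= nm w by have := nm_triB z w; rewrite nmBC; lra.
have w0 : w != 0 by rewrite -nm_gt0; exact: lt_le_trans hw.
rewrite (_ : _ - _ = ((w - z) / (w * z ^+ 2)) * (w - z)); last by field; rewrite z0.
rewrite normcM ler_wpM2r ?nm_ge0 // normcM normcV ler_pdivrMr; last first.
  by rewrite nm_gt0 mulf_neq0 // expf_neq0.
apply: (le_trans (ltW h2)); rewrite normcM nmX -mulrA ler_pM2l //.
rewrite ler_pdivrMr // exprS mulrAC ler_pM2r ?exprn_gt0 //; lra.
Qed.

Lemma cdiffV f z d : f z != 0 -> cdiff f z d ->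
  cdiff (fun w => (f w)^-1) z (- d / f z ^+ 2).
Proof.
move=> fz H; have H2 := cdiff_inv fz.
by rewrite (_ : - d / f z ^+ 2 = - f z ^- 2 * d); [exact: (cdiff_comp H H2)|ring].
Qed.

Lemma cdiff_affine c b z : cdiff (fun w => b + c * w) z c.
Proof.
apply: (cdiff_eq (cdiffD (cdiff_cst b z) (cdiffZ c (cdiff_id z)))).
by rewrite add0r mulr1.
Qed.

Lemma cdiff_compZ f c b z d : cdiff f (b + c * z) d ->
  cdiff (fun w => f (b + c * w)) z (d * c).
Proof. by move=> H; exact: (cdiff_comp (cdiff_affine c b z) H). Qed.

Lemma cdiff_sum (I : Type) (r : seq I) (F : I -> C -> C) (D : I -> C) z :
  (forall i, cdiff (F i) z (D i)) ->
  cdiff (fun w => \sum_(i <- r) F i w) z (\sum_(i <- r) D i).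
Proof.
move=> H; elim: r => [|a r IH].
  rewrite big_nil; apply: (cdiff_near ltr01 _ (cdiff_cst 0 z)) => w _.
  by rewrite big_nil.
rewrite big_cons; apply: (cdiff_near ltr01 _ (cdiffD (H a) IH)) => w _.
by rewrite big_cons.
Qed.

End Derivative.

(** * The mean value inequality along a segment *)

Section MeanValue.
Context {R : realType}.
Local Notation C := R[i].

(** A continuation principle: the supremum of the [t] such that [P] holds on [[0, t]] has the
    property itself by the last premise, and by the second one it cannot be less than 1. It serves
    when [P] at earlier points is what makes the next step possible. *)
Lemma real_induction (P : R -> Prop) : P 0 ->
  (forall t, 0 <= t -> t < 1 -> P t ->
     exists2 del : R, 0 < del & forall s, t < s -> s < t + del -> s <= 1 -> P s) ->
  (forall t, 0 < t -> t <= 1 -> (forall s, 0 <= s -> s < t -> P s) -> P t) ->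
  forall t, 0 <= t -> t <= 1 -> P t.
Proof.
move=> P0 Pstep Plim.
pose E := [set t : R | 0 <= t /\ t <= 1 /\ forall s, 0 <= s -> s <= t -> P s].
have E0 : E 0.
  by split => //; split; [exact: ler01|move=> s s0 s1; have -> : s = 0 by apply/eqP; rewrite eq_le s0 s1].
have supE : has_sup E by split; [exists 0|exists 1 => t [_ []]].
pose c := sup E.
have c0 : 0 <= c by apply: ub_le_sup => //; case: supE.
have c1 : c <= 1 by apply: ge_sup => [|t [_ []] //]; exists 0.
have below s : 0 <= s -> s < c -> P s.
  move=> s0 sc; have [t [_ [_ Ht]] st] : exists2 t, E t & s < t.
    have sc' : 0 < c - s by rewrite subr_gt0.
    by have [t Et] := sup_adherent sc' supE; rewrite subKr; exists t.
  by apply: Ht => //; exact: ltW.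
have Pc : P c.
  move: c0; rewrite le_eqVlt => /orP[/eqP <- //|c0]; exact: Plim.
have cE s : 0 <= s -> s <= c -> P s.
  by move=> s0; rewrite le_eqVlt => /orP[/eqP -> //|]; exact: below.
have c1E : c = 1.
  apply/eqP; rewrite eq_le c1 /= leNgt; apply/negP => clt.
  have [del del0 Hd] := Pstep c c0 clt Pc.
  pose t := Num.min 1 (c + del / 2).
  have ct : c < t by rewrite /t lt_min clt ltrDl divr_gt0.
  have td : t < c + del.
    by rewrite /t gt_min ltrD2l ltr_pdivrMr // ltr_pMr // ltr1n orbT.
  have t1 : t <= 1 by rewrite /t ge_min lexx.
  suff : E t by move=> /(ub_le_sup (proj2 supE)); rewrite leNgt ct.
  split; first exact: le_trans c0 (ltW ct).
  split=> // s s0 st; have [sc|cs] := leP s c; first exact: cE.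
  by apply: Hd => //; [exact: le_lt_trans st td|exact: le_trans st t1].
by move=> t t0 t1; apply: cE => //; rewrite c1E.
Qed.

Definition rdiff (phi : R -> C) (t : R) (d : C) := forall e : R, 0 < e ->
  exists2 del : R, 0 < del & forall s, `|s - t| < del ->
    nm (phi s - phi t - d * (s - t)%:C) <= e * `|s - t|.

Lemma rdiffB phi psi t d d' : rdiff phi t d -> rdiff psi t d' ->
  rdiff (fun s => phi s - psi s) t (d - d').
Proof.
move=> H1 H2 e e0; have e20 : 0 < e / 2 by rewrite divr_gt0.
have [d1 d10 K1] := H1 _ e20; have [d2 d20 K2] := H2 _ e20.
exists (Num.min d1 d2); first by rewrite lt_min d10.
move=> s; rewrite lt_min => /andP[/K1 h1 /K2 h2].
rewrite (_ : _ - _ = (phi s - phi t - d * (s - t)%:C)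
  - (psi s - psi t - d' * (s - t)%:C)); last by ring.
apply: le_trans (nm_triD _ _) _; apply: le_trans (lerD h1 h2) _.
by rewrite -mulrDl -splitr.
Qed.

Lemma rdiff_affine phi a b t d : rdiff phi (a + t * b) d ->
  rdiff (fun s => phi (a + s * b)) t (d * b%:C).
Proof.
move=> H e e0; have b0 : 0 < 1 + `|b| by rewrite ltr_pwDl.
have [del del0 Hd] := H (e / (1 + `|b|)) ltac:(by rewrite divr_gt0).
exists (del / (1 + `|b|)); first by rewrite divr_gt0.
move=> s; rewrite ltr_pdivlMr // => hs.
have E : a + s * b - (a + t * b) = (s - t) * b by ring.
have bl : `|s - t| * `|b| <= `|s - t| * (1 + `|b|).
  by rewrite ler_wpM2l // lerDr.
have := Hd (a + s * b); rewrite E normrM => /(_ (le_lt_trans bl hs)) h.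
rewrite (_ : d * b%:C * (s - t)%:C = d * ((s - t) * b)%:C); last by rewrite rmorphM /=; ring.
apply: (le_trans h); rewrite -mulrA ler_pM2l // mulrC ler_pdivrMr //.
Qed.

Lemma cdiff_rdiff (f : C -> C) (p u : C) t d : cdiff f (p + t%:C * u) d ->
  rdiff (fun s => f (p + s%:C * u)) t (d * u).
Proof.
move=> H e e0; have u0 : 0 < 1 + nm u by rewrite ltr_pwDl // nm_ge0.
have [del del0 Hd] := H (e / (1 + nm u)) ltac:(by rewrite divr_gt0).
exists (del / (1 + nm u)); first by rewrite divr_gt0.
move=> s; rewrite ltr_pdivlMr // => hs.
have E : p + s%:C * u - (p + t%:C * u) = (s - t)%:C * u by rewrite rmorphB /=; ring.
have bl : `|s - t| * nm u <= `|s - t| * (1 + nm u).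
  by rewrite ler_wpM2l // lerDr.
have := Hd (p + s%:C * u); rewrite E normcM nmC => /(_ (le_lt_trans bl hs)) h.
rewrite (_ : d * u * (s - t)%:C = d * ((s - t)%:C * u)); last by ring.
apply: (le_trans h); rewrite -mulrA ler_pM2l // mulrC ler_pdivrMr //.
Qed.

(** A complex-valued function need not have an intermediate point with equality, so the inequality
    is propagated along the segment: the slope [M + e] absorbs the error of the derivative at each
    step, and [e] tends to 0. *)
Lemma mean_value01 (phi : R -> C) (M : R) :
  (forall t : R, 0 <= t -> t <= 1 -> exists2 d, rdiff phi t d & nm d <= M) ->
  nm (phi 1 - phi 0) <= M.
Proof.
move=> H; apply/ler_addgt0Pr => e e0; pose K := M + e.
suff : forall t : R, 0 <= t -> t <= 1 -> nm (phi t - phi 0) <= K * t.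
  by move=> /(_ 1 ler01 (lexx _)); rewrite mulr1.
have step t d : rdiff phi t d -> nm d <= M ->
   exists2 del : R, 0 < del & forall s, `|s - t| < del ->
     nm (phi s - phi t) <= K * `|s - t|.
  move=> Hd dM; have [del del0 Hdel] := Hd _ e0; exists del => // s /Hdel h.
  rewrite (_ : phi s - phi t =
    (phi s - phi t - d * (s - t)%:C) + d * (s - t)%:C); last by ring.
  apply: le_trans (le_normcD _ _) _; rewrite normcM nmC /K mulrDl addrC lerD //.
  by rewrite ler_wpM2r.
apply: real_induction.
- by rewrite subrr nm0 mulr0.
- move=> t t0 t1 Pt; have [d Hd dM] := H t t0 (ltW t1).
  have [del del0 Hdel] := step t d Hd dM; exists del => // s ts sd _.
  have := Hdel s; rewrite ger0_norm ?subr_ge0 ?(ltW ts) // ltrBlDl => /(_ sd) h.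
  apply: le_trans (nm_tri (phi t) _ _) _; apply: le_trans (lerD h Pt) _; lra.
- move=> t t0 t1 Pt; have [d Hd dM] := H t (ltW t0) t1.
  have [del del0 Hdel] := step t d Hd dM.
  (* A point before [t] within reach of the derivative at [t], kept non-negative so that the
     induction hypothesis covers it. *)
  pose s := Num.max 0 (t - del / 2).
  have d2 : 0 < del / 2 by rewrite divr_gt0.
  have d22 : del / 2 < del by rewrite ltr_pdivrMr // ltr_pMr // ltr1n.
  have s0 : 0 <= s by rewrite /s le_max lexx.
  have st : s < t by rewrite /s gt_max t0 ltrBlDr ltrDl.
  have sd : t - s < del.
    by rewrite ltrBlDr -ltrBlDl /s lt_max ltrD2l ltrN2 d22 orbT.
  have := Hdel s; rewrite distrC ger0_norm ?subr_ge0 ?(ltW st) // => /(_ sd) h.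
  apply: le_trans (nm_tri (phi s) _ _) _; rewrite nmBC.
  apply: le_trans (lerD h (Pt s s0 st)) _; lra.
Qed.

Lemma mean_valueR (phi : R -> C) (a b M : R) :
  (forall t : R, 0 <= t -> t <= 1 ->
     exists2 d, rdiff phi (a + t * (b - a)) d & nm d <= M) ->
  nm (phi b - phi a) <= M * `|b - a|.
Proof.
move=> H.
have := @mean_value01 (fun s => phi (a + s * (b - a))) (M * `|b - a|).
rewrite mul1r mul0r addr0 (addrC a) subrK; apply => t t0 t1.
have [d Hd dM] := H t t0 t1; exists (d * (b - a)%:C); first exact: rdiff_affine.
by rewrite normcM nmC ler_wpM2r.
Qed.

Lemma mean_value (f : C -> C) (p q : C) (M : R) :
  (forall t : R, 0 <= t -> t <= 1 ->
     exists2 d, cdiff f (p + t%:C * (q - p)) d & nm d <= M) ->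
  nm (f q - f p) <= M * nm (q - p).
Proof.
move=> H.
have := @mean_value01 (fun s => f (p + s%:C * (q - p))) (M * nm (q - p)).
rewrite rmorph1 rmorph0 mul1r mul0r addr0 (addrC p) subrK; apply => t t0 t1.
have [d Hd dM] := H t t0 t1; exists (d * (q - p)); first exact: cdiff_rdiff.
by rewrite normcM ler_wpM2r ?nm_ge0.
Qed.

End MeanValue.

(** * Goursat's theorem and primitives *)

Section Antiderivative.
Context {R : realType}.
Local Notation C := R[i].

Definition ccont (f : C -> C) (z : C) := forall e : R, 0 < e ->
  exists2 del : R, 0 < del & forall w, nm (w - z) < del -> nm (f w - f z) < e.

Lemma real_antiderivative (phi : R -> R) (T : R) : continuous phi ->
  exists Phi : R -> R, forall x, - T < x -> x < T -> is_derive x 1 Phi (phi x).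
Proof.
move=> cphi.
exists (fun x => \int[lebesgue_measure]_(t in `[- T, x]) phi t)%R => x Tx xT.
have cw : {within `[- T, T], continuous phi} by apply: continuous_subspaceT.
have fi : lebesgue_measure.-integrable `[- T, T] (EFin \o phi).
  by apply: continuous_compact_integrable => //; exact: segment_compact.
have [d1 d2] := continuous_FTC1_closed xT fi Tx (cphi x).
by apply: DeriveDef; [exact: d1|rewrite derive1E in d2; exact: d2].
Qed.

Lemma is_derive_eps (Phi : R -> R) (x d : R) : is_derive x 1 Phi d ->
  forall e : R, 0 < e -> exists2 del : R, 0 < del & forall s, `|s - x| < del ->
    `|Phi s - Phi x - d * (s - x)| <= e * `|s - x|.
Proof.
move=> [dv <-] e e0.
have /cvgrPdist_le H := dv.
have := H e e0; rewrite /dnbhs /within /= => /nbhs_ballP [del /= del0 Hd].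
exists del => // s hs; have [->|sx] := eqVneq s x; first by rewrite !subrr mulr0 subr0 !normr0 mulr0.
have sx0 : s - x != 0 by rewrite subr_eq0.
have := Hd (s - x); rewrite /ball /= sub0r normrN => /(_ hs sx0).
rewrite -[_ *: 1]/(_ * 1) mulr1 subrK => h.
rewrite (_ : _ - _ = - ('D_1 Phi x - (s - x)^-1 * (Phi s - Phi x)) * (s - x)); last by field.
by rewrite normrM normrN ler_wpM2r.
Qed.

Lemma antiderivative (phi : R -> C) (T : R) :
  (forall x (e : R), 0 < e -> exists2 del : R, 0 < del &
     forall s, `|s - x| < del -> nm (phi s - phi x) < e) ->
  exists Phi : R -> C, forall x, - T < x -> x < T -> rdiff Phi x (phi x).
Proof.
move=> cphi.
have cRe : continuous (fun x => Re (phi x)).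
  move=> x; apply/cvgrPdist_lt => e e0; have [del del0 Hd] := cphi x e e0.
  apply/nbhs_ballP; exists del => // s; rewrite /ball /= distrC => /Hd h.
  by rewrite distrC; apply: le_lt_trans h; rewrite -raddfB; exact: nmRe.
have cIm : continuous (fun x => Im (phi x)).
  move=> x; apply/cvgrPdist_lt => e e0; have [del del0 Hd] := cphi x e e0.
  apply/nbhs_ballP; exists del => // s; rewrite /ball /= distrC => /Hd h.
  by rewrite distrC; apply: le_lt_trans h; rewrite -raddfB; exact: nmIm.
have [P HP] := real_antiderivative T cRe; have [Q HQ] := real_antiderivative T cIm.
exists (fun x => (P x)%:C + 'i%C * (Q x)%:C) => x x1 x2 e e0.
have e20 : 0 < e / 2 by rewrite divr_gt0.
have [d1 d10 H1] := is_derive_eps (HP x x1 x2) e20.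
have [d2 d20 H2] := is_derive_eps (HQ x x1 x2) e20.
exists (Num.min d1 d2); first by rewrite lt_min d10.
move=> s; rewrite lt_min => /andP[/H1 h1 /H2 h2].
rewrite {1}(complexE (phi x)).
rewrite (_ : _ - _ = (P s - P x - Re (phi x) * (s - x))%:C
   + 'i%C * (Q s - Q x - Im (phi x) * (s - x))%:C); last first.
  by rewrite !(rmorphB, rmorphM) /=; ring.
apply: le_trans (le_normcD _ _) _; rewrite normcM nmi mul1r !nmC.
by apply: le_trans (lerD h1 h2) _; rewrite -mulrDl -splitr.
Qed.

End Antiderivative.

Section Goursat.
Context {R : realType}.
Local Notation C := R[i].
Context (f : C -> C) (T : R) (H V : R -> R -> C).
Hypothesis fcont : forall z, ccont f z.
Hypothesis HH : forall y x, - T < x -> x < T -> rdiff (H y) x (f (x +i* y)).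
Hypothesis HV : forall x y, - T < y -> y < T -> rdiff (V x) y (f (x +i* y)).

Local Ltac lclear := clear - fcont HH HV.

Lemma cplxE (x y : R) : x +i* y = x%:C + 'i%C * y%:C.
Proof. by rewrite {1}(complexE (x +i* y)). Qed.

Lemma segment_itv (a b t T1 : R) : - T1 < a -> a < T1 -> - T1 < b -> b < T1 ->
  0 <= t -> t <= 1 -> - T1 < a + t * (b - a) /\ a + t * (b - a) < T1.
Proof.
move=> h1 h2 h3 h4 h5 h6.
have k u v : 0 < u -> 0 < v -> 0 < (1 - t) * u + t * v.
  move=> u0 v0; move: h5; rewrite le_eqVlt => /orP[/eqP <-|t0].
    by rewrite subr0 mul1r mul0r addr0.
  by rewrite ltr_wpDl ?mulr_gt0 // mulr_ge0 ?subr_ge0 // ltW.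
have := k (a + T1) (b + T1) ltac:(lra) ltac:(lra).
have := k (T1 - a) (T1 - b) ltac:(lra) ltac:(lra).
by move=> *; split; lra.
Qed.

(** An antiderivative of the affine function [c + d (z - p)]. *)
Let P (c d p z : C) := c * z + d * ((z - p) ^+ 2 / 2%:R).

Let cdiffP c d p z : cdiff (P c d p) z (c + d * (z - p)).
Proof.
have h1 := cdiffZ c (cdiff_id z).
have h2 := cdiffX 2 (cdiffB (cdiff_id z) (cdiff_cst p z)).
have h3 := cdiffM h2 (cdiff_cst (2%:R^-1) z).
apply: (cdiff_eq (cdiffD h1 (cdiffZ d h3))).
have n2 : (2%:R : C) != 0 by rewrite pnatr_eq0.
by rewrite /= expr1; field.
Qed.

(** [H y] minus [P] has derivative [f] minus the affine function along the edge, so its increment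
    only measures how far [f] is from that function. The increments of [P] cancel around a closed
    rectangle. *)
Lemma hedge (c d p : C) (y a b eta : R) : - T < a -> a < T -> - T < b -> b < T ->
  (forall t, 0 <= t -> t <= 1 -> let z := (a + t * (b - a)) +i* y in
     nm (f z - (c + d * (z - p))) <= eta) ->
  nm ((H y b - P c d p (b +i* y)) - (H y a - P c d p (a +i* y))) <= eta * `|b - a|.
Proof.
move=> a1 a2 b1 b2 hf.
apply: (@mean_valueR _ (fun x => H y x - P c d p (x +i* y))) => t t0 t1.
have [l1 l2] := segment_itv a1 a2 b1 b2 t0 t1.
set x := a + t * (b - a).
exists (f (x +i* y) - (c + d * (x +i* y - p)) * 1); last by rewrite mulr1; exact: hf.
apply: rdiffB; first exact: HH.
have E s : s +i* y = 'i%C * y%:C + s%:C * 1 by rewrite cplxE mulr1 addrC.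
rewrite (_ : (fun s => _) = (fun s => P c d p ('i%C * y%:C + s%:C * 1))); last first.
  by apply/funext => s; rewrite E.
by rewrite E; apply: cdiff_rdiff; exact: cdiffP.
Qed.

Lemma rdiffZ c phi (t : R) (d : C) : rdiff phi t d -> rdiff (fun s => c * phi s) t (c * d).
Proof.
move=> Hd e e0; have c0 : 0 < 1 + nm c by rewrite ltr_pwDl // nm_ge0.
have [del del0 K] := Hd (e / (1 + nm c)) ltac:(by rewrite divr_gt0).
exists del => // s /K h.
rewrite (_ : _ - _ = c * (phi s - phi t - d * (s - t)%:C)); last by ring.
rewrite normcM; apply: (@le_trans _ _ ((1 + nm c) * nm (phi s - phi t - d * (s - t)%:C))).
  by rewrite ler_wpM2r ?nm_ge0 // lerDr.
by rewrite mulrC -ler_pdivlMr // mulrAC.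
Qed.

Lemma vedge (c d p : C) (x a b eta : R) : - T < a -> a < T -> - T < b -> b < T ->
  (forall t, 0 <= t -> t <= 1 -> let z := x +i* (a + t * (b - a)) in
     nm (f z - (c + d * (z - p))) <= eta) ->
  nm (('i%C * V x b - P c d p (x +i* b)) - ('i%C * V x a - P c d p (x +i* a))) <= eta * `|b - a|.
Proof.
move=> a1 a2 b1 b2 hf.
apply: (@mean_valueR _ (fun y => 'i%C * V x y - P c d p (x +i* y))) => t t0 t1.
have [l1 l2] := segment_itv a1 a2 b1 b2 t0 t1.
set y := a + t * (b - a).
exists ('i%C * f (x +i* y) - (c + d * (x +i* y - p)) * 'i%C); last first.
  by rewrite [_ * 'i%C]mulrC -mulrBr normcM nmi mul1r; exact: hf.
apply: rdiffB; first by apply: rdiffZ; exact: HV.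
have E s : x +i* s = x%:C + s%:C * 'i%C by rewrite cplxE mulrC.
rewrite (_ : (fun s => _) = (fun s => P c d p (x%:C + s%:C * 'i%C))); last first.
  by apply/funext => s; rewrite E.
by rewrite E; apply: cdiff_rdiff; exact: cdiffP.
Qed.

(** The integral of [f] around the boundary, counterclockwise. Each side contributes the increment
    of an antiderivative along it; vertical sides carry the factor [i] of [dz = i dy]. *)
Definition rect_int x0 x1 y0 y1 : C :=
  (H y0 x1 - H y0 x0) + 'i%C * (V x1 y1 - V x1 y0)
  - (H y1 x1 - H y1 x0) - 'i%C * (V x0 y1 - V x0 y0).
Local Notation J := rect_int.

Lemma rect_int_bound (c d p : C) x0 x1 y0 y1 eta :
  - T < x0 -> x0 <= x1 -> x1 < T -> - T < y0 -> y0 <= y1 -> y1 < T ->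
  (forall x y, x0 <= x -> x <= x1 -> y0 <= y -> y <= y1 ->
     nm (f (x +i* y) - (c + d * (x +i* y - p))) <= eta) ->
  nm (J x0 x1 y0 y1) <= eta * (2 * ((x1 - x0) + (y1 - y0))).
Proof.
move=> h1 h2 h3 h4 h5 h6 hf.
have x1T : - T < x1 by exact: lt_le_trans h2.
have x0T : x0 < T by exact: le_lt_trans h3.
have y1T : - T < y1 by exact: lt_le_trans h5.
have y0T : y0 < T by exact: le_lt_trans h6.
have B1 := @hedge c d p y0 x0 x1 eta h1 x0T x1T h3.
have B2 := @vedge c d p x1 y0 y1 eta h4 y0T y1T h6.
have B3 := @hedge c d p y1 x0 x1 eta h1 x0T x1T h3.
have B4 := @vedge c d p x0 y0 y1 eta h4 y0T y1T h6.
have dx : `|x1 - x0| = x1 - x0 by rewrite ger0_norm // subr_ge0.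
have dy : `|y1 - y0| = y1 - y0 by rewrite ger0_norm // subr_ge0.
rewrite dx in B1 B3; rewrite dy in B2 B4.
have between (a b t : R) : a <= b -> 0 <= t -> t <= 1 -> a <= a + t * (b - a) /\ a + t * (b - a) <= b.
  by lclear; move=> *; split; nra.
have YY1 := conj (lexx y0) h5; have YY3 := conj h5 (lexx y1).
have YY4 := conj (lexx x0) h2; have YY2 := conj h2 (lexx x1).
have {B1} := B1 (fun t t0 t1 => hf _ _ (between _ _ _ h2 t0 t1).1 (between _ _ _ h2 t0 t1).2 (YY1).1 (YY1).2).
move=> B1.
have {B2} := B2 (fun t t0 t1 => hf _ _ (YY2).1 (YY2).2 (between _ _ _ h5 t0 t1).1 (between _ _ _ h5 t0 t1).2).
move=> B2.
have {B3} := B3 (fun t t0 t1 => hf _ _ (between _ _ _ h2 t0 t1).1 (between _ _ _ h2 t0 t1).2 (YY3).1 (YY3).2).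
move=> B3.
have {B4} := B4 (fun t t0 t1 => hf _ _ (YY4).1 (YY4).2 (between _ _ _ h5 t0 t1).1 (between _ _ _ h5 t0 t1).2).
move=> B4.
set b1 := (X in nm X <= _) in B1; set b2 := (X in nm X <= _) in B2.
set b3 := (X in nm X <= _) in B3; set b4 := (X in nm X <= _) in B4.
rewrite (_ : J x0 x1 y0 y1 = b1 + b2 - b3 - b4); last first.
  by rewrite /J /b1 /b2 /b3 /b4; ring.
have := nm_triD (b1 + b2 - b3) b4; have := nm_triD (b1 + b2) b3.
have := le_normcD b1 b2; move: B1 B2 B3 B4; lclear; lra.
Qed.

Lemma exists_pow2_gt (K : R) : exists n, K < 2 ^+ n.
Proof.
exists (Num.bound `|K|); apply: le_lt_trans (ler_norm _) _.
apply: lt_le_trans (archi_boundP (normr_ge0 _)) _.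
by rewrite -natrX ler_nat ltnW // ltn_expl.
Qed.

Lemma rect_int_quarter (p1 p2 W h : R) : 0 <= W -> 0 <= h -> exists q : R * R,
  [/\ nm (J p1 (p1 + W) p2 (p2 + h)) <=
        4 * nm (J q.1 (q.1 + W / 2) q.2 (q.2 + h / 2)),
      p1 <= q.1, q.1 + W / 2 <= p1 + W, p2 <= q.2 & q.2 + h / 2 <= p2 + h].
Proof.
move=> W0 h0.
pose Q a b := J a (a + W / 2) b (b + h / 2).
have E : J p1 (p1 + W) p2 (p2 + h) =
    Q p1 p2 + Q (p1 + W / 2) p2 + Q p1 (p2 + h / 2) + Q (p1 + W / 2) (p2 + h / 2).
  have w2 : p1 + W / 2 + W / 2 = p1 + W by rewrite -addrA -splitr.
  have h2 : p2 + h / 2 + h / 2 = p2 + h by rewrite -addrA -splitr.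
  by rewrite /Q !w2 !h2 /J; ring.
have N : nm (J p1 (p1 + W) p2 (p2 + h)) <= nm (Q p1 p2) + nm (Q (p1 + W / 2) p2)
    + nm (Q p1 (p2 + h / 2)) + nm (Q (p1 + W / 2) (p2 + h / 2)).
  rewrite E; apply: le_trans (le_normcD _ _) _; rewrite lerD2r.
  by apply: le_trans (le_normcD _ _) _; rewrite lerD2r; exact: le_normcD.
pose j := nm (J p1 (p1 + W) p2 (p2 + h)).
have [a|a] := leP j (4 * nm (Q p1 p2)).
  by exists (p1, p2); split => //=; lra.
have [b|b] := leP j (4 * nm (Q (p1 + W / 2) p2)).
  by exists (p1 + W / 2, p2); split => //=; lra.
have [c|c] := leP j (4 * nm (Q p1 (p2 + h / 2))).
  by exists (p1, p2 + h / 2); split => //=; lra.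
exists (p1 + W / 2, p2 + h / 2); split => /=; try lra.
rewrite -/j; move: N a b c; rewrite -/j /Q; lra.
Qed.

Lemma goursat x0 x1 y0 y1 :
  - T < x0 -> x0 <= x1 -> x1 < T -> - T < y0 -> y0 <= y1 -> y1 < T ->
  (forall x y, x0 <= x -> x <= x1 -> y0 <= y -> y <= y1 ->
     exists d, cdiff f (x +i* y) d) ->
  J x0 x1 y0 y1 = 0.
Proof.
move=> h1 h2 h3 h4 h5 h6 hf.
pose w := x1 - x0; pose h := y1 - y0.
have w0 : 0 <= w by rewrite subr_ge0.
have h0 : 0 <= h by rewrite subr_ge0.
have p2 n : 0 < 2 ^+ n :> R by rewrite exprn_gt0.
have step (np : nat * (R * R)) := @rect_int_quarter np.2.1 np.2.2 (w / 2 ^+ np.1) (h / 2 ^+ np.1)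
   (divr_ge0 w0 (ltW (p2 _))) (divr_ge0 h0 (ltW (p2 _))).
(* [g (n, q)] is the corner of a quarter of the [n]-th rectangle at [q] that carries at least a
   fourth of its integral. *)
have [g Hg] := choice step.
pose c := fix c n := if n is n'.+1 then g (n', c n') else (x0, y0).
have half (u : R) n : u / 2 ^+ n / 2 = u / 2 ^+ n.+1.
  by rewrite exprSr invfM mulrA.
have cS n : [/\ nm (J (c n).1 ((c n).1 + w / 2 ^+ n) (c n).2 ((c n).2 + h / 2 ^+ n)) <=
        4 * nm (J (c n.+1).1 ((c n.+1).1 + w / 2 ^+ n.+1) (c n.+1).2 ((c n.+1).2 + h / 2 ^+ n.+1)),
      (c n).1 <= (c n.+1).1, (c n.+1).1 + w / 2 ^+ n.+1 <= (c n).1 + w / 2 ^+ n,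
      (c n).2 <= (c n.+1).2 & (c n.+1).2 + h / 2 ^+ n.+1 <= (c n).2 + h / 2 ^+ n].
  by have := Hg (n, c n); rewrite /= !half.
have mono1 n m : (c n).1 <= (c (n + m)%N).1 /\
    (c (n + m)%N).1 + w / 2 ^+ (n + m) <= (c n).1 + w / 2 ^+ n.
  elim: m => [|m [i1 i2]]; first by rewrite addn0.
  by rewrite addnS; have [_ a b _ _] := cS (n + m)%N; split;
    [exact: le_trans a|exact: le_trans i2].
have mono2 n m : (c n).2 <= (c (n + m)%N).2 /\
    (c (n + m)%N).2 + h / 2 ^+ (n + m) <= (c n).2 + h / 2 ^+ n.
  elim: m => [|m [i1 i2]]; first by rewrite addn0.
  by rewrite addnS; have [_ _ _ a b] := cS (n + m)%N; split;
    [exact: le_trans a|exact: le_trans i2].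
have nested (s : nat -> R) (u : R) : 0 <= u ->
    (forall n m, s n <= s (n + m)%N /\ s (n + m)%N + u / 2 ^+ (n + m) <= s n + u / 2 ^+ n) ->
    exists X, forall n, s n <= X /\ X <= s n + u / 2 ^+ n.
  move=> u0 hs; have ub n : ubound (range s) (s n + u / 2 ^+ n).
    move=> _ [m _ <-]; have [nm|/ltnW mn] := leqP n m.
      have [_] := hs n (m - n)%N; rewrite subnKC //; apply: le_trans.
      by rewrite lerDl divr_ge0 // ltW.
    have [+ _] := hs m (n - m)%N; rewrite subnKC // => /le_trans; apply.
    by rewrite lerDl divr_ge0 // ltW.
  exists (sup (range s)) => n; split; last by apply: ge_sup => //; exists (s 0%N); exists 0%N.
  by apply: ub_le_sup; [exists (s 0%N + u / 2 ^+ 0); exact: ub|exists n].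
have [X HX] := nested (fun n => (c n).1) w w0 mono1.
have [Y HY] := nested (fun n => (c n).2) h h0 mono2.
have box n : [/\ x0 <= (c n).1, (c n).1 + w / 2 ^+ n <= x1,
    y0 <= (c n).2 & (c n).2 + h / 2 ^+ n <= y1].
  have [a1 a2] := mono1 0%N n; have [b1 b2] := mono2 0%N n.
  move: a1 a2 b1 b2; rewrite !add0n expr0 !divr1 /= /w /h !(addrC _ (_ - _)) !subrK.
  by split.
have [d Hd] : exists d, cdiff f (X +i* Y) d.
  have [] := box 0%N; have [] := HX 0%N; have [] := HY 0%N.
  rewrite /= => y1' y2' x1' x2' b1 b2 b3 b4.
  by apply: hf; [move: x1'|move: x2' b2|move: y1'|move: y2' b4]; lclear; lra.
have bound n : nm (J x0 x1 y0 y1) <=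
    4 ^+ n * nm (J (c n).1 ((c n).1 + w / 2 ^+ n) (c n).2 ((c n).2 + h / 2 ^+ n)).
  elim: n => [|n IH].
    by rewrite expr0 mul1r /= expr0 !divr1 /w /h !(addrC _ (_ - _)) !subrK.
  apply: le_trans IH _; rewrite exprSr -mulrA ler_pM2l ?exprn_gt0 //.
  by have [] := cS n.
apply/eqP; rewrite -nm_eq0 eq_le nm_ge0 andbT.
(* At stage [n] the affine error is [e (w + h) / 2^n] and the perimeter is [2 (w + h) / 2^n]; the
   factor [4^n] lost in the bisections cancels both powers of 2. *)
suff key e : 0 < e -> nm (J x0 x1 y0 y1) <= e * (2 * (w + h) ^+ 2).
  apply/ler_addgt0Pr => e e0; rewrite add0r.
  have K0 : 0 < 2 * (w + h) ^+ 2 + 1 by rewrite ltr_pwDr // mulr_ge0 // sqr_ge0.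
  have := key (e / (2 * (w + h) ^+ 2 + 1)) ltac:(by rewrite divr_gt0).
  move=> /le_trans; apply; rewrite mulrAC ler_pdivrMr // ler_pM2l // lerDl ler01 //.
move=> e0; have [del del0 Hdel] := Hd _ e0.
have [n Hn] := exists_pow2_gt ((w + h) / del).
have Hn' : (w + h) / 2 ^+ n < del.
  by rewrite ltr_pdivrMr // mulrC -ltr_pdivrMr.
have [b1 b2 b3 b4] := box n; have [X1 X2] := HX n; have [Y1 Y2] := HY n.
have wn : 0 <= w / 2 ^+ n by rewrite divr_ge0 // ltW.
have hn : 0 <= h / 2 ^+ n by rewrite divr_ge0 // ltW.
have whn : (w + h) / 2 ^+ n = w / 2 ^+ n + h / 2 ^+ n by rewrite mulrDl.
have le1 : (c n).1 <= (c n).1 + w / 2 ^+ n by rewrite lerDl.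
have le2 : (c n).2 <= (c n).2 + h / 2 ^+ n by rewrite lerDl.
have B := @rect_int_bound (f (X +i* Y)) d (X +i* Y) (c n).1 ((c n).1 + w / 2 ^+ n)
  (c n).2 ((c n).2 + h / 2 ^+ n) (e * ((w + h) / 2 ^+ n))
  (lt_le_trans h1 b1) le1 (le_lt_trans b2 h3) (lt_le_trans h4 b3) le2 (le_lt_trans b4 h6).
apply: le_trans (bound n) _.
have -> : e * (2 * (w + h) ^+ 2) =
    4 ^+ n * (e * ((w + h) / 2 ^+ n) * (2 * ((w + h) / 2 ^+ n))).
  have -> : 4 = 2 ^+ 2 :> R by rewrite expr2 -natrM.
  rewrite -exprM mulnC exprM; have := p2 n; set t := 2 ^+ n => t0.
  by field; rewrite gt_eqF.
rewrite ler_pM2l ?exprn_gt0 //.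
have E : (c n).1 + w / 2 ^+ n - (c n).1 + ((c n).2 + h / 2 ^+ n - (c n).2)
   = (w + h) / 2 ^+ n by rewrite whn; ring.
rewrite E in B; apply: B => x y x1' x2' y1' y2'.
have near : nm (x +i* y - (X +i* Y)) <= (w + h) / 2 ^+ n.
  apply: le_trans (nm_ReIm _) _; rewrite /= whn; apply: lerD; rewrite ler_norml.
    by move: X1 X2 x1' x2'; lclear; lra.
  by move: Y1 Y2 y1' y2'; lclear; lra.
rewrite opprD addrA; apply: le_trans (Hdel _ (le_lt_trans near Hn')) _.
by rewrite ler_pM2l.
Qed.

(** Isolates an exceptional coordinate: the middle piece shrinks with [eta], and each outer piece is
    degenerate or avoids [a], so that [goursat] applies to it. *)
Lemma split_around (x0 x1 a eta : R) : x0 <= a -> a <= x1 -> 0 < eta ->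
  exists2 m : R * R, [/\ x0 <= m.1, m.1 <= m.2 & m.2 <= x1] &
    [/\ a - eta <= m.1, m.2 <= a + eta, m.1 = x0 \/ m.1 < a & m.2 = x1 \/ a < m.2].
Proof.
move=> h1 h2 h3; exists (Num.max x0 (a - eta), Num.min x1 (a + eta)) => /=.
  by split; rewrite ?le_max ?ge_max ?ge_min ?le_min ?lexx ?orbT //; lra.
split; rewrite ?le_max ?ge_max ?ge_min ?le_min ?lexx ?orbT //.
  by rewrite maxEle; case: ifP => _; [right; lra|left].
by rewrite minEle; case: ifP => _; [left|right; lra].
Qed.

Lemma goursat_except z0 x0 x1 y0 y1 :
  - T < x0 -> x0 <= x1 -> x1 < T -> - T < y0 -> y0 <= y1 -> y1 < T ->
  (forall x y, x0 <= x -> x <= x1 -> y0 <= y -> y <= y1 ->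
     x +i* y != z0 -> exists d, cdiff f (x +i* y) d) ->
  J x0 x1 y0 y1 = 0.
Proof.
move=> h1 h2 h3 h4 h5 h6 hf.
set a := Re z0; set b := Im z0.
have z0E : z0 = a +i* b by rewrite /a /b; case: (z0).
have away a0 a1 b0 b1 : x0 <= a0 -> a0 <= a1 -> a1 <= x1 -> y0 <= b0 -> b0 <= b1 -> b1 <= y1 ->
    ~~ [&& a0 <= a, a <= a1, b0 <= b & b <= b1] -> J a0 a1 b0 b1 = 0.
  move=> k1 k2 k3 k4 k5 k6 k7.
  apply: (goursat (lt_le_trans h1 k1) k2 (le_lt_trans k3 h3)
    (lt_le_trans h4 k4) k5 (le_lt_trans k6 h6)).
  move=> x y l1 l2 l3 l4.
  apply: (hf _ _ (le_trans k1 l1) (le_trans l2 k3) (le_trans k4 l3) (le_trans l4 k6)).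
  apply/negP => /eqP E; move/negP: k7; apply.
  have -> : a = x by rewrite /a -E.
  have -> : b = y by rewrite /b -E.
  by apply/and4P; split.
have degx u v w : J u u v w = 0 by rewrite /J; ring.
have degy u v w : J u v w w = 0 by rewrite /J; ring.
have splx m u v w w' : J u v w w' = J u m w w' + J m v w w' by rewrite /J; ring.
have sply m u v w w' : J u v w w' = J u v w m + J u v m w' by rewrite /J; ring.
have [|nin] := boolP [&& x0 <= a, a <= x1, y0 <= b & b <= y1]; last first.
  by apply: away.
move=> /and4P[a0 a1 b0 b1].
have [del del0 Hdel] := @fcont z0 1 ltr01.
apply/eqP; rewrite -nm_eq0 eq_le nm_ge0 andbT.
apply/ler_addgt0Pr => e e0; rewrite add0r.
have K0 : 0 < 8 * (nm (f z0) + 1) by rewrite mulr_gt0 // ltr_wpDl ?nm_ge0.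
(* The middle rectangle has perimeter at most [8 eta] and, since [2 eta < del], lies where [|f|] is
   at most [|f z0| + 1]. *)
pose eta := Num.min (del / 3) (e / (8 * (nm (f z0) + 1))).
have eta0 : 0 < eta by rewrite /eta lt_min !divr_gt0.
have eta1 : eta <= del / 3 by rewrite /eta ge_min lexx.
have eta2 : eta * (8 * (nm (f z0) + 1)) <= e.
  by rewrite -ler_pdivlMr // /eta ge_min lexx orbT.
have [[xm xM] /= [xm1 xx xM1] [xm3 xM3 xm4 xM4]] := split_around a0 a1 eta0.
have [[ym yM] /= [ym1 yy yM1] [ym3 yM3 ym4 yM4]] := split_around b0 b1 eta0.
have L1 : J x0 xm y0 y1 = 0.
  case: xm4 => [->|lt]; first exact: degx.
  by apply: away => //; [exact: le_trans xM1|rewrite [a <= xm]leNgt lt andbF].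
have L2 : J xM x1 y0 y1 = 0.
  case: xM4 => [->|lt]; first exact: degx.
  by apply: away => //; [exact: le_trans xx|rewrite leNgt lt].
have L3 : J xm xM y0 ym = 0.
  case: ym4 => [->|lt]; first exact: degy.
  by apply: away => //; [exact: le_trans yM1|rewrite [b <= ym]leNgt lt !andbF].
have L4 : J xm xM yM y1 = 0.
  case: yM4 => [->|lt]; first exact: degy.
  by apply: away => //; [exact: le_trans yy|rewrite [yM <= b]leNgt lt !andbF].
rewrite (splx xm) L1 add0r (splx xM) L2 addr0 (sply ym) L3 add0r (sply yM) L4 addr0.
have B := @rect_int_bound 0 0 0 xm xM ym yM (nm (f z0) + 1) (lt_le_trans h1 xm1) xx
  (le_lt_trans xM1 h3) (lt_le_trans h4 ym1) yy (le_lt_trans yM1 h6).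
apply: le_trans (B _) _; last first.
  apply: le_trans eta2; have := nm_ge0 (f z0); move: xm3 xM3 ym3 yM3; clear.
  by move=> *; nra.
move=> x y l1 l2 l3 l4; rewrite mul0r addr0 subr0.
have near : nm (x +i* y - z0) < del.
  apply: le_lt_trans (nm_ReIm _) _; rewrite z0E /=.
  have : `|x - a| <= eta by rewrite ler_norml; move: l1 l2 xm3 xM3; lclear; lra.
  have : `|y - b| <= eta by rewrite ler_norml; move: l3 l4 ym3 yM3; lclear; lra.
  by move: eta1 eta0 del0; lclear; lra.
have := Hdel _ near; have := nm_triB (f (x +i* y)) (f z0); lclear; lra.
Qed.

(** [F] integrates along the real axis and then vertically. As integrals around rectangles vanish,
    the increment from [z] to [w] may be taken along an L-shaped path starting at [z], on which [f]
    is close to [f z]. *)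
Lemma primitive_square z0 :
  (forall z, `|Re z| < T -> `|Im z| < T -> z != z0 -> exists d, cdiff f z d) ->
  exists F : C -> C, F 0 = 0 /\
    forall z, `|Re z| < T -> `|Im z| < T -> cdiff F z (f z).
Proof.
move=> hf.
have J0 a1 a2 b1 b2 : `|a1| < T -> `|a2| < T -> `|b1| < T -> `|b2| < T -> J a1 a2 b1 b2 = 0.
  rewrite !ltr_norml => /andP[? ?] /andP[? ?] /andP[? ?] /andP[? ?].
  have base u1 u2 v1 v2 : - T < u1 -> u2 < T -> - T < v1 -> v2 < T ->
      u1 <= u2 -> v1 <= v2 -> J u1 u2 v1 v2 = 0.
    move=> k1 k2 k3 k4 k5 k6.
    apply: (@goursat_except z0 _ _ _ _ k1 k5 k2 k3 k6 k4) => x y l1 l2 l3 l4 ne.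
    apply: hf => //=; rewrite ltr_norml.
      by rewrite (lt_le_trans k1 l1) (le_lt_trans l2 k2).
    by rewrite (lt_le_trans k3 l3) (le_lt_trans l4 k4).
  have sx u1 u2 v1 v2 : J u1 u2 v1 v2 = - J u2 u1 v1 v2 by rewrite /J; ring.
  have sy u1 u2 v1 v2 : J u1 u2 v1 v2 = - J u1 u2 v2 v1 by rewrite /J; ring.
  have [/ltW|] := ltP a1 a2; have [/ltW|] := ltP b1 b2 => *.
  - exact: base.
  - by rewrite sy base ?oppr0.
  - by rewrite sx base ?oppr0.
  - by rewrite sy sx base ?oppr0.
pose F z := (H 0 (Re z) - H 0 0) + 'i%C * (V (Re z) (Im z) - V (Re z) 0).
exists F; split; first by rewrite /F /= !subrr mulr0 addr0.
move=> z hx hy e e0; have e20 : 0 < e / 2 by rewrite divr_gt0.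
have T0 : `|0 : R| < T by rewrite normr0; exact: le_lt_trans hx.
have [del del0 Hdel] := @fcont z _ e20.
pose m := Num.min del (Num.min (T - `|Re z|) (T - `|Im z|)).
exists (m / 2); first by rewrite divr_gt0 // /m !lt_min del0 !subr_gt0 hx.
move=> w hw.
have [m1 m2 m3] : [/\ m <= del, m <= T - `|Re z| & m <= T - `|Im z|].
  by rewrite /m !ge_min !lexx !orbT.
set x := Re z in hx m2 *; set y := Im z in hy m3 *; set u := Re w; set v := Im w.
have zE : z = x +i* y by rewrite /x /y; case: (z).
have wE : w = u +i* v by rewrite /u /v; case: (w).
have du : `|u - x| <= nm (w - z) by rewrite /u /x -raddfB; exact: nmRe.
have dv : `|v - y| <= nm (w - z) by rewrite /v /y -raddfB; exact: nmIm.
have hu : `|u| < T.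
  by have := ler_normD x (u - x); rewrite (addrC x) subrK; move: du hw m2 hx; lclear; lra.
have hv : `|v| < T.
  by have := ler_normD y (v - y); rewrite (addrC y) subrK; move: dv hw m3 hy; lclear; lra.
have E : F w - F z = (H y u - H y x) + 'i%C * (V u v - V u y).
  have := J0 x u 0 y hx hu T0 hy; rewrite /J /F -/x -/y -/u -/v => K.
  apply/eqP; rewrite -subr_eq0; apply/eqP; rewrite -K; ring.
have [x1 x2] : - T < x /\ x < T by apply/andP; rewrite -ltr_norml.
have [y1 y2] : - T < y /\ y < T by apply/andP; rewrite -ltr_norml.
have [u1 u2] : - T < u /\ u < T by apply/andP; rewrite -ltr_norml.
have [v1 v2] : - T < v /\ v < T by apply/andP; rewrite -ltr_norml.
have shrink (s t : R) : 0 <= t -> t <= 1 -> `|t * s| <= `|s|.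
  by move=> t0 t1; rewrite normrM (ger0_norm t0) ler_piMl.
have B1 := @hedge (f z) 0 0 y x u (e / 2) x1 x2 u1 u2 ltac:(
  move=> t t0 t1 /=; rewrite mul0r addr0; apply/ltW; apply: Hdel; rewrite zE;
  apply: le_lt_trans (nm_ReIm _) _; rewrite /= subrr normr0 addr0 (addrC x) addrK;
  have := normr_ge0 (t * (u - x)); have := shrink (u - x) t t0 t1; move: du hw m1; lclear; lra).
have B2 := @vedge (f z) 0 0 u y v (e / 2) y1 y2 v1 v2 ltac:(
  move=> t t0 t1 /=; rewrite mul0r addr0; apply/ltW; apply: Hdel; rewrite zE;
  apply: le_lt_trans (nm_ReIm _) _; rewrite /= (addrC y) addrK;
  have := shrink (v - y) t t0 t1; move: du dv hw m1; lclear; lra).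
rewrite E.
set b1 := (X in nm X <= _) in B1; set b2 := (X in nm X <= _) in B2.
rewrite (_ : _ - f z * _ = b1 + b2); last first.
  have -> : w - z = (u +i* v) - (x +i* y) by rewrite -wE -zE.
  have P0 c0 z1 : P c0 0 0 z1 = c0 * z1 by rewrite /P mul0r addr0.
  by rewrite /b1 /b2 !P0; ring.
apply: le_trans (le_normcD _ _) _; apply: le_trans (lerD B1 B2) _.
rewrite -mulrDr; rewrite mulrAC ler_pdivrMr // -mulrA ler_pM2l //.
by move: du dv; lclear; lra.
Qed.

End Goursat.

Section Primitive.
Context {R : realType}.
Local Notation C := R[i].

Lemma primitive_of_cont (f : C -> C) (T : R) (z0 : C) : (forall z, ccont f z) ->
  (forall z, `|Re z| < T -> `|Im z| < T -> z != z0 -> exists d, cdiff f z d) ->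
  exists F : C -> C, F 0 = 0 /\
    forall z, `|Re z| < T -> `|Im z| < T -> cdiff F z (f z).
Proof.
move=> cf df.
have hH (y : R) : exists Phi : R -> C, forall x, - T < x -> x < T -> rdiff Phi x (f (x +i* y)).
  apply: (@antiderivative _ (fun x => f (x +i* y))) => x e e0.
  have [del del0 Hd] := cf (x +i* y) e e0; exists del => // s hs; apply: Hd.
  by apply: le_lt_trans (nm_ReIm _) _; rewrite /= subrr normr0 addr0.
have hV (x : R) : exists Phi : R -> C, forall y, - T < y -> y < T -> rdiff Phi y (f (x +i* y)).
  apply: (@antiderivative _ (fun y => f (x +i* y))) => y e e0.
  have [del del0 Hd] := cf (x +i* y) e e0; exists del => // s hs; apply: Hd.
  by apply: le_lt_trans (nm_ReIm _) _; rewrite /= subrr normr0 add0r.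
have [H HH] := choice hH; have [V HV] := choice hV.
exact: (primitive_square cf HH HV df).
Qed.

Definition clamp (T t : R) : R := Num.max (- T) (Num.min T t).

Lemma clamp_id (T t : R) : `|t| <= T -> clamp T t = t.
Proof.
rewrite ler_norml => /andP[h1 h2]; rewrite /clamp minEle.
by case: ifP => hT; rewrite maxEle; case: ifP; move: h1 h2 hT; clear; lra.
Qed.

Lemma clamp_le (T t : R) : 0 <= T -> `|clamp T t| <= T.
Proof.
move=> T0; rewrite ler_norml /clamp le_max lexx /= ge_max; apply/andP; split; first lra.
by rewrite ge_min lexx.
Qed.

Lemma clamp_lip (T s t : R) : 0 <= T -> `|clamp T s - clamp T t| <= `|s - t|.
Proof.
move=> T0; rewrite /clamp !maxEle !minEle.
by case: (leP T s); case: (leP T t); move=> a b; repeat case: ifP => ?;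
  rewrite ler_norml; case: (leP 0 (s - t)) => k; rewrite ?(ger0_norm k) ?(ltr0_norm k);
  apply/andP; split; lra.
Qed.

Definition holomorphic (c : C) (r : R) (f : C -> C) :=
  forall z, nm (z - c) < r -> exists d, cdiff f z d.

(** [primitive_of_cont] wants continuity on the whole plane, so [f] is composed with the retraction
    [k] onto the square of half-side [r / 2] about [c], which lies inside the disc of radius [r]. *)
Lemma local_primitive (f : C -> C) (c z0 : C) (r : R) : 0 < r ->
  (forall z, nm (z - c) < r -> ccont f z) ->
  (forall z, nm (z - c) < r -> z != z0 -> exists d, cdiff f z d) ->
  exists F : C -> C, forall z, nm (z - c) < r / 2 -> cdiff F z (f z).
Proof.
move=> r0 cf df.
pose T := r / 2; have T0 : 0 < T by rewrite divr_gt0.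
have T00 := ltW T0.
pose k (z : C) := c + (clamp T (Re z) +i* clamp T (Im z)).
have kc z : nm (k z - c) < r.
  rewrite /k addrC addKr /normc.
  have h1 := clamp_le (Re z) T00; have h2 := clamp_le (Im z) T00.
  rewrite -[ltRHS]ger0_norm ?(ltW r0) // -sqrtr_sqr ltr_sqrt ?exprn_gt0 //.
  move: h1 h2; rewrite !ler_norml => /andP[a1 a2] /andP[b1 b2].
  have : r = T + T by rewrite /T -splitr.
  by move=> ->; move: T0 a1 a2 b1 b2; clear; nra.
have klip z w : nm (k z - k w) <= 2 * nm (z - w).
  have -> : k z - k w = (clamp T (Re z) - clamp T (Re w)) +i* (clamp T (Im z) - clamp T (Im w)).
    by rewrite /k opprD addrACA subrr add0r.
  apply: le_trans (nm_ReIm _) _ => /=.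
  have h1 := clamp_lip (Re z) (Re w) T00; have h2 := clamp_lip (Im z) (Im w) T00.
  have h3 := nmRe (z - w); have h4 := nmIm (z - w).
  by move: h1 h2 h3 h4; rewrite !raddfB /=; clear; lra.
have kid z : `|Re z| <= T -> `|Im z| <= T -> k z = c + z.
  by move=> h1 h2; rewrite /k !clamp_id //; case: (z).
have [||F [_ HF]] := @primitive_of_cont (fun z => f (k z)) T (z0 - c).
- move=> z e e0; have [del del0 Hd] := cf _ (kc z) e e0.
  exists (del / 2); first by rewrite divr_gt0.
  move=> w hw; apply: Hd; apply: le_lt_trans (klip _ _) _.
  by rewrite mulrC -ltr_pdivlMr.
- move=> z h1 h2 ne.
  have kz : k z = c + z by rewrite kid // ltW.
  have [d Hd] : exists d, cdiff f (c + 1 * z) d.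
    rewrite mul1r -kz; apply: df => //; rewrite kz; apply: contra ne => /eqP <-.
    by rewrite addrC addKr.
  exists (d * 1); pose m := Num.min (T - `|Re z|) (T - `|Im z|).
  have m0 : 0 < m by rewrite /m lt_min !subr_gt0 h1.
  apply: (cdiff_near m0 _ (cdiff_compZ Hd)) => w hw; rewrite mul1r kid //.
    have := ler_normD (Re z) (Re w - Re z); have := nmRe (w - z).
    have : m <= T - `|Re z| by rewrite /m ge_min lexx.
    by rewrite raddfB /= (addrC (Re z)) subrK; move: hw; clear; lra.
  have := ler_normD (Im z) (Im w - Im z); have := nmIm (w - z).
  have : m <= T - `|Im z| by rewrite /m ge_min lexx orbT.
  by rewrite raddfB /= (addrC (Im z)) subrK; move: hw; clear; lra.
exists (fun z => F (- c + 1 * z)) => z hz.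
have hR : `|Re (z - c)| < T by apply: le_lt_trans (nmRe _) hz.
have hI : `|Im (z - c)| < T by apply: le_lt_trans (nmIm _) hz.
have := HF _ hR hI; rewrite kid ?ltW // (addrC c) subrK.
by rewrite (_ : z - c = - c + 1 * z) => [/cdiff_compZ|]; rewrite ?mulr1 // mul1r addrC.
Qed.

Lemma cdiff0_const (f : C -> C) (p q : C) :
  (forall t : R, 0 <= t -> t <= 1 -> cdiff f (p + t%:C * (q - p)) 0) -> f q = f p.
Proof.
move=> H; apply/eqP; rewrite -subr_eq0 -nm_eq0 eq_le nm_ge0 andbT.
have := @mean_value _ f p q 0; rewrite mul0r; apply => t t0 t1.
by exists 0; [exact: H|rewrite nm0].
Qed.

Lemma cdiff_ccont (f : C -> C) z d : cdiff f z d -> ccont f z.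
Proof. exact: cdiff_cont. Qed.

(** Primitives on the squares of half-side [n], all normalised to vanish at 0, agree where both are
    defined and glue together. *)
Lemma entire_primitive (f : C -> C) : (forall z, exists d, cdiff f z d) ->
  exists F : C -> C, forall z, cdiff F z (f z).
Proof.
move=> df; have cf z : ccont f z by have [d Hd] := df z; exact: cdiff_ccont Hd.
have ex (n : nat) := @primitive_of_cont f n%:R 0 cf (fun z _ _ _ => df z).
have [F HF] := choice ex.
have agree n m z : (n <= m)%N -> `|Re z| < n%:R -> `|Im z| < n%:R -> F m z = F n z.
  move=> nm_ h1 h2.
  have mn : n%:R <= m%:R :> R by rewrite ler_nat.
  have : F m z - F n z = F m 0 - F n 0; last first.
    by rewrite !(proj1 (HF _)) subrr => /eqP; rewrite subr_eq0 => /eqP.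
  apply: (@cdiff0_const (fun w => F m w - F n w)) => t t0 t1.
  rewrite add0r subr0.
  have tR : Re (t%:C * z) = t * Re z by case: (z) => a b /=; rewrite mul0r subr0.
  have tI : Im (t%:C * z) = t * Im z by case: (z) => a b /=; rewrite mul0r addr0.
  have k1 : `|Re (t%:C * z)| < n%:R.
    by rewrite tR normrM (ger0_norm t0); apply: le_lt_trans h1; rewrite ler_piMl.
  have k2 : `|Im (t%:C * z)| < n%:R.
    by rewrite tI normrM (ger0_norm t0); apply: le_lt_trans h2; rewrite ler_piMl.
  have := cdiffB (proj2 (HF m) _ (lt_le_trans k1 mn) (lt_le_trans k2 mn)) (proj2 (HF n) _ k1 k2).
  by rewrite subrr.
(* The extra 1 leaves room for a disc of radius 1 about [z] on which a single square serves all
   points. *)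
pose N (z : C) := Num.bound (nm z + 1).
have NP z : nm z + 1 < (N z)%:R.
  by apply: archi_boundP; rewrite addr_ge0 ?nm_ge0.
exists (fun z => F (N z) z) => z.
have hz : nm z < (N z)%:R by apply: lt_trans (NP z); rewrite ltrDl.
have := proj2 (HF (N z)) z (le_lt_trans (nmRe z) hz) (le_lt_trans (nmIm z) hz).
apply: (cdiff_near ltr01) => w hw.
have hw2 : nm w < (N z)%:R.
  apply: le_lt_trans (NP z); have := nm_triB w z; move: hw; clear; lra.
have hw1 : nm w < (N w)%:R by apply: lt_trans (NP w); rewrite ltrDl.
have [nm_|/ltnW nm_] := leqP (N z) (N w).
  by rewrite (agree _ _ _ nm_ (le_lt_trans (nmRe w) hw2) (le_lt_trans (nmIm w) hw2)).
by rewrite (agree _ _ _ nm_ (le_lt_trans (nmRe w) hw1) (le_lt_trans (nmIm w) hw1)).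
Qed.

End Primitive.

(** * The complex exponential *)

Section ComplexExponential.
Context {R : realType}.
Local Notation C := R[i].
Implicit Types (z w : C).

Definition cexp z : C := (expR (Re z))%:C * (cos (Im z) +i* sin (Im z)).

Lemma cexpD z w : cexp (z + w) = cexp z * cexp w.
Proof.
rewrite /cexp !raddfD /= expRD cosD sinD rmorphM /= mulrACA; congr (_ * _).
by apply/eqP; rewrite eq_complex /= eqxx /= addrC [cos _ * _ + _]addrC eqxx.
Qed.

Lemma nm_cis (y : R) : nm (cos y +i* sin y) = 1.
Proof. by rewrite /normc cos2Dsin2 sqrtr1. Qed.

Lemma nm_cexp z : nm (cexp z) = expR (Re z).
Proof. by rewrite /cexp normcM nm_cis mulr1 nmC ger0_norm // expR_ge0. Qed.

Lemma cexp_neq0 z : cexp z != 0.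
Proof. by rewrite -nm_gt0 nm_cexp expR_gt0. Qed.

Lemma cexp0 : cexp 0 = 1.
Proof. by rewrite /cexp /= expR0 cos0 sin0 mul1r. Qed.

Lemma cexpN z : cexp (- z) = (cexp z)^-1.
Proof.
apply: (mulIf (cexp_neq0 z)); rewrite -cexpD addNr cexp0 mulVf //; exact: cexp_neq0.
Qed.

Lemma cexpMn z n : cexp (z *+ n) = cexp z ^+ n.
Proof. by elim: n => [|n IH]; rewrite ?mulr0n ?cexp0 // mulrS cexpD IH exprS. Qed.

Lemma cexp_diff0 : cdiff cexp 0 1.
Proof.
(* Errors of size [e' |z|] will be summed six times: once from [exp], four times from cosine and
   sine with the factor [|1 + x| <= 2], and once from the product [x y]. *)
move=> e e0; have [e' [e'0 e'1 e'2]] : exists e' : R, [/\ 0 < e', e' <= 1 & e' * 6 <= e].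
  exists (Num.min 1 (e / 6)); split; first by rewrite lt_min ltr01 divr_gt0.
    by rewrite ge_min lexx.
  by rewrite -ler_pdivlMr // ge_min lexx orbT.
have dexp : is_derive (0 : R) 1 expR 1 by rewrite -[X in is_derive _ _ _ X]expR0; exact: is_derive_expR.
have dcos : is_derive (0 : R) 1 cos 0 by rewrite -[X in is_derive _ _ _ X]oppr0 -[X in - X]sin0; exact: is_derive_cos.
have dsin : is_derive (0 : R) 1 sin 1 by rewrite -[X in is_derive _ _ _ X]cos0; exact: is_derive_sin.
have [d1 d10 H1] := is_derive_eps dexp e'0.
have [d2 d20 H2] := is_derive_eps dcos e'0.
have [d3 d30 H3] := is_derive_eps dsin e'0.
exists (Num.min e' (Num.min d1 (Num.min d2 d3))); first by rewrite !lt_min e'0 d10 d20.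
move=> z; rewrite subr0 !lt_min => /and4P[h0 h1 h2 h3].
set x := Re z; set y := Im z.
have xz : `|x| <= nm z := nmRe z; have yz : `|y| <= nm z := nmIm z.
have := H1 x; rewrite !subr0 expR0 mul1r => /(_ (le_lt_trans xz h1)) {}H1.
have := H2 y; rewrite !subr0 cos0 mul0r subr0 => /(_ (le_lt_trans yz h2)) {}H2.
have := H3 y; rewrite !subr0 sin0 mul1r subr0 => /(_ (le_lt_trans yz h3)) {}H3.
rewrite cexp0 mul1r.
have key (E c s x' y' : R) : E%:C * (c +i* s) - 1 - (x' +i* y') =
    (E - 1 - x')%:C * (c +i* s) + (1 + x')%:C * ((c - 1) +i* (s - y')) + 'i%C * x'%:C * y'%:C.
  by apply/eqP; rewrite eq_complex /=; apply/andP; split; apply/eqP; ring.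
have -> : cexp z - 1 - z = (expR x - 1 - x)%:C * (cos y +i* sin y)
    + (1 + x)%:C * ((cos y - 1) +i* (sin y - y)) + 'i%C * x%:C * y%:C.
  by rewrite -key /cexp -/x -/y; congr (_ - _); rewrite /x /y; case: (z).
have n3 : nm ((cos y - 1) +i* (sin y - y)) <= e' * `|y| + e' * `|y|.
  by apply: le_trans (nm_ReIm _) _; exact: lerD.
have x1 : nm (1 + x)%:C <= 2.
  by rewrite nmC; have := ler_normD 1 x; rewrite normr1; move: xz h0 e'1; clear; lra.
apply: le_trans (le_normcD _ _) _; apply: le_trans (lerD (le_normcD _ _) (lexx _)) _.
rewrite !normcM nm_cis mulr1 nmC nmi mul1r !nmC.
have := nm_ge0 (1 + x)%:C; have z0 := nm_ge0 z.
have k1 : nm (1 + x)%:C * nm ((cos y - 1) +i* (sin y - y)) <= 2 * (e' * nm z + e' * nm z).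
  apply: ler_pM => //; rewrite ?nm_ge0 //; apply: le_trans n3 _.
  by rewrite lerD // ler_pM2l.
have k2 : `|x| * `|y| <= e' * nm z by apply: ler_pM => //; exact: le_trans xz (ltW h0).
have k3 : e' * `|x| <= e' * nm z by rewrite ler_pM2l.
move: H1 k1 k2 k3; rewrite nmC => H1 k1 k2 k3 _.
have k4 : e' * 6 * nm z <= e * nm z by rewrite ler_wpM2r.
by move: H1 k1 k2 k3 k4; clear; lra.
Qed.

Lemma cexp_diff z : cdiff cexp z (cexp z).
Proof.
have h : cdiff cexp (- z + 1 * z) 1 by rewrite mul1r addNr; exact: cexp_diff0.
apply: (cdiff_eq (cdiff_near ltr01 _ (cdiffZ (cexp z) (cdiff_compZ h)))); last by rewrite !mulr1.
by move=> w _ /=; rewrite mul1r -cexpD addNKr.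
Qed.

Lemma cexp_surj w : w != 0 -> exists z, cexp z = w.
Proof.
move=> w0; have n0 : 0 < nm w by rewrite nm_gt0.
pose u := Re w / nm w; pose v := Im w / nm w.
have uv : u ^+ 2 + v ^+ 2 = 1.
  have : nm w ^+ 2 = Re w ^+ 2 + Im w ^+ 2.
    by case: (w) => a b /=; rewrite sqr_sqrtr // addr_ge0 ?sqr_ge0.
  rewrite /u /v !expr_div_n -mulrDl => <-; rewrite divff //.
  by rewrite expf_neq0 // gt_eqF.
have u1 : -1 <= u <= 1.
  have u2 : u ^+ 2 <= 1 by rewrite -uv lerDl sqr_ge0.
  by move: u2; rewrite expr2; clear; move=> u2; apply/andP; split; nra.
(* [acos] fixes the cosine only; the sign of the sine selects the angle or its opposite. *)
have [t [ct st]] : exists t, cos t = u /\ sin t = v.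
  have cu : cos (acos u) = u by apply: acosK; rewrite in_itv.
  have : sin (acos u) ^+ 2 = v ^+ 2.
    by have := cos2Dsin2 (acos u); rewrite cu; move: uv; clear; lra.
  move/eqP; rewrite eqf_sqr => /orP[/eqP sv|/eqP sv]; first by exists (acos u).
  by exists (- acos u); rewrite cosN sinN cu sv opprK.
exists (ln (nm w) +i* t); rewrite /cexp /= ct st lnK ?posrE //.
have n0' : nm w != 0 by rewrite gt_eqF.
by case: (w) @u @v {uv u1 ct st} n0' => a b u v n0'; apply/eqP; rewrite eq_complex /= /u /v !mul0r subr0 addr0; apply/andP; split; apply/eqP; rewrite mulrC divfK.
Qed.

Lemma cexp_2pi : cexp (0 +i* (pi *+ 2)) = 1.
Proof. by rewrite /cexp /= expR0 cos2pi sin2pi mul1r. Qed.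

Definition unity (N : nat) : C := cexp (0 +i* (pi *+ 2 / N%:R)).

Lemma nm_unity N : nm (unity N) = 1.
Proof. by rewrite nm_cexp expR0. Qed.

Lemma unity_expn N m : unity N ^+ m = cexp (0 +i* (pi *+ 2 * (m%:R / N%:R))).
Proof.
rewrite /unity -cexpMn; congr cexp; elim: m => [|m IH].
  by rewrite mulr0n mul0r mulr0.
rewrite mulrS IH -natr1; apply/eqP; rewrite eq_complex /= addr0 eqxx /=.
by apply/eqP; ring.
Qed.

Lemma unity_root N : (0 < N)%N -> unity N ^+ N = 1.
Proof.
by move=> N0; rewrite unity_expn divff ?pnatr_eq0 -?lt0n // mulr1 cexp_2pi.
Qed.

Lemma unity_prim N m : (0 < m < N)%N -> unity N ^+ m != 1.
Proof.
move=> /andP[m0 mN]; apply/negP => /eqP; rewrite unity_expn.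
set th := m%:R / N%:R : R.
have N0 : (0 : R) < N%:R by rewrite ltr0n (leq_trans _ mN).
have th0 : 0 < th by rewrite divr_gt0 // ltr0n.
have th1 : th < 1 by rewrite ltr_pdivrMr // mul1r ltr_nat.
(* A cosine equal to 1 at [2 pi th] makes the sine vanish at [pi th], which lies strictly between 0
   and [pi]. *)
rewrite /cexp /= expR0 mul1r => -[] c1 _.
have := sin_gt0_pi (x := pi * th); rewrite mulr_gt0 ?pi_gt0 //= .
rewrite -[ltRHS]mulr1 ltr_pM2l ?pi_gt0 // th1 => /(_ isT).
have := cosD (pi * th) (pi * th); rewrite -mulr2n -mulrnAl c1.
have := cos2Dsin2 (pi * th).
move: (cos (pi * th)) (sin (pi * th)) => c s; clear; rewrite !expr2; nra.
Qed.

Lemma unity_near1 (e : R) : 0 < e -> exists N0, forall N, (N0 <= N)%N -> nm (unity N - 1) < e.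
Proof.
move=> e0; have [del del0 Hd] := cdiff_cont cexp_diff0 e0.
exists (Num.bound (pi *+ 2 / del)).+1 => N hN; rewrite -cexp0; apply: Hd.
rewrite subr0; apply: le_lt_trans (nm_ReIm _) _; rewrite /= normr0 add0r.
have p0 : 0 < pi *+ 2 :> R by rewrite pmulrn_lgt0 // pi_gt0.
have N0 : (0 : R) < N%:R by rewrite ltr0n (leq_trans _ hN).
rewrite ger0_norm ?divr_ge0 ?ltW // ltr_pdivrMr // mulrC -ltr_pdivrMr //.
apply: lt_le_trans (archi_boundP _) _; first by rewrite divr_ge0 // ltW.
by rewrite ler_nat ltnW.
Qed.

End ComplexExponential.

(** * Cauchy's formula over roots of unity *)

Section Compactness.
Context {R : realType}.
Local Notation C := R[i].

(** Compactness in its working form: an index valid near each point can be chosen uniformly on [K].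
    The filter [\oo] takes the place of finite subcovers. *)
Lemma compact_nat (K : set C^o) (Q : nat -> C -> Prop) : compact K ->
  (forall z, K z -> exists2 e : R, 0 < e & exists J, forall w, nm (w - z) < e ->
     forall j, (J <= j)%N -> Q j w) ->
  exists J, forall j, (J <= j)%N -> forall w, K w -> Q j w.
Proof.
move=> /compact_near_coveringP Kc H.
have [z Kz|J _ HJ] := Kc nat \oo Q _; last by exists J => j Jj w Kw; exact: HJ Kw.
have [e e0 [J HJ]] := H z Kz.
exists ([set w : C^o | nm (w - z) < e], [set j | (J <= j)%N]) => /=.
  by split; [apply/nbhsC_P; exists e|exists J].
by move=> [w j] /= [hw hj]; exact: HJ.
Qed.

Lemma compact_eps (K : set C^o) (Q : R -> C -> Prop) : compact K ->
  (forall e e' w, e' <= e -> Q e w -> Q e' w) ->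
  (forall z, K z -> exists2 e : R, 0 < e & forall w, nm (w - z) < e -> Q e w) ->
  exists2 e : R, 0 < e & forall w, K w -> Q e w.
Proof.
move=> Kc mono H.
have [|J HJ] := @compact_nat K (fun j w => Q (j.+1%:R^-1) w) Kc.
  move=> z /H [e e0 He]; exists e => //; exists (Num.bound e^-1) => w /He Qw j hj.
  apply: mono Qw; rewrite invf_ple ?posrE //.
  have h1 := archi_boundP (ltW (eq_ind_r (fun b => is_true b) e0 (invr_gt0 e))).
  by apply: (le_trans (ltW h1)); rewrite ler_nat leqW.
by exists (J.+1%:R^-1); [rewrite invr_gt0|move=> w Kw; exact: HJ].
Qed.

Definition cdisc (c : C) (r : R) : set C^o := [set z : C^o | nm (z - c) <= r].

Lemma cdisc_compact c r : compact (cdisc c r).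
Proof.
pose B := `[- r, r]%classic `*` `[- r, r]%classic : set (R * R).
pose h (p : R * R) : C^o := c + (p.1 +i* p.2).
have cB : compact (h @` B).
  apply: continuous_compact; last by apply: compact_setX; exact: segment_compact.
  apply: continuous_subspaceT => p A /nbhsC_P [e e0 He].
  have e20 : 0 < e / 2 by rewrite divr_gt0.
  exists (ball p.1 (e / 2), ball p.2 (e / 2)); first by split; exact: nbhsx_ballx.
  move=> [a b] /= [ha hb]; apply: He; rewrite /h opprD addrACA subrr add0r.
  apply: le_lt_trans (nm_ReIm _) _; rewrite /= (splitr e).
  by apply: ltrD; rewrite distrC.
apply: (subclosed_compact _ cB).
- rewrite -openC openE => z /= /negP; rewrite -ltNge => hz; apply/nbhsC_P.
  exists (nm (z - c) - r); first by rewrite subr_gt0.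
  move=> w hw /=; apply/negP; rewrite -ltNge.
  by have := nm_tri w z c; rewrite (nmBC z w); move: hw; clear; lra.
- move=> z hz; exists (Re (z - c), Im (z - c)); last first.
    by rewrite /h (_ : _ +i* _ = z - c) /=; [rewrite addrC subrK|case: (z - c)].
  by split=> /=; rewrite in_itv /= -ler_norml; apply: le_trans hz; [exact: nmRe|exact: nmIm].
Qed.

Lemma ccont_bounded (f : C -> C) (c : C) r : (forall z, nm (z - c) <= r -> ccont f z) ->
  exists2 M : R, 0 < M & forall z, nm (z - c) <= r -> nm (f z) <= M.
Proof.
move=> cf; have [|J HJ] := @compact_nat _ (fun j w => nm (f w) <= j%:R) (cdisc_compact (c:=c) (r:=r)).
  move=> z hz; have [e e0 He] := cf z hz 1 ltr01; exists e => //.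
  exists (Num.bound (nm (f z) + 1)) => w /He hw j hj.
  have : nm (f z) + 1 < j%:R.
    apply: lt_le_trans (archi_boundP _) _; first by rewrite addr_ge0 ?nm_ge0.
    by rewrite ler_nat.
  by have := nm_triB (f w) (f z); move: hw; clear; lra.
exists J.+1%:R; first by rewrite ltr0n.
by move=> z hz; exact: (HJ J.+1 (leqnSn _)).
Qed.

End Compactness.

Section DiscreteCauchy.
Context {R : realType}.
Local Notation C := R[i].
Implicit Types (F f : C -> C).

(** Here the continuity of the derivative enters: [F x - f z * x] has a small derivative on a whole
    segment starting at [z], so the mean value inequality gives a remainder bound uniform in [z]. *)
Lemma uniform_diff F f c r : (forall z, nm (z - c) <= r -> cdiff F z (f z)) ->
  (forall z, nm (z - c) <= r -> ccont f z) -> forall e : R, 0 < e ->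
  exists2 del : R, 0 < del & forall z w, nm (z - c) <= r -> nm (w - c) <= r ->
    nm (w - z) < del -> nm (F w - F z - f z * (w - z)) <= e * nm (w - z).
Proof.
move=> dF cf e e0.
have [||del del0 Hd] := @compact_eps _ _ (fun del w => forall w', nm (w' - w) < del ->
  nm (w' - c) <= r -> nm (f w' - f w) <= e) (cdisc_compact (c:=c) (r:=r)).
- by move=> a b w ba H w' h; apply: H; exact: lt_le_trans ba.
- move=> z hz; have e20 : 0 < e / 2 by rewrite divr_gt0.
  have [del del0 Hd] := cf z hz _ e20.
  have d20 : 0 < del / 2 by rewrite divr_gt0.
  exists (del / 2) => // w hw w' hw' _.
  have h1 : nm (f w - f z) < e / 2 by apply: Hd; move: hw del0; clear; lra.
  have h2 : nm (f w' - f z) < e / 2.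
    by apply: Hd; have := nm_tri w w' z; move: hw hw'; clear; lra.
  by have := nm_tri (f z) (f w') (f w); rewrite (nmBC (f z)); move: h1 h2; clear; lra.
exists del => // z w hz hw hzw.
have := @mean_value _ (fun x => F x - f z * x) z w e.
rewrite (_ : F w - f z * w - (F z - f z * z) = F w - F z - f z * (w - z)); last by ring.
apply=> t t0 t1; set x := z + t%:C * (w - z).
have xz : nm (x - z) <= nm (w - z).
  by rewrite /x addrC addKr normcM nmC (ger0_norm t0) ler_piMl ?nm_ge0.
have xc : nm (x - c) <= r.
  rewrite (_ : x - c = (1 - t)%:C * (z - c) + t%:C * (w - c)); last first.
    by rewrite /x rmorphB rmorph1; ring.
  apply: le_trans (le_normcD _ _) _; rewrite !normcM !nmC (ger0_norm t0).
  rewrite ger0_norm ?subr_ge0 //; move: hz hw t0 t1; clear.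
  move: (nm (z - c)) (nm (w - c)) => a b; nra.
exists (f x - f z); first exact: (cdiffB (dF _ xc) (cdiff_eq (cdiffZ (f z) (cdiff_id x)) (mulr1 _))).
by apply: Hd => //; exact: le_lt_trans xz hzw.
Qed.

Lemma sum_unity N : (1 < N)%N -> \sum_(j < N) @unity R N ^+ j = 0.
Proof.
move=> N1; have := subrX1 (@unity R N) N; rewrite unity_root ?(ltnW N1) // subrr.
move=> /esym /eqP; rewrite mulf_eq0 => /orP[|/eqP //].
by rewrite subr_eq0 -[X in X == _]expr1 (negbTE (@unity_prim R N 1 _)).
Qed.

Local Notation node r N j := (r%:C * @unity R N ^+ j).

Lemma nm_node (r : R) N j : 0 < r -> nm (node r N j) = r.
Proof. by move=> r0; rewrite normcM nmX nm_unity expr1n mulr1 nmC gtr0_norm. Qed.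

Lemma node_sub_neq0 (r : R) N j w : 0 < r -> nm w < r -> node r N j - w != 0.
Proof.
by move=> r0 wr; rewrite subr_eq0; apply/eqP => E; rewrite -E nm_node // ltxx in wr.
Qed.

(* Differentiating in s the average of F over the circle of radius s r around (1 - s) w gives
   a Riemann sum of a total derivative, which telescopes. *)
Lemma discrete_cauchy F f r : 0 < r -> (forall z, nm z <= r -> cdiff F z (f z)) ->
  (forall z, nm z <= r -> ccont f z) -> forall e : R, 0 < e ->
  exists N0, forall N, (N0 <= N)%N -> forall w, nm w < r ->
   nm (\sum_(j < N) F (node r N j) * (node r N j / (node r N j - w))
       - F w * \sum_(j < N) node r N j / (node r N j - w)) <= e * N%:R.
Proof.
move=> r0 dF cf e e0.
have er0 : 0 < e / r by rewrite divr_gt0.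
have [||del del0 Hd] := @uniform_diff F f 0 r _ _ _ er0.
- by move=> z; rewrite subr0; exact: dF.
- by move=> z; rewrite subr0; exact: cf.
have [N0 HN0] := @unity_near1 R (del / r) ltac:(by rewrite divr_gt0).
(* With at least two nodes the root of unity differs from 1 and the nodes sum to 0. *)
exists (maxn N0 2) => N; rewrite geq_max => /andP[/HN0 hN N2] w wr.
set om := @unity R N in hN *; pose pj j := node r N j.
pose phi (s : C) := \sum_(j < N) F (w + (pj j - w) * s) * (pj j / (pj j - w)).
have p1 : phi 1 = \sum_(j < N) F (pj j) * (pj j / (pj j - w)).
  by apply: eq_bigr => j _; rewrite mulr1 (addrC w) subrK.
have p0 : phi 0 = F w * \sum_(j < N) pj j / (pj j - w).
  by rewrite mulr_sumr; apply: eq_bigr => j _; rewrite mulr0 addr0.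
rewrite -p1 -p0.
have := @mean_value _ phi 0 1 (e * N%:R); rewrite subr0 normc1 mulr1; apply=> t t0 t1.
rewrite add0r mulr1.
pose q j := w + (pj j - w) * t%:C.
have npj j : nm (pj j) = r by exact: nm_node.
have qr j : nm (q j) <= r.
  rewrite (_ : q j = (1 - t)%:C * w + t%:C * pj j); last first.
    by rewrite /q rmorphB rmorph1; ring.
  apply: le_trans (le_normcD _ _) _; rewrite normcM [nm (_ * pj j)]normcM npj !nmC (ger0_norm t0).
  rewrite ger0_norm ?subr_ge0 //; move: (ltW wr) t0 t1; clear.
  by move: (nm w) => a; nra.
exists (\sum_(j < N) f (q j) * pj j).
  have H (j : 'I_N) := cdiffM (cdiff_compZ (dF _ (qr j)))
    (cdiff_cst (pj j / (pj j - w)) t%:C).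
  apply: (cdiff_eq (cdiff_sum _ H)); apply: eq_bigr => j _.
  by rewrite mulr0 add0r mulrC -mulrA (mulrC (pj j - w)) divfK // node_sub_neq0.
(* At [t = 0] every [q j] is [w] and the derivative is a multiple of the sum of the nodes. The
   argument below divides by [t] and cannot include this case. *)
move: t0; rewrite le_eqVlt => /orP[/eqP t0|t0].
  have -> : \sum_(j < N) f (q j) * pj j = 0.
    transitivity (\sum_(j < N) f w * r%:C * om ^+ j).
      by apply: eq_bigr => j _; rewrite /q -t0 rmorph0 mulr0 addr0 /pj mulrA.
    by rewrite -mulr_sumr sum_unity // mulr0.
  by rewrite nm0 mulr_ge0 // ltW.
have qS j : q j.+1 - q j = t%:C * (om - 1) * pj j.
  by rewrite /q /pj exprS -/om; ring.
have tele : \sum_(0 <= j < N) (F (q j.+1) - F (q j)) = 0.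
  rewrite telescope_sumr // /q /pj unity_root ?expr0 ?subrr //; exact: ltn_trans N2.
have om1 : 0 < nm (om - 1).
  by rewrite nm_gt0 subr_eq0 -[om]expr1 unity_prim.
have tom : 0 < nm (t%:C * (om - 1)).
  by rewrite normcM nmC gtr0_norm // mulr_gt0.
(* Multiplied by [t (om - 1)], the derivative becomes the sum of [f (q j) (q j.+1 - q j)]. The
   increments of [F] telescope to 0, so only [N] remainders are left, each at most
   [e |t (om - 1)|]. *)
rewrite -(ler_pM2r tom) -normcM.
have -> : (\sum_(j < N) f (q j) * pj j) * (t%:C * (om - 1)) =
   - \sum_(0 <= j < N) (F (q j.+1) - F (q j) - f (q j) * (q j.+1 - q j)).
  rewrite sumrB tele sub0r opprK big_mkord mulr_suml; apply: eq_bigr => j _.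
  by rewrite qS; ring.
rewrite normcN; apply: le_trans (nm_sum _ _) _.
have -> : e * N%:R * nm (t%:C * (om - 1)) = \sum_(0 <= j < N) e * nm (t%:C * (om - 1)).
  by rewrite sumr_const_nat subn0 -mulr_natr; ring.
apply: ler_sum_nat => j _.
have -> : e * nm (t%:C * (om - 1)) = e / r * nm (q j.+1 - q j).
  rewrite qS [in RHS]normcM npj (mulrC _ r) mulrA divfK //; exact: lt0r_neq0.
apply: (Hd (q j) (q j.+1)); rewrite ?subr0 //.
rewrite qS normcM npj normcM nmC gtr0_norm // -ltr_pdivlMr //.
by apply: le_lt_trans hN; rewrite ler_piMl ?nm_ge0.
Qed.

(** Times [1 - x^N] with [x = w / r], each term is a finite geometric sum in [x / om^j]; summing
    over [j], orthogonality of the roots of unity leaves the exponent 0 only. The factor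
    [1 / (1 - x^N)] is the defect of the discrete kernel and tends to 1. *)
Lemma unity_kernel (r : R) N w : (0 < N)%N -> 0 < r -> nm w < r ->
  \sum_(j < N) node r N j / (node r N j - w) = N%:R / (1 - (w / r%:C) ^+ N).
Proof.
move=> N0 r0 wr; set om := @unity R N; set x := w / r%:C.
have rC : r%:C != 0 :> C by rewrite -nm_gt0 nmC gtr0_norm.
have om0 : om != 0 by exact: cexp_neq0.
have x1 : nm x < 1 by rewrite normcM normcV nmC gtr0_norm // ltr_pdivrMr // mul1r.
have xN : 1 - x ^+ N != 0.
  rewrite subr_eq0; apply/eqP => E.
  by have := exprn_ilt1 N (nm_ge0 x) x1; rewrite -nmX -E normc1 ltxx eqn0Ngt N0.
apply: (mulIf xN); rewrite divfK // mulr_suml.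
have term j : node r N j / (node r N j - w) * (1 - x ^+ N) =
    \sum_(i < N) x ^+ i * (om ^- i) ^+ j.
  have omj : om ^+ j != 0 by rewrite expf_neq0.
  pose u := x / om ^+ j.
  have uN : u ^+ N = x ^+ N.
    by rewrite /u expr_div_n -exprM mulnC exprM unity_root // expr1n divr1.
  have u1 : 1 - u != 0.
    rewrite subr_eq0; apply/eqP => E; move: x1.
    by rewrite -[x](divfK omj) -/u -E mul1r nmX nm_unity expr1n ltxx.
  have -> : node r N j / (node r N j - w) = (1 - u)^-1.
    have -> : node r N j - w = node r N j * (1 - u).
      by rewrite /u /x; field; rewrite rC omj.
    by rewrite invfM mulrA divff ?mul1r // mulf_neq0.
  have E : 1 - u ^+ N = (1 - u) * \sum_(i < N) u ^+ i by rewrite -opprB subrX1 -mulNr opprB.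
  rewrite -uN E mulKf //; apply: eq_bigr => i _.
  by rewrite /u expr_div_n; congr (_ * _); rewrite exprVn -!exprM mulnC.
under eq_bigr do rewrite term.
rewrite exchange_big /= (bigD1 (Ordinal N0)) //= [X in _ + X]big1 ?addr0.
  under eq_bigr do rewrite expr0 invr1 expr1n mulr1.
  by rewrite sumr_const card_ord.
move=> i i0; rewrite -mulr_sumr.
have iN : (0 < i < N)%N by rewrite ltn_ord lt0n -val_eqE in i0 *; rewrite i0.
have := subrX1 (om ^- i) N; rewrite exprVn -exprM mulnC exprM unity_root // expr1n invr1 subrr.
move=> /esym /eqP; rewrite mulf_eq0 subr_eq0 => /orP[|/eqP ->]; last by rewrite mulr0.
by rewrite invr_eq1 (negbTE (unity_prim iN)).
Qed.

End DiscreteCauchy.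

(** * Cauchy's estimates for functions with a continuous derivative *)

Section CauchyEstimates.
Context {R : realType}.
Local Notation C := R[i].
Implicit Types (F f : C -> C).
Local Notation node r N j := (r%:C * unity N ^+ j).

Section AtOrigin.
Context (F f : C -> C) (r M : R).
Hypothesis r0 : 0 < r.
Hypothesis dF : forall z, nm z <= r -> cdiff F z (f z).
Hypothesis cf : forall z, nm z <= r -> ccont f z.
Hypothesis FM : forall z, nm z = r -> nm (F z) <= M.

Lemma max_modulus_at0 : nm (F 0) <= M.
Proof.
apply/ler_addgt0Pr => e e0; have [N0 HN] := discrete_cauchy r0 dF cf e0.
pose N := maxn N0 1; have N1 : (0 < N)%N by rewrite leq_max orbT.
have := HN N (leq_maxl _ _) 0; rewrite nm0 => /(_ r0).
have nz j : node r N j != 0 :> C by rewrite -nm_gt0 nm_node.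
under eq_bigr do rewrite subr0 divff ?mulr1 //.
rewrite [X in F 0 * X](eq_bigr (fun=> 1)) => [|j _]; last by rewrite subr0 divff.
rewrite sumr_const card_ord [F 0 * _]mulr_natr => h.
have h2 : nm (\sum_(j < N) F (node r N j)) <= M * N%:R.
  apply: le_trans (nm_sum _ _) _; rewrite mulr_natr -[X in _ <= _ *+ X](card_ord N) -sumr_const.
  by apply: ler_sum => j _; apply: FM; exact: nm_node.
have N0' : (0 : R) < N%:R by rewrite ltr0n.
rewrite -(ler_pM2r N0') mulrDl -[X in X <= _](_ : nm (F 0 *+ N) = _); last first.
  by rewrite normcMn mulr_natr.
have := nm_triB (F 0 *+ N) (\sum_(j < N) F (node r N j)).
by rewrite nmBC; move: h h2; lra.
Qed.

Let M0 : 0 <= M.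
Proof. by apply: le_trans (nm_ge0 (F r%:C)) (FM _); rewrite nmC gtr0_norm. Qed.

(** The discrete first Taylor coefficient at 0. *)
Let A N : C := N%:R^-1 * \sum_(j < N) F (node r N j) / node r N j.

Let nmA N : (0 < N)%N -> nm (A N) <= M / r.
Proof.
move=> N0; rewrite /A normcM normcV nm_nat mulrC ler_pdivrMr ?ltr0n //.
apply: le_trans (nm_sum _ _) _; rewrite mulr_natr -[X in _ <= _ *+ X](card_ord N) -sumr_const.
apply: ler_sum => j _; rewrite normcM normcV nm_node // ler_pM2r ?invr_gt0 //.
by apply: FM; exact: nm_node.
Qed.

(** The kernel is [1 / (1 - u) = 1 + u + u^2 / (1 - u)] with [u = w / node]. The first two terms
    give [F 0] and [A N * w]; the third is at most [2 |u|^2] because [|u| <= 1/2]. Three errors of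
    [e / 3] remain: the discretisations at [w] and at 0, and the factor [1 / (1 - x^N)]. *)
Let approx w : nm w <= r / 2 -> forall e : R, 0 < e -> exists N0, forall N, (N0 <= N)%N ->
  (0 < N)%N /\ nm (F w - F 0 - A N * w) <= 2 * M * (nm w / r) ^+ 2 + e.
Proof.
move=> wr e e0; have e30 : 0 < e / 3 by rewrite divr_gt0.
have wr' : nm w < r by apply: le_lt_trans wr _; rewrite ltr_pdivrMr // ltr_pMr // ltr1n.
have [N0 HN] := discrete_cauchy r0 dF cf e30.
have [N1 HN1] := exists_pow2_gt (2 * nm (F w) / (e / 3)).
exists (maxn (maxn N0 N1) 1) => N; rewrite !geq_max => /andP[/andP[hN0 hN1] hN]; split => //.
have Nn : (0 : R) < N%:R by rewrite ltr0n.
have NC : (N%:R : C) != 0 by rewrite pnatr_eq0 -lt0n.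
have nz j : node r N j != 0 :> C by rewrite -nm_gt0 nm_node.
have k1 := HN N hN0 w wr'; have := HN N hN0 0; rewrite nm0 => /(_ r0) k2.
rewrite unity_kernel // in k1.
set x := w / r%:C in k1.
have nx : nm x = nm w / r by rewrite normcM normcV nmC gtr0_norm.
have nx2 : nm x <= 2^-1 by rewrite nx ler_pdivrMr // mulrC.
pose K j := node r N j / (node r N j - w).
pose S := N%:R^-1 * \sum_(j < N) F (node r N j) * K j.
pose S0 := N%:R^-1 * \sum_(j < N) F (node r N j).
have eN : nm (N%:R^-1 : C) * (e / 3 * N%:R) = e / 3.
  by rewrite normcV nm_nat mulrC mulfK // gt_eqF.
have a1 : nm (S - F w / (1 - x ^+ N)) <= e / 3.
  rewrite -eN (_ : S - _ = N%:R^-1 * (\sum_(j < N) F (node r N j) * K j - F w * (N%:R / (1 - x ^+ N)))).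
    by rewrite normcM ler_pM2l // normcV nm_nat invr_gt0.
  by rewrite mulrBr /S; congr (_ - _); rewrite mulrCA mulKf.
have a2 : nm (S0 - F 0) <= e / 3.
  rewrite -eN (_ : S0 - _ = N%:R^-1 * (\sum_(j < N) F (node r N j) * (node r N j / (node r N j - 0))
     - F 0 * \sum_(j < N) node r N j / (node r N j - 0))).
    by rewrite normcM ler_pM2l // normcV nm_nat invr_gt0.
  rewrite mulrBr /S0; congr (_ - _).
    by congr (_ * _); apply: eq_bigr => j _; rewrite subr0 divff ?mulr1.
  rewrite (eq_bigr (fun=> 1)) => [|j _]; last by rewrite subr0 divff.
  by rewrite sumr_const card_ord mulrCA mulVf ?mulr1.
have a3 : nm (S - S0 - A N * w) <= 2 * M * nm x ^+ 2.
  have -> : S - S0 - A N * w =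
      N%:R^-1 * \sum_(j < N) F (node r N j) * (K j - 1 - w / node r N j).
    rewrite /S /S0 /A -mulrBr -mulrA -mulrBr; congr (_ * _).
    by rewrite mulr_suml -!sumrB; apply: eq_bigr => j _; ring.
  rewrite normcM normcV nm_nat mulrC ler_pdivrMr //.
  apply: le_trans (nm_sum _ _) _; rewrite mulr_natr -[X in _ <= _ *+ X](card_ord N) -sumr_const.
  apply: ler_sum => j _; rewrite normcM mulrAC.
  rewrite (_ : 2 * nm x ^+ 2 * M = M * (2 * nm x ^+ 2)); last by ring.
  apply: ler_pM; rewrite ?nm_ge0 //; first by apply: FM; exact: nm_node.
  pose u := w / node r N j.
  have nu : nm u = nm x by rewrite /u normcM normcV nm_node // nx.
  have u1 : 1 - u != 0.
    rewrite subr_eq0; apply/eqP => E; move: nx2; rewrite -nu -E normc1.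
    by move: (r0); lra.
  have -> : K j - 1 - w / node r N j = u ^+ 2 / (1 - u).
    have wE : w = node r N j * u by rewrite /u mulrC divfK.
    have gen (b v : C) : b != 0 -> 1 - v != 0 -> b / (b - b * v) - 1 - v = v ^+ 2 / (1 - v).
      move=> b0 v1; rewrite (_ : b - b * v = b * (1 - v)); last by ring.
      by field; rewrite ?b0 ?v1.
    by rewrite /K -/u {1}wE gen.
  rewrite normcM normcV nmX nu mulrC ler_wpM2r ?exprn_ge0 ?nm_ge0 //.
  have h : 2^-1 <= nm (1 - u) by have := nm_triB 1 u; rewrite normc1 nu; move: nx2; lra.
  rewrite -[leRHS]invrK lef_pV2 // ?posrE ?invr_gt0 //.
  by apply: lt_le_trans h; rewrite invr_gt0.
have a4 : nm (F w / (1 - x ^+ N) - F w) <= e / 3.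
  have p2 : (0 : R) < 2 ^+ N by rewrite exprn_gt0.
  have xN : nm (x ^+ N) <= (2 ^+ N)^-1.
    by rewrite nmX -exprVn lerXn2r ?nnegrE ?nm_ge0 // invr_ge0.
  have xN2 : nm (x ^+ N) <= 2^-1.
    apply: le_trans xN _; rewrite lef_pV2 ?posrE // -[leLHS]expr1.
    by rewrite ler_eXn2l // ltr1n.
  have h : 2^-1 <= nm (1 - x ^+ N).
    by have := nm_triB 1 (x ^+ N); rewrite normc1; move: xN2; lra.
  have h0 : 0 < nm (1 - x ^+ N) by apply: lt_le_trans h; rewrite invr_gt0.
  have u1 : 1 - x ^+ N != 0 by rewrite -nm_gt0.
  have -> : F w / (1 - x ^+ N) - F w = F w * x ^+ N / (1 - x ^+ N) by field.
  rewrite normcM normcV ler_pdivrMr // normcM.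
  have l1 : nm (F w) * nm (x ^+ N) <= nm (F w) / 2 ^+ N by rewrite ler_wpM2l ?nm_ge0.
  apply: (le_trans l1); apply: (@le_trans _ _ (e / 3 * 2^-1)); last by rewrite ler_pM2l.
  rewrite ler_pdivrMr //.
  have : 2 * nm (F w) / (e / 3) <= 2 ^+ N.
    by apply: ltW; apply: lt_le_trans HN1 _; rewrite ler_eXn2l // ltr1n.
  by rewrite ler_pdivrMr // mulrAC ler_pdivlMr // mulrC [2 ^+ N * _]mulrC.
rewrite -nx.
rewrite (_ : F w - F 0 - A N * w = - (F w / (1 - x ^+ N) - F w) - (S - F w / (1 - x ^+ N))
    + (S - S0 - A N * w) + (S0 - F 0)); last by ring.
apply: le_trans (le_normcD _ _) _.
have := le_normcD (- (F w / (1 - x ^+ N) - F w) - (S - F w / (1 - x ^+ N))) (S - S0 - A N * w).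
have := nm_triD (- (F w / (1 - x ^+ N) - F w)) (S - F w / (1 - x ^+ N)).
by rewrite normcN; move: a1 a2 a3 a4; lra.
Qed.

Let zero_disc : nm (0 : C) <= r. Proof. by rewrite nm0 ltW. Qed.

(** A test point at which the quadratic remainder of [approx] and the remainder of the derivative
    are both at most [eta |w|]; comparing the two expansions there identifies [A N] with [f 0] up to
    a multiple of [eta]. *)
Let small (eta : R) : 0 < eta -> exists w : C, [/\ 0 < nm w, nm w <= r / 2,
   2 * M * (nm w / r) ^+ 2 <= eta * nm w & nm (F w - F 0 - f 0 * w) <= eta * nm w].
Proof.
move=> eta0; have [del del0 Hd] := dF zero_disc eta0.
have K0 : 0 < 2 * M + 1 by rewrite ltr_wpDl // mulr_ge0.
pose s := Num.min (del / 2) (Num.min (r / 2) (eta * r ^+ 2 / (2 * M + 1))).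
have s0 : 0 < s by rewrite /s !lt_min !divr_gt0 // mulr_gt0 // exprn_gt0.
have [s1 s2 s3] : [/\ s <= del / 2, s <= r / 2 & s <= eta * r ^+ 2 / (2 * M + 1)].
  by rewrite /s !ge_min !lexx !orbT.
exists s%:C; rewrite nmC gtr0_norm //; split => //.
  rewrite expr_div_n mulrA ler_pdivrMr ?exprn_gt0 // expr2 mulrA -mulrA mulrCA.
  rewrite -[leRHS]mulrA [leRHS]mulrCA ler_pM2l //.
  move: s3; rewrite ler_pdivlMr // => s3; apply: le_trans s3.
  by rewrite mulrC ler_pM2l // lerDl.
have := Hd s%:C; rewrite subr0 nmC gtr0_norm //; apply.
by move: s1 del0; lra.
Qed.

Lemma cauchy_deriv_at0 : nm (f 0) <= M / r.
Proof.
apply/ler_addgt0Pr => e e0; have e30 : 0 < e / 3 by rewrite divr_gt0.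
have [w [w0 wr w2 w1]] := small e30.
have [N0 HN] := approx wr (mulr_gt0 e30 w0).
have [Np k] := HN N0 (leqnn _); have a := nmA Np.
rewrite -(ler_pM2r w0) -normcM.
rewrite (_ : f 0 * w = A N0 * w + (F w - F 0 - A N0 * w) - (F w - F 0 - f 0 * w)); last by ring.
have := nm_triD (A N0 * w + (F w - F 0 - A N0 * w)) (F w - F 0 - f 0 * w).
have := le_normcD (A N0 * w) (F w - F 0 - A N0 * w).
have : nm (A N0 * w) <= M / r * nm w by rewrite normcM ler_pM2r.
move: w1 w2 k; rewrite mulrDl; lra.
Qed.

Lemma cauchy_quad_at0 w : nm w <= r / 2 ->
  nm (F w - F 0 - f 0 * w) <= 2 * M * (nm w / r) ^+ 2.
Proof.
move=> wr; apply/ler_addgt0Pr => e e0.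
have K0 : 0 < nm w + 1 by rewrite ltr_wpDl // nm_ge0.
pose eta := e / 2 / 3 / (nm w + 1).
have eta0 : 0 < eta by rewrite !divr_gt0.
have eta1 : 3 * eta * nm w <= e / 2.
  rewrite (_ : 3 * eta * nm w = (e / 2) * (nm w / (nm w + 1))); last first.
    by rewrite /eta; field; rewrite gt_eqF.
  by rewrite ger_pMr ?divr_gt0 // ler_pdivrMr // mul1r lerDl.
have [v [v0 vr v2 v1]] := small eta0.
have [N0 HN0] := approx vr (mulr_gt0 eta0 v0).
have e20 : 0 < e / 2 by rewrite divr_gt0.
have [N1 HN1] := approx wr e20.
pose N := maxn N0 N1.
have [_ k0] := HN0 N (leq_maxl _ _); have [_ k1] := HN1 N (leq_maxr _ _).
have d : nm (A N - f 0) <= 3 * eta.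
  rewrite -(ler_pM2r v0) -normcM.
  rewrite (_ : (A N - f 0) * v = (F v - F 0 - f 0 * v) - (F v - F 0 - A N * v)); last by ring.
  by apply: le_trans (nm_triD _ _) _; move: v2 v1 k0; lra.
rewrite (_ : F w - F 0 - f 0 * w = (F w - F 0 - A N * w) + (A N - f 0) * w); last by ring.
apply: le_trans (le_normcD _ _) _.
have : nm ((A N - f 0) * w) <= 3 * eta * nm w by rewrite normcM ler_wpM2r ?nm_ge0.
by move: k1 eta1; lra.
Qed.

End AtOrigin.

Section AtPoint.
Context (F f : C -> C) (c : C) (r M : R).
Hypothesis r0 : 0 < r.
Hypothesis dF : forall z, nm (z - c) <= r -> cdiff F z (f z).
Hypothesis cf : forall z, nm (z - c) <= r -> ccont f z.
Hypothesis FM : forall z, nm (z - c) = r -> nm (F z) <= M.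

Let shift z : nm (c + 1 * z - c) = nm z.
Proof. by rewrite mul1r addrC addKr. Qed.

Let dF' z : nm z <= r -> cdiff (fun z => F (c + 1 * z)) z (f (c + 1 * z)).
Proof.
move=> hz; apply: (cdiff_eq (cdiff_compZ (dF _))); last by rewrite mulr1.
by rewrite shift.
Qed.

Let cf' z : nm z <= r -> ccont (fun z => f (c + 1 * z)) z.
Proof.
move=> hz e e0; have [|del del0 Hd] := cf (z := c + 1 * z) _ e0; first by rewrite shift.
by exists del => // w hw; apply: Hd; rewrite opprD addrACA subrr add0r -mulrBr mul1r.
Qed.

Let FM' z : nm z = r -> nm (F (c + 1 * z)) <= M.
Proof. by move=> hz; apply: FM; rewrite shift. Qed.

Lemma C1_max_modulus : nm (F c) <= M.
Proof. by have := max_modulus_at0 r0 dF' cf' FM'; rewrite mulr0 addr0. Qed.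

Lemma C1_cauchy_deriv : nm (f c) <= M / r.
Proof. by have := cauchy_deriv_at0 r0 dF' cf' FM'; rewrite mulr0 addr0. Qed.

Lemma C1_cauchy_quad w : nm (w - c) <= r / 2 ->
  nm (F w - F c - f c * (w - c)) <= 2 * M * (nm (w - c) / r) ^+ 2.
Proof.
move=> h; have := cauchy_quad_at0 r0 dF' cf' FM' h.
by rewrite !mul1r !addr0 (addrC c) subrK.
Qed.

End AtPoint.

End CauchyEstimates.

(** * Holomorphic functions *)

Section Completeness.
Context {R : realType}.
Local Notation C := R[i].

Definition tends (u : nat -> C) (l : C) := forall e : R, 0 < e ->
  exists N, forall n, (N <= n)%N -> nm (u n - l) < e.

Lemma real_cauchy (u : nat -> R) :
  (forall e : R, 0 < e -> exists N, forall n m, (N <= n)%N -> (N <= m)%N -> `|u n - u m| < e) ->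
  exists l, forall e : R, 0 < e -> exists N, forall n, (N <= n)%N -> `|u n - l| < e.
Proof.
move=> H; have cv : cvg (u @ \oo).
  apply/cauchy_cvgP/cauchy_exP => e e0; have [N HN] := H e e0.
  by exists (u N); exists N => // n /= Nn; rewrite /ball /=; apply: HN.
exists (lim (u @ \oo)) => e e0; move/cvgrPdist_lt : cv => /(_ e e0) [N _ HN].
by exists N => n Nn; rewrite distrC; exact: HN.
Qed.

Lemma cauchy_tends (u : nat -> C) :
  (forall e : R, 0 < e -> exists N, forall n m, (N <= n)%N -> (N <= m)%N -> nm (u n - u m) < e) ->
  exists l, tends u l.
Proof.
move=> H.
have [|a Ha] := @real_cauchy (fun n => Re (u n)).
  move=> e /H [N HN]; exists N => n m Nn Nm; apply: le_lt_trans (HN _ _ Nn Nm).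
  by rewrite -raddfB; exact: nmRe.
have [|b Hb] := @real_cauchy (fun n => Im (u n)).
  move=> e /H [N HN]; exists N => n m Nn Nm; apply: le_lt_trans (HN _ _ Nn Nm).
  by rewrite -raddfB; exact: nmIm.
exists (a +i* b) => e e0; have e20 : 0 < e / 2 by rewrite divr_gt0.
have [N1 H1] := Ha _ e20; have [N2 H2] := Hb _ e20.
exists (maxn N1 N2) => n; rewrite geq_max => /andP[/H1 h1 /H2 h2].
apply: le_lt_trans (nm_ReIm _) _; rewrite !raddfB /= (splitr e); exact: ltrD.
Qed.

Lemma tends_le (u : nat -> C) l c M : tends u l -> (forall n, nm (u n - c) <= M) -> nm (l - c) <= M.
Proof.
move=> ul H; apply/ler_addgt0Pr => e /ul [N /(_ N (leqnn N))] h.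
by have := nm_tri (u N) l c; rewrite (nmBC l (u N)); have := H N; move: h; clear; lra.
Qed.

Lemma ccontB (f g : C -> C) z : ccont f z -> ccont g z -> ccont (fun w => f w - g w) z.
Proof.
move=> cf cg e e0; have e20 : 0 < e / 2 by rewrite divr_gt0.
have [d1 d10 H1] := cf _ e20; have [d2 d20 H2] := cg _ e20.
exists (Num.min d1 d2); first by rewrite lt_min d10.
move=> w; rewrite lt_min => /andP[/H1 h1 /H2 h2].
rewrite (_ : _ - _ = (f w - f z) - (g w - g z)); last by ring.
by apply: le_lt_trans (nm_triD _ _) _; move: h1 h2; clear; lra.
Qed.

Lemma ccontZ (f : C -> C) (k : C) z : ccont f z -> ccont (fun w => k * f w) z.
Proof.
move=> cf e e0; have K0 : 0 < nm k + 1 by rewrite ltr_wpDl ?nm_ge0.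
have [d1 d10 H1] := cf (e / (nm k + 1)) ltac:(by rewrite divr_gt0).
exists d1 => // w /H1; rewrite ltr_pdivlMr // => h; rewrite -mulrBr normcM.
apply: le_lt_trans h; rewrite mulrC ler_wpM2l ?nm_ge0 // lerDl //.
Qed.

Lemma ccont_shift (f : C -> C) (h : C) z : ccont f (z + h) -> ccont (fun w => f (w + h)) z.
Proof.
move=> cf e e0; have [d d0 H] := cf e e0; exists d => // w hw; apply: H.
by rewrite (_ : w + h - (z + h) = w - z); last by ring.
Qed.

Lemma cdiff_shift (f : C -> C) (h : C) z d : cdiff f (z + h) d -> cdiff (fun w => f (w + h)) z d.
Proof.
move=> H e e0; have [del del0 Hd] := H e e0; exists del => // w hw.
have E : w + h - (z + h) = w - z by ring.
by have := Hd (w + h); rewrite E; apply.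
Qed.

End Completeness.

Section Holomorphic.
Context {R : realType}.
Local Notation C := R[i].
Implicit Types (F f g : C -> C) (c z w : C) (r : R).

(** By the quadratic estimate, difference quotients of [F] converge to [f] at a linear rate,
    uniformly. The difference of two such quotients, with steps [h] and [k], has as derivative the
    same difference of quotients of [f]; Cauchy's estimate bounds it, so the quotients of [f] form a
    Cauchy family, whose limit is [g]. *)
Lemma C1_second F f c rho : 0 < rho ->
  (forall z, nm (z - c) < 8 * rho -> cdiff F z (f z)) ->
  (forall z, nm (z - c) < 8 * rho -> ccont f z) ->
  exists g : C -> C, exists2 K : R, 0 < K & forall z, nm (z - c) <= rho -> forall h, nm h <= rho ->
    nm (f (z + h) - f z - g z * h) <= K * nm h ^+ 2.
Proof.
move=> r0 dF cf.
have cF z : nm (z - c) <= 4 * rho -> ccont F z.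
  move=> hz; apply: cdiff_ccont (dF z _); move: hz r0; clear; lra.
have [M M0 FM] := ccont_bounded cF.
(* The constant of the quadratic estimate on a circle of radius [2 rho], after division by [|h|]. *)
pose K1 := M / (2 * rho ^+ 2).
have K10 : 0 < K1 by rewrite divr_gt0 // mulr_gt0 // exprn_gt0.
have ltr0Sn2 : (0 : R) < 2 by [].
have step1 y h : nm (y - c) <= 2 * rho -> h != 0 -> nm h <= rho ->
    nm (h^-1 * (F (y + h) - F y) - f y) <= K1 * nm h.
  move=> hy h0 hr.
  have k z : nm (z - y) <= 2 * rho -> nm (z - c) <= 4 * rho.
    by move=> hz; have := nm_tri y z c; move: hz hy; clear; lra.
  have k8 z : nm (z - y) <= 2 * rho -> nm (z - c) < 8 * rho.
    by move=> /k; move: r0; clear; lra.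
  have := @C1_cauchy_quad R F f y (2 * rho) M (mulr_gt0 ltr0Sn2 r0)
    (fun z hz => dF z (k8 z hz)) (fun z hz => cf z (k8 z hz)) _ (y + h).
  have yh : y + h - y = h by ring.
  rewrite yh => H.
  have hn : 0 < nm h by rewrite nm_gt0.
  rewrite -(ler_pM2r hn) -normcM.
  rewrite (_ : (_ - f y) * h = F (y + h) - F y - f y * h); last by field.
  apply: le_trans (H _ _) _.
  - by move=> z /eqP; rewrite eq_le => /andP[+ _] => /k; exact: FM.
  - by move: hr; clear; lra.
  - by rewrite /K1 le_eqVlt; apply/orP; left; apply/eqP; field; rewrite gt_eqF.
have K20 : 0 < K1 / rho by rewrite divr_gt0.
have step2 z h k : nm (z - c) <= rho -> h != 0 -> nm h <= rho -> k != 0 -> nm k <= rho ->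
    nm (h^-1 * (f (z + h) - f z) - k^-1 * (f (z + k) - f z)) <= K1 / rho * (nm h + nm k).
  move=> hz h0 hr k0 kr.
  pose E y := h^-1 * (F (y + h) - F y) - k^-1 * (F (y + k) - F y).
  pose e y := h^-1 * (f (y + h) - f y) - k^-1 * (f (y + k) - f y).
  have b8 y u : nm (y - z) <= rho -> nm u <= rho -> nm (y + u - c) < 8 * rho.
    move=> hy hu; have := nm_tri z (y + u) c; have := le_normcD (y - z) u.
    rewrite addrAC; move: hy hu hz r0; clear; lra.
  have b80 y : nm (y - z) <= rho -> nm (y - c) < 8 * rho.
    by move=> hy; have := b8 y 0 hy; rewrite nm0 addr0; apply; exact: ltW.
  rewrite mulrAC; apply: (@C1_cauchy_deriv R E e z rho) => // y hy.
  - apply: cdiffB; apply: cdiffZ; apply: cdiffB.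
    + by apply: cdiff_shift; apply: dF; exact: b8.
    + by apply: dF; exact: b80.
    + by apply: cdiff_shift; apply: dF; exact: b8.
    + by apply: dF; exact: b80.
  - apply: ccontB; apply: ccontZ; apply: ccontB.
    + by apply: ccont_shift; apply: cf; exact: b8.
    + by apply: cf; exact: b80.
    + by apply: ccont_shift; apply: cf; exact: b8.
    + by apply: cf; exact: b80.
  - have hy2 : nm (y - c) <= 2 * rho.
      by have := nm_tri z y c; move: hy hz; clear; lra.
    rewrite (_ : E y = (h^-1 * (F (y + h) - F y) - f y) - (k^-1 * (F (y + k) - F y) - f y)); last first.
      by rewrite /E; ring.
    apply: le_trans (nm_triD _ _) _; rewrite [leRHS]mulrDr.
    by apply: lerD; exact: step1.
have lim z : exists l, nm (z - c) <= rho -> forall h, h != 0 -> nm h <= rho ->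
    nm (h^-1 * (f (z + h) - f z) - l) <= K1 / rho * nm h.
  have [hz|] := leP (nm (z - c)) rho; last by exists 0.
  pose hn (n : nat) : C := (rho / n.+1%:R)%:C.
  have hn0 n : hn n != 0 by rewrite -nm_gt0 nmC normr_gt0 gt_eqF // divr_gt0.
  have hnE n : nm (hn n) = rho / n.+1%:R by rewrite nmC gtr0_norm // divr_gt0.
  have hnr n : nm (hn n) <= rho.
    by rewrite hnE ler_pdivrMr // ler_pMr // ler1n.
  have small e : 0 < e -> exists N, forall n, (N <= n)%N -> K1 / rho * nm (hn n) < e.
    move=> e0; exists (Num.bound (K1 / e)) => n Nn.
    rewrite hnE mulrA divfK ?gt_eqF // ltr_pdivrMr // mulrC -ltr_pdivrMr //.
    apply: lt_le_trans (archi_boundP _) _; first by rewrite divr_ge0 // ltW.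
    by rewrite ler_nat ltnW.
  have [|l Hl] := @cauchy_tends R (fun n => (hn n)^-1 * (f (z + hn n) - f z)).
    move=> e e0; have [N HN] := small (e / 2) ltac:(by rewrite divr_gt0).
    exists N => n m /HN h1 /HN h2.
    apply: le_lt_trans (step2 _ _ _ hz (hn0 n) (hnr n) (hn0 m) (hnr m)) _.
    by rewrite [ltLHS]mulrDr; move: h1 h2; clear; lra.
  exists l => _ h h0 hr; apply/ler_addgt0Pr => e e0.
  have e20 : 0 < e / 2 by rewrite divr_gt0.
  have [N1 H1] := small _ e20; have [N2 H2] := Hl _ e20.
  pose N := maxn N1 N2.
  have := H1 N (leq_maxl _ _); have := H2 N (leq_maxr _ _).
  have := step2 _ _ _ hz h0 hr (hn0 N) (hnr N); rewrite [leRHS]mulrDr.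
  set a := _ * (f (z + h) - f z); set b := _ * (f (z + hn N) - f z).
  by have := nm_tri b a l; clear; lra.
have [g Hg] := choice lim.
exists g; exists (K1 / rho) => // z hz h hr.
have [->|h0] := eqVneq h 0; first by rewrite addr0 subrr mulr0 subr0 nm0 expr0n mulr0.
have := Hg z hz h h0 hr.
have hn : 0 < nm h by rewrite nm_gt0.
rewrite -(ler_pM2r hn) -normcM mulrBl mulrAC mulVf // mul1r.
by move=> /le_trans; apply; rewrite expr2 mulrA.
Qed.

Lemma C1_second_cdiff f g c rho K : 0 < rho -> 0 < K ->
  (forall h, nm h <= rho -> nm (f (c + h) - f c - g c * h) <= K * nm h ^+ 2) -> cdiff f c (g c).
Proof.
move=> r0 K0 H e e0; exists (Num.min rho (e / K)); first by rewrite lt_min r0 divr_gt0.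
move=> w; rewrite lt_min => /andP[h1 h2].
have := H (w - c) (ltW h1); rewrite (addrC c) subrK => /le_trans; apply.
by rewrite expr2 mulrA ler_wpM2r ?nm_ge0 // mulrC -ler_pdivlMr // ltW.
Qed.

(** [g] lies within [K s] of the difference quotient of [f] with a fixed step [s], and that quotient
    is continuous. *)
Lemma C1_second_cont f g c rho K : 0 < rho -> 0 < K ->
  (forall z, nm (z - c) < 2 * rho -> ccont f z) ->
  (forall z, nm (z - c) <= rho -> forall h, nm h <= rho ->
     nm (f (z + h) - f z - g z * h) <= K * nm h ^+ 2) -> ccont g c.
Proof.
move=> r0 K0 cf H e e0.
pose s := Num.min rho (e / (4 * K)).
have s0 : 0 < s by rewrite /s lt_min r0 divr_gt0 // mulr_gt0.
have sr : s <= rho by rewrite /s ge_min lexx.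
have sK : K * s <= e / 4.
  have : s <= e / (4 * K) by rewrite /s ge_min lexx orbT.
  by rewrite invfM mulrA ler_pdivlMr // mulrC.
pose h : C := s%:C.
have nh : nm h = s by rewrite nmC gtr0_norm.
have c1 : ccont (fun z => f (z + h) - f z) c.
  apply: ccontB; last by apply: cf; rewrite subrr nm0 mulr_gt0.
  apply: ccont_shift; apply: cf; rewrite addrC addKr nh; move: sr r0; clear; lra.
have [del del0 Hd] := c1 (e / 4 * s) ltac:(by rewrite mulr_gt0 // divr_gt0).
exists (Num.min del rho); first by rewrite lt_min del0.
move=> z; rewrite lt_min => /andP[/Hd h1 h2].
have k1 := H z (ltW h2) h; rewrite nh in k1; have {}k1 := k1 sr.
have k2 := H c ltac:(by rewrite subrr nm0 ltW) h; rewrite nh in k2; have {}k2 := k2 sr.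
have Kss : K * s ^+ 2 <= e / 4 * s by rewrite expr2 mulrA ler_pM2r.
rewrite -(ltr_pM2r s0) -[X in _ * X < _]nh -normcM.
rewrite (_ : (g z - g c) * h = (f (z + h) - f z - (f (c + h) - f c))
   - (f (z + h) - f z - g z * h) + (f (c + h) - f c - g c * h)); last by ring.
apply: le_lt_trans (le_normcD _ _) _.
have := nm_triD (f (z + h) - f z - (f (c + h) - f c)) (f (z + h) - f z - g z * h).
have : 0 < e * s by rewrite mulr_gt0.
by move: h1 k1 k2 Kss; clear; lra.
Qed.

Definition dv f : C -> C := (f : C^o -> C^o)^`()%classic.

Lemma cdiff_dv f z d : cdiff f z d -> dv f z = d.
Proof. exact: cdiff_derive1. Qed.

Lemma hol_cdiff f c r z : holomorphic c r f -> nm (z - c) < r -> cdiff f z (dv f z).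
Proof. by move=> H /H [d Hd]; rewrite (cdiff_dv Hd). Qed.

Lemma hol_sub f c r c' r' : holomorphic c r f -> nm (c' - c) + r' <= r -> holomorphic c' r' f.
Proof.
by move=> H hr z hz; apply: H; have := nm_tri c' z c; move: hz hr; clear; lra.
Qed.

Lemma C1_hol F f c r : 0 < r -> (forall z, nm (z - c) < r -> cdiff F z (f z)) ->
  (forall z, nm (z - c) < r -> ccont f z) -> holomorphic c r f.
Proof.
move=> r0 dF cf z hz.
pose rho := (r - nm (z - c)) / 8.
have rho0 : 0 < rho by rewrite divr_gt0 // subr_gt0.
have k w : nm (w - z) < 8 * rho -> nm (w - c) < r.
  move=> hw; have := nm_tri z w c; have -> : nm (z - c) = r - 8 * rho by rewrite /rho; field.
  by move: hw; clear; lra.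
have [g [K K0 Hg]] := C1_second rho0 (fun w hw => dF w (k w hw)) (fun w hw => cf w (k w hw)).
exists (g z); apply: (C1_second_cdiff rho0 K0); apply: Hg; by rewrite subrr nm0 ltW.
Qed.

(** Goursat's theorem tolerates the point [z0], so [f] has local primitives of class C^1, and
    derivatives of such functions are holomorphic. *)
Lemma removable f c r z0 : 0 < r -> (forall z, nm (z - c) < r -> ccont f z) ->
  (forall z, nm (z - c) < r -> z != z0 -> exists d, cdiff f z d) -> holomorphic c r f.
Proof.
move=> r0 cf df z hz.
pose s := r - nm (z - c); have s0 : 0 < s by rewrite subr_gt0.
have k w : nm (w - z) < s -> nm (w - c) < r.
  by move=> hw; have := nm_tri z w c; move: hw; rewrite /s; clear; lra.
have [F HF] := local_primitive s0 (fun w hw => cf w (k w hw)) (fun w hw => df w (k w hw)).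
have s20 : 0 < s / 2 by rewrite divr_gt0.
apply: (C1_hol s20 HF); last by rewrite subrr nm0.
by move=> w hw; apply: cf; apply: k; move: hw s0; clear; lra.
Qed.

Lemma hol_ccont f c r z : holomorphic c r f -> nm (z - c) < r -> ccont f z.
Proof. by move=> H /H [d]; exact: cdiff_ccont. Qed.

(** As the derivative of a local primitive, [f] has first-order expansions with a quadratic
    remainder whose constant is locally uniform, and this makes its own derivative continuous. From
    here on Cauchy's estimates apply to [f] itself. *)
Lemma hol_dv_cont f c r z : holomorphic c r f -> nm (z - c) < r -> ccont (dv f) z.
Proof.
move=> hf hz.
pose s := (r - nm (z - c)) / 2; have s0 : 0 < s by rewrite divr_gt0 // subr_gt0.
have k w : nm (w - z) < 2 * s -> nm (w - c) < r.
  have E : nm (z - c) = r - 2 * s by rewrite /s; field.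
  by move=> hw; have := nm_tri z w c; rewrite E; move: hw; clear; lra.
have k2 w : nm (w - z) < s -> nm (w - c) < r by move=> hw; apply: k; move: hw s0; clear; lra.
have [F HF] := @local_primitive R f z z (2 * s) ltac:(by rewrite mulr_gt0)
  (fun w hw => hol_ccont hf (k w hw)) (fun w hw _ => hf w (k w hw)).
have HF' w : nm (w - z) < s -> cdiff F w (f w).
  have -> : s = 2 * s / 2 by field.
  exact: HF.
pose rho := s / 8; have rho0 : 0 < rho by rewrite divr_gt0.
have e8 : 8 * rho = s by rewrite /rho; field.
have HF8 w : nm (w - z) < 8 * rho -> cdiff F w (f w) by rewrite e8; exact: HF'.
have cf8 w : nm (w - z) < 8 * rho -> ccont f w by rewrite e8 => /k2; exact: hol_ccont.
have [g [K K0 Hg]] := C1_second rho0 HF8 cf8.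
have rs : 2 * rho < s by rewrite -e8; move: rho0; clear; lra.
have cg : ccont g z.
  apply: (C1_second_cont rho0 K0) Hg => w hw; apply: (hol_ccont hf); apply: k2.
  exact: lt_trans rs.
have dg w : nm (w - z) < rho -> dv f w = g w.
  by move=> hw; apply: cdiff_dv; apply: (C1_second_cdiff rho0 K0); apply: Hg; exact: ltW.
move=> e e0; have [del del0 Hd] := cg e e0.
exists (Num.min del rho); first by rewrite lt_min del0.
by move=> w; rewrite lt_min => /andP[h1 h2]; rewrite !dg ?subrr ?nm0 //; exact: Hd.
Qed.

Lemma hol_dv f c r : holomorphic c r f -> holomorphic c r (dv f).
Proof.
move=> hf; have [r0|r0] := ltP 0 r; last first.
  by move=> z hz; have := le_lt_trans (nm_ge0 (z - c)) (lt_le_trans hz r0); rewrite ltxx.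
by apply: (C1_hol r0) => z hz; [exact: (hol_cdiff hf)|exact: (hol_dv_cont hf)].
Qed.

Section Estimates.
Context (f : C -> C) (c : C) (r s M : R).
Hypotheses (r0 : 0 < r) (rs : r < s) (hf : holomorphic c s f).
Hypothesis fM : forall z, nm (z - c) = r -> nm (f z) <= M.

Let df z : nm (z - c) <= r -> cdiff f z (dv f z).
Proof. by move=> hz; apply: (hol_cdiff hf); exact: le_lt_trans rs. Qed.
Let cdf z : nm (z - c) <= r -> ccont (dv f) z.
Proof. by move=> hz; apply: (hol_dv_cont hf); exact: le_lt_trans rs. Qed.

Lemma cauchy_deriv : nm (dv f c) <= M / r.
Proof. exact: C1_cauchy_deriv r0 df cdf fM. Qed.

Lemma cauchy_quad w : nm (w - c) <= r / 2 ->
  nm (f w - f c - dv f c * (w - c)) <= 2 * M * (nm (w - c) / r) ^+ 2.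
Proof. exact: C1_cauchy_quad r0 df cdf fM w. Qed.

End Estimates.

End Holomorphic.

(** * Isolated zeros and Hurwitz's theorem *)

Section LocalTheory.
Context {R : realType}.
Local Notation C := R[i].
Implicit Types (f g h : C -> C) (c z w : C) (r s M : R).
Local Notation node r N j := (r%:C * unity N ^+ j).

Lemma hol_ext f g c r : (forall z, nm (z - c) < r -> f z = g z) -> holomorphic c r f ->
  holomorphic c r g.
Proof.
move=> fg hf z hz; have [d Hd] := hf z hz; exists d.
have m0 : 0 < r - nm (z - c) by rewrite subr_gt0.
apply: (cdiff_near m0 _ Hd) => w hw; apply: fg.
by have := nm_tri z w c; move: hw; clear; lra.
Qed.

Lemma hol_cst k c r : holomorphic c r (fun=> k).
Proof. by move=> z _; exists 0; exact: cdiff_cst. Qed.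

Lemma hol_D f g c r : holomorphic c r f -> holomorphic c r g ->
  holomorphic c r (fun z => f z + g z).
Proof. by move=> hf hg z hz; have [d Hd] := hf z hz; have [e He] := hg z hz; exists (d + e); exact: cdiffD. Qed.

Lemma hol_B f g c r : holomorphic c r f -> holomorphic c r g ->
  holomorphic c r (fun z => f z - g z).
Proof. by move=> hf hg z hz; have [d Hd] := hf z hz; have [e He] := hg z hz; exists (d - e); exact: cdiffB. Qed.

Lemma hol_M f g c r : holomorphic c r f -> holomorphic c r g ->
  holomorphic c r (fun z => f z * g z).
Proof.
move=> hf hg z hz; have [d Hd] := hf z hz; have [e He] := hg z hz.
by eexists; exact: (cdiffM Hd He).
Qed.

Lemma hol_X f n c r : holomorphic c r f -> holomorphic c r (fun z => f z ^+ n).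
Proof. by move=> hf z hz; have [d Hd] := hf z hz; eexists; exact: (cdiffX n Hd). Qed.

Lemma hol_V f c r : (forall z, nm (z - c) < r -> f z != 0) -> holomorphic c r f ->
  holomorphic c r (fun z => (f z)^-1).
Proof.
by move=> f0 hf z hz; have [d Hd] := hf z hz; eexists; exact: (cdiffV (f0 z hz) Hd).
Qed.

(** The discrete Cauchy formula off the centre: [r / (r - |z - c|)] bounds the kernel and 2 bounds
    [|1 - x^N|]. Linearity in [M] is what [zero_order] exploits. *)
Lemma off_center_bound f c r s M z : 0 < r -> r < s -> holomorphic c s f ->
  (forall w, nm (w - c) = r -> nm (f w) <= M) -> nm (z - c) < r ->
  nm (f z) <= 2 * M * r / (r - nm (z - c)).
Proof.
move=> r0 rs hf fM zr.
pose F w := f (c + 1 * w).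
have sh w : c + 1 * w - c = w by ring.
have hs w : nm w <= r -> nm (c + 1 * w - c) < s by rewrite sh => /le_lt_trans; apply.
have dF w : nm w <= r -> cdiff F w (dv f (c + 1 * w)).
  move=> hw; apply: (cdiff_eq (cdiff_compZ (hol_cdiff hf (hs w hw)))).
  by rewrite mulr1.
have cF w : nm w <= r -> ccont (fun w => dv f (c + 1 * w)) w.
  move=> hw e e0; have [del del0 Hd] := hol_dv_cont hf (hs w hw) e0.
  by exists del => // v hv; apply: Hd; rewrite (_ : _ - _ = v - w); last by ring.
set w := z - c in zr *.
have Fz : F w = f z by rewrite /F mul1r /w addrC subrK.
rewrite -Fz.
have q0 : 0 < r - nm w by rewrite subr_gt0.
apply/ler_addgt0Pr => e e0; have e20 : 0 < e / 2 by rewrite divr_gt0.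
have [N0 HN] := discrete_cauchy r0 dF cF e20.
pose N := maxn N0 1; have N1 : (0 < N)%N by rewrite leq_max orbT.
have Nn : (0 : R) < N%:R by rewrite ltr0n.
have := HN N (leq_maxl _ _) w zr; rewrite unity_kernel //.
set x := w / r%:C; set S := \sum_(j < N) _ => h.
have nx : nm (x ^+ N) <= 1.
  rewrite nmX exprn_ile1 ?nm_ge0 // /x normcM normcV nmC gtr0_norm //.
  by rewrite ler_pdivrMr // mul1r ltW.
have bS : nm S <= M * r / (r - nm w) * N%:R.
  apply: le_trans (nm_sum _ _) _; rewrite mulr_natr -[X in _ <= _ *+ X](card_ord N) -sumr_const.
  apply: ler_sum => j _; rewrite normcM -[leRHS]mulrA; apply: ler_pM; rewrite ?nm_ge0 //.
    by apply: (fM (c + 1 * node r N j)); rewrite sh nm_node.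
  rewrite normcM normcV nm_node // ler_pM2l // lef_pV2 ?posrE //; last first.
    by rewrite nm_gt0 node_sub_neq0.
  by have := nm_triB (node r N j) w; rewrite nm_node.
have d2 : nm (1 - x ^+ N) <= 2.
  by have := nm_triD 1 (x ^+ N); rewrite normc1; move: nx; clear; lra.
have d0 : 0 < nm (1 - x ^+ N).
  rewrite nm_gt0 subr_eq0; apply/eqP => E.
  have x1 : nm x < 1 by rewrite normcM normcV nmC gtr0_norm // ltr_pdivrMr // mul1r.
  by have := exprn_ilt1 N (nm_ge0 x) x1; rewrite -nmX -E normc1 ltxx eqn0Ngt N1.
have key : nm (F w) * N%:R <= nm (F w * (N%:R / (1 - x ^+ N))) * 2.
  rewrite mulrA normcM normcV normcM nm_nat -mulrA ler_peMr ?mulr_ge0 ?nm_ge0 //.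
  by rewrite mulrC ler_pdivlMr // mul1r.
rewrite -(ler_pM2r Nn); apply: (le_trans key).
have := nm_triB (F w * (N%:R / (1 - x ^+ N))) S; rewrite nmBC => t.
have -> : (2 * M * r / (r - nm w) + e) * N%:R =
   2 * (M * r / (r - nm w) * N%:R) + 2 * (e / 2 * N%:R).
  by field; rewrite gt_eqF.
by move: t h bS; lra.
Qed.

(** Differentiability of [f] at [c] makes the quotient continuous there, and the singularity is
    removable. *)
Lemma hol_div f c r : 0 < r -> holomorphic c r f -> f c = 0 ->
  exists2 g, holomorphic c r g & forall z, f z = (z - c) * g z.
Proof.
move=> r0 hf fc.
have cc : nm (c - c) < r by rewrite subrr nm0.
pose g z := if z == c then dv f c else f z / (z - c).
have off z : nm (z - c) < r -> z != c -> exists d, cdiff g z d.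
  move=> hz zc; have z0 : z - c != 0 by rewrite subr_eq0.
  have [d Hd] := hf z hz.
  have hq := cdiffM Hd (@cdiffV R (fun w => w - c) z _ z0 (cdiffB (cdiff_id z) (cdiff_cst c z))).
  have zc0 : 0 < nm (z - c) by rewrite nm_gt0.
  eexists; apply: (cdiff_near zc0 _ hq).
  move=> w hw; rewrite /g ifN //; apply: contraTneq hw => ->.
  by rewrite nmBC ltxx.
exists g; last first.
  move=> z; rewrite /g; have [->|zc] := eqVneq z c; first by rewrite subrr mul0r.
  by rewrite mulrC divfK // subr_eq0.
apply: (@removable R g c r c) => // z hz.
have [->|zc] := eqVneq z c; last by have [d Hd] := off z hz zc; exact: cdiff_ccont Hd.
move=> e e0; have e20 : 0 < e / 2 by rewrite divr_gt0.
have [del del0 Hd] := hol_cdiff hf cc e20.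
exists del => // w hw; rewrite /g eqxx; have [_|wc] := eqVneq w c.
  by rewrite subrr nm0.
have wn : 0 < nm (w - c) by rewrite nm_gt0 subr_eq0.
have := Hd w hw; rewrite fc subr0 => h.
rewrite -(ltr_pM2r wn) -normcM mulrBl divfK ?subr_eq0 //.
by apply: (le_lt_trans h); rewrite ltr_pM2r // ltr_pdivrMr // ltr_pMr // ltr1n.
Qed.

(** If every power of [z - c] divides [f], the quotients are at most [M / rho^m] on a circle of
    radius [rho], hence [|f z|] is at most a constant times [(|z - c| / rho)^m], which tends to
    0. *)
Lemma zero_order f c r : 0 < r -> holomorphic c r f ->
  (forall z, nm (z - c) < r -> f z = 0) \/
  exists m h, [/\ holomorphic c r h, h c != 0 & forall z, f z = (z - c) ^+ m * h z].
Proof.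
move=> r0 hf; have [H|H] := pselect (exists m h, [/\ holomorphic c r h, h c != 0 &
  forall z, f z = (z - c) ^+ m * h z]); [by right|left].
have all_m m : exists2 h, holomorphic c r h & forall z, f z = (z - c) ^+ m * h z.
  elim: m => [|m [h hh fh]]; first by exists f => // z; rewrite expr0 mul1r.
  have [hc|hc] := eqVneq (h c) 0; last by case: H; exists m, h.
  have [g hg gh] := hol_div r0 hh hc; exists g => // z.
  by rewrite exprSr -mulrA -gh.
move=> z hz; apply/eqP; rewrite -nm_eq0 eq_le nm_ge0 andbT.
pose t := nm (z - c); pose rho := (t + r) / 2.
have tr : t < rho by rewrite /rho; move: hz; rewrite -/t; clear; lra.
have rr : rho < r by rewrite /rho; move: hz; rewrite -/t; clear; lra.
have t0 : 0 <= t := nm_ge0 _.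
have rho0 : 0 < rho by exact: le_lt_trans tr.
have [M M0 HM] := @ccont_bounded R f c rho (fun w hw => hol_ccont hf (le_lt_trans hw rr)).
have bound m : nm (f z) <= 2 * M * rho / (rho - t) * (t / rho) ^+ m.
  have [h hh fh] := all_m m.
  have hb w : nm (w - c) = rho -> nm (h w) <= M / rho ^+ m.
    move=> hw; rewrite ler_pdivlMr ?exprn_gt0 // -hw -nmX mulrC -normcM -fh.
    by apply: HM; rewrite hw.
  have := off_center_bound rho0 rr hh hb tr; rewrite -/t => B.
  rewrite fh normcM nmX -/t.
  have -> : 2 * M * rho / (rho - t) * (t / rho) ^+ m = t ^+ m * (2 * (M / rho ^+ m) * rho / (rho - t)).
    by rewrite expr_div_n; ring.
  by rewrite ler_wpM2l // exprn_ge0.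
have q1 : t / rho < 1 by rewrite ltr_pdivrMr // mul1r.
have q0 : 0 <= t / rho by rewrite divr_ge0 // ltW.
apply/ler_addgt0Pr => e e0; rewrite add0r.
have K0 : 0 < 2 * M * rho / (rho - t).
  by rewrite divr_gt0 ?subr_gt0 // mulr_gt0 // mulr_gt0.
have : (fun m => (t / rho) ^+ m) @ \oo --> (0 : R) by apply: cvg_expr; rewrite ger0_norm.
move/cvgrPdist_lt => /(_ (e / (2 * M * rho / (rho - t))) ltac:(by rewrite divr_gt0)) [m _ /(_ m (leqnn m))].
rewrite sub0r normrN ger0_norm ?exprn_ge0 // ltr_pdivlMr // mulrC => h.
exact: le_trans (bound m) (ltW h).
Qed.

Lemma isolated_zeros f c r : 0 < r -> holomorphic c r f ->
  (forall z, nm (z - c) < r -> f z = 0) \/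
  exists2 s, 0 < s /\ s <= r & forall z, nm (z - c) < s -> z != c -> f z != 0.
Proof.
move=> r0 hf; have [|[m [h [hh hc fE]]]] := zero_order r0 hf; [by left|right].
have [del del0 Hd] := hol_ccont (z := c) hh ltac:(by rewrite subrr nm0) (e := nm (h c)) ltac:(by rewrite nm_gt0).
exists (Num.min r del).
  by rewrite lt_min r0 del0 ge_min lexx.
move=> z; rewrite lt_min => /andP[_ /Hd h1] zc; rewrite fE mulf_neq0 ?expf_neq0 ?subr_eq0 //.
by apply: contraTneq h1 => ->; rewrite sub0r normcN ltxx.
Qed.

(** The maximum modulus bound applied to [1 / f]. *)
Lemma min_modulus f c r s m : 0 < r -> r < s -> holomorphic c s f -> 0 < m ->
  (forall z, nm (z - c) = r -> m <= nm (f z)) ->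
  (forall z, nm (z - c) <= r -> f z != 0) -> m <= nm (f c).
Proof.
move=> r0 rs hf m0 fm f0.
have sub z : nm (z - c) <= r -> nm (z - c) < s by move=> /le_lt_trans; apply.
have hdv := hol_dv hf.
have := @C1_max_modulus R (fun z => (f z)^-1) (fun z => - dv f z / f z ^+ 2) c r m^-1 r0.
have fc : 0 < nm (f c) by rewrite nm_gt0 f0 // subrr nm0 ltW.
rewrite normcV lef_pV2 ?posrE //; apply.
- by move=> z hz; apply: cdiffV (f0 z hz) (hol_cdiff hf (sub z hz)).
- move=> z hz; have [d Hd] := hf z (sub z hz); have [d' Hd'] := hdv z (sub z hz).
  have fz2 : f z ^+ 2 != 0 by rewrite expf_neq0 // f0.
  exact: cdiff_ccont (cdiffM (cdiffN Hd') (@cdiffV R (fun w => f w ^+ 2) z _ fz2 (cdiffX 2 Hd))).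
- move=> z hz; rewrite normcV lef_pV2 ?posrE ?fm //.
  by apply: lt_le_trans (fm z hz).
Qed.

Definition ucvg c r (u : nat -> C -> C) f := forall e : R, 0 < e ->
  exists J, forall j, (J <= j)%N -> forall z, nm (z - c) < r -> nm (u j z - f z) < e.

Lemma ucvg_sub c r c' r' u f : ucvg c r u f -> nm (c' - c) + r' <= r -> ucvg c' r' u f.
Proof.
move=> H h e /H [J HJ]; exists J => j /HJ k z hz; apply: k.
by have := nm_tri c' z c; move: hz h; clear; lra.
Qed.

(** On a small circle around the isolated zero, [|f| >= m]. If [u j] had no zero inside,
    [min_modulus] would give [|u j c| >= 2 m / 3], whereas [u j c] is within [m / 3] of
    [f c = 0]. *)
Lemma hurwitz u f c s : 0 < s -> (exists J, forall j, (J <= j)%N -> holomorphic c s (u j)) ->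
  holomorphic c s f -> ucvg c s u f -> f c = 0 ->
  (exists2 z, nm (z - c) < s & f z != 0) -> forall rho, 0 < rho ->
  exists J, forall j, (J <= j)%N -> exists2 z, nm (z - c) < rho & u j z = 0.
Proof.
move=> s0 [J0 hu] hf uf fc [z0 z0s fz0] rho rho0.
have [H|[s1 [s10 s1s] H]] := isolated_zeros s0 hf; first by rewrite H ?eqxx in fz0.
pose r := Num.min s1 rho / 2.
have mn : 0 < Num.min s1 rho by rewrite lt_min s10.
have r0 : 0 < r by rewrite divr_gt0.
have rm : r < Num.min s1 rho by rewrite ltr_pdivrMr // ltr_pMr // ltr1n.
have [r1 r2] : r < s1 /\ r < rho by move: rm; rewrite lt_min => /andP.
have rs : r < s by exact: lt_le_trans s1s.
have [|//|m m0 Hm] := @compact_eps R _ (fun m z => nm (z - c) = r -> m <= nm (f z)) (cdisc_compact (c := c) (r := r)).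
- by move=> e e' w ee H1 /H1; exact: le_trans.
- move=> z hz; have [zr|zr] := eqVneq (nm (z - c)) r; last first.
    have zr' : 0 < r - nm (z - c) by rewrite subr_gt0 lt_neqAle zr.
    exists (r - nm (z - c)) => // w hw wr.
    by have := nm_tri z w c; move: hw wr; clear; lra.
  have fz : 0 < nm (f z).
    rewrite nm_gt0; apply: H; first by rewrite zr.
    by apply: contraTneq r0 => E; rewrite -zr E subrr nm0 ltxx.
  have fz2 : 0 < nm (f z) / 2 by rewrite divr_gt0.
  have [del del0 Hd] := hol_ccont hf (le_lt_trans hz rs) fz2.
  exists (Num.min del (nm (f z) / 2)); first by rewrite lt_min del0.
  move=> w; rewrite lt_min => /andP[/Hd h1 _] _.
  have : Num.min del (nm (f z) / 2) <= nm (f z) / 2 by rewrite ge_min lexx orbT.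
  by have := nm_triB (f z) (f w); rewrite (nmBC (f z)); move: h1; clear; lra.
have m30 : 0 < m / 3 by rewrite divr_gt0.
have [J HJ] := uf _ m30.
exists (maxn J J0) => j; rewrite geq_max => /andP[/HJ hj /hu huj].
apply: contrapT => nz.
have uj0 z : nm (z - c) <= r -> u j z != 0.
  move=> hz; apply/eqP => E; apply: nz; exists z => //; exact: le_lt_trans r2.
have m23 : 0 < 2 * (m / 3) by rewrite mulr_gt0.
have h0 := hj c ltac:(by rewrite subrr nm0).
rewrite fc subr0 in h0.
have K : 2 * (m / 3) <= nm (u j c).
  apply: (min_modulus r0 rs huj m23 _ uj0) => z hz.
  have h1 := hj z ltac:(by rewrite hz).
  have h2 := Hm z ltac:(by rewrite /cdisc /= hz) hz.
  by have := nm_triB (f z) (u j z); rewrite (nmBC (f z)); move: h1 h2; clear; lra.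
by move: m0 h0 K; clear; lra.
Qed.

End LocalTheory.

(** * Uniform limits and entire functions *)

Section Weierstrass.
Context {R : realType}.
Local Notation C := R[i].
Implicit Types (f g h : C -> C) (c z w : C) (r s M : R).

Lemma ucvg_cont u f c s : 0 < s -> (exists J, forall j, (J <= j)%N -> holomorphic c s (u j)) ->
  ucvg c s u f -> forall z, nm (z - c) < s -> ccont f z.
Proof.
move=> s0 [J0 hu] uf z hz e e0; have e30 : 0 < e / 3 by rewrite divr_gt0.
have [J HJ] := uf _ e30; pose j := maxn J J0.
have hj := HJ j (leq_maxl _ _).
have [del del0 Hd] := hol_ccont (hu j (leq_maxr _ _)) hz e30.
exists (Num.min del (s - nm (z - c))); first by rewrite lt_min del0 subr_gt0.
move=> w; rewrite lt_min => /andP[/Hd h1 h2].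
have h3 := hj z hz; have h4 := hj w ltac:(by have := nm_tri z w c; move: h2; clear; lra).
rewrite (_ : f w - f z = (u j w - u j z) - (u j w - f w) + (u j z - f z)); last by ring.
apply: le_lt_trans (le_normcD _ _) _.
by have := nm_triD (u j w - u j z) (u j w - f w); move: h1 h3 h4; clear; lra.
Qed.

(** Cauchy's estimate makes the derivatives of the [u j] at [z] a Cauchy sequence; the quadratic
    remainder bound, uniform in [j], then passes to the limit. *)
Lemma weierstrass u f c s : 0 < s -> (exists J, forall j, (J <= j)%N -> holomorphic c s (u j)) ->
  ucvg c s u f -> holomorphic c s f.
Proof.
move=> s0 hu uf z hz; have cf := ucvg_cont s0 hu uf.
have [J0 hJ0] := hu.
pose rho := (s - nm (z - c)) / 2; have rho0 : 0 < rho by rewrite divr_gt0 // subr_gt0.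
have zE : nm (z - c) = s - 2 * rho by rewrite /rho; field.
have k w : nm (w - z) < 2 * rho -> nm (w - c) < s.
  by move=> hw; have := nm_tri z w c; rewrite zE; move: hw; clear; lra.
have k1 w : nm (w - z) <= rho -> nm (w - c) < s.
  by move=> hw; apply: k; move: hw rho0; clear; lra.
have sub j : (J0 <= j)%N -> holomorphic z (2 * rho) (u j).
  by move=> /hJ0 hj; apply: (hol_sub hj); rewrite zE subrK.
have r2 : rho < 2 * rho by move: rho0; clear; lra.
have [M M0 HM] := @ccont_bounded R f z rho (fun w hw => cf w (k1 w hw)).
have [J1 HJ1] := uf 1 ltr01.
have uM j w : (J1 <= j)%N -> nm (w - z) <= rho -> nm (u j w) <= M + 1.
  move=> /HJ1 hj hw; have := hj w (k1 w hw); have := HM w hw.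
  by have := nm_triB (u j w) (f w); clear; lra.
have zz : nm (z - z) < s by rewrite subrr nm0.
have [|d Hd] := @cauchy_tends R (fun j => dv (u j) z).
  move=> e e0; have er : 0 < e * rho / 4 by rewrite divr_gt0 // mulr_gt0.
  have [J HJ] := uf _ er; exists (maxn J J0) => i j.
  rewrite !geq_max => /andP[/HJ hi Ji] /andP[/HJ hj Jj].
  have hij : holomorphic z (2 * rho) (fun w => u i w - u j w) by apply: hol_B; exact: sub.
  have zr : nm (z - z) < 2 * rho by rewrite subrr nm0 mulr_gt0.
  have <- : dv (fun w => u i w - u j w) z = dv (u i) z - dv (u j) z.
    by apply: cdiff_dv; apply: cdiffB; [apply: (hol_cdiff (sub i Ji))|apply: (hol_cdiff (sub j Jj))].
  have b w : nm (w - z) = rho -> nm (u i w - u j w) <= e * rho / 2.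
    move=> hw; have h1 := hi w (k1 w ltac:(by rewrite hw)); have h2 := hj w (k1 w ltac:(by rewrite hw)).
    have := nm_tri (f w) (u i w) (u j w); rewrite (nmBC (f w)).
    by move: h1 h2; clear; lra.
  apply: le_lt_trans (cauchy_deriv rho0 r2 hij b) _.
  by rewrite ltr_pdivrMr // ltr_pdivrMr // ltr_pMr ?ltr1n // mulr_gt0.
exists d.
have K0 : 0 < 2 * (M + 1) / rho ^+ 2 by rewrite divr_gt0 ?exprn_gt0 // mulr_gt0 // addr_gt0.
have r20 : 0 < rho / 2 by rewrite divr_gt0.
apply: (@C1_second_cdiff R f (fun=> d) z (rho / 2) _ r20 K0) => h hh.
apply/ler_addgt0Pr => e e0.
pose e' := e / (3 * (1 + nm h)).
have h1 : 0 < 1 + nm h by rewrite ltr_pwDl ?nm_ge0.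
have e'0 : 0 < e' by rewrite divr_gt0 // mulr_gt0.
have e'e : e' * (3 * (1 + nm h)) = e by rewrite divfK // gt_eqF // mulr_gt0.
have [J2 HJ2] := uf _ e'0; have [J3 HJ3] := Hd _ e'0.
pose j := maxn (maxn J0 J1) (maxn J2 J3).
have [j0 j1 j2 j3] : [/\ (J0 <= j)%N, (J1 <= j)%N, (J2 <= j)%N & (J3 <= j)%N].
  by rewrite /j !leq_max !leqnn !orbT.
have hw : nm (z + h - z) <= rho / 2 by rewrite addrC addKr.
have Q := @cauchy_quad R (u j) z rho (2 * rho) (M + 1) rho0 r2 (sub j j0)
   (fun w hw => uM j w j1 (eq_ind_r (fun x => is_true (x <= rho)) (lexx rho) hw)) (z + h) hw.
have zh : z + h - z = h by ring.
rewrite zh in Q.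
have a1 := HJ2 j j2 z ltac:(by apply: k; rewrite subrr nm0 mulr_gt0).
have a2 := HJ2 j j2 (z + h) ltac:(by apply: k; rewrite zh; move: hh rho0; clear; lra).
have a3 := HJ3 j j3.
have K (t1 t2 t3 t4 t5 t6 k' : C) : t1 - t2 - t3 * k' =
    (t4 - t5 - t6 * k') - (t4 - t1) + (t5 - t2) + (t6 - t3) * k' by ring.
rewrite (K _ _ _ (u j (z + h)) (u j z) (dv (u j) z)).
have -> : 2 * (M + 1) / rho ^+ 2 * nm h ^+ 2 = 2 * (M + 1) * (nm h / rho) ^+ 2.
  have Q2 (a b t : R) : a / b ^+ 2 * t ^+ 2 = a * (t / b) ^+ 2.
    by rewrite expr_div_n [RHS]mulrA [RHS]mulrAC.
  exact: Q2.
have a4 : nm ((dv (u j) z - d) * h) <= e' * nm h by rewrite normcM ler_wpM2r ?nm_ge0 // ltW.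
set q1 := u j (z + h) - u j z - dv (u j) z * h in Q *.
have b1 := le_normcD (q1 - (u j (z + h) - f (z + h)) + (u j z - f z)) ((dv (u j) z - d) * h).
have b2 := le_normcD (q1 - (u j (z + h) - f (z + h))) (u j z - f z).
have b3 := nm_triD q1 (u j (z + h) - f (z + h)).
have h0 := nm_ge0 h.
apply: le_trans b1 _; rewrite -e'e.
have b4 : 0 <= e' * nm h by rewrite mulr_ge0 // ltW.
by move: Q a1 a2 a4 b2 b3 b4 e'0; clear; lra.
Qed.

Lemma ucvg_dv u f c s r : (exists J, forall j, (J <= j)%N -> holomorphic c s (u j)) ->
  holomorphic c s f -> ucvg c s u f -> r < s -> ucvg c r (fun j => dv (u j)) (dv f).
Proof.
move=> [J0 hu] hf uf rs e e0.
pose rho := (s - r) / 2; have rho0 : 0 < rho by rewrite divr_gt0 // subr_gt0.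
have er : 0 < e * rho / 2 by rewrite divr_gt0 // mulr_gt0.
have [J HJ] := uf _ er; exists (maxn J J0) => j; rewrite geq_max => /andP[/HJ hj /hu huj] z hz.
have rE : r + 2 * rho = s by rewrite /rho; field.
have k w : nm (w - z) < 2 * rho -> nm (w - c) < s.
  by move=> hw; have := nm_tri z w c; rewrite -rE; move: hw hz; clear; lra.
have r2 : rho < 2 * rho by move: rho0; clear; lra.
have zs : nm (z - c) < s by exact: lt_trans rs.
have <- : dv (fun w => u j w - f w) z = dv (u j) z - dv f z.
  by apply: cdiff_dv; apply: cdiffB; [exact: (hol_cdiff huj)|exact: (hol_cdiff hf)].
have hd : holomorphic z (2 * rho) (fun w => u j w - f w).
  by move=> w /k; apply: hol_B.
apply: le_lt_trans (cauchy_deriv (M := e * rho / 2) rho0 r2 hd _) _.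
  by move=> w hw; apply/ltW/hj/k; rewrite hw.
by rewrite ltr_pdivrMr // ltr_pdivrMr // ltr_pMr ?ltr1n // mulr_gt0.
Qed.

End Weierstrass.

(** * Logarithms of entire functions and Bloch's theorem *)

Section Entire.
Context {R : realType}.
Local Notation C := R[i].
Implicit Types (f g h : C -> C) (c z w : C) (r s M : R).

Definition entire f := forall z, exists d, cdiff f z d.

Lemma entire_hol f c r : entire f -> holomorphic c r f.
Proof. by move=> ef z _; exact: ef. Qed.

Lemma entire_cdiff f z : entire f -> cdiff f z (dv f z).
Proof. by move=> /(_ z) [d Hd]; rewrite (cdiff_dv Hd). Qed.

Lemma entire_dv f : entire f -> entire (dv f).
Proof.
move=> ef z; apply: (hol_dv (entire_hol (c := z) (r := 1) ef)).
by rewrite subrr nm0.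
Qed.

Lemma dv0_const f : entire f -> (forall z, dv f z = 0) -> forall z w, f z = f w.
Proof.
move=> ef f0 z w; apply: cdiff0_const => t t0 t1.
by rewrite -[X in cdiff _ _ X](f0 (w + t%:C * (z - w))); exact: entire_cdiff.
Qed.

(** [phi] is a primitive of [f' / f], shifted so that the formula holds at 0; [f exp(-phi)] has
    derivative 0. *)
Lemma entire_log f : entire f -> (forall z, f z != 0) ->
  exists2 phi, entire phi & forall z, f z = cexp (phi z).
Proof.
move=> ef f0.
have eq : entire (fun z => dv f z / f z).
  move=> z; have [d Hd] := entire_dv ef z.
  by eexists; exact: (cdiffM Hd (cdiffV (f0 z) (entire_cdiff z ef))).
have [F HF] := entire_primitive eq.
have [c0 Hc] := cexp_surj (f0 0).
pose phi z := F z - F 0 + c0.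
have dphi z : cdiff phi z (dv f z / f z).
  apply: (cdiff_eq (cdiffD (cdiffB (HF z) (cdiff_cst (F 0) z)) (cdiff_cst c0 z))).
  by rewrite subr0 addr0.
exists phi; first by move=> z; eexists; exact: dphi.
move=> z; pose k w := f w * cexp (- phi w).
have dk w : cdiff k w 0.
  have h := cdiffM (entire_cdiff w ef) (cdiff_comp (cdiffN (dphi w)) (cexp_diff (- phi w))).
  by apply: (cdiff_eq h); have := f0 w; move=> fw; field.
have : k z = k 0 by apply: cdiff0_const.
rewrite /k /phi subrr add0r -Hc -cexpD subrr cexp0 cexpN => /(congr1 (fun x => x * cexp (F z - F 0 + c0))).
by rewrite mul1r divfK // cexp_neq0.
Qed.

(** [p] nearly maximises [(r - |z - a|) |g' z|] on the disc of radius [r] about [a]. With [2 d] the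
    distance from [p] to the circle and [A = |g' p|], the derivative is at most [4 A] within [d] of
    [p]; so [g] is almost linear on a disc of radius comparable with [d] and covers a disc about
    [g p] of radius comparable with [A d]. As [g] is entire, [r] can be as large as [T] demands. *)
Lemma bloch g : entire g -> (forall z w, g z = g w) \/
  forall T : R, 0 < T -> exists w0, forall w, nm (w - w0) < T -> exists z, g z = w.
Proof.
move=> eg; have [H|/existsNP [a /eqP ga]] := pselect (forall z, dv g z = 0).
  by left; exact: dv0_const.
right=> T T0; have eg' := entire_dv eg.
have ga0 : 0 < nm (dv g a) by rewrite nm_gt0.
(* The constant 256 is 4 times 64: the near-maximum costs a factor 4 in [sup E < 4 d A], and
   [64 T < d A] is what the final estimate consumes. *)
have [r r0 rT] : exists2 r, 0 < r & r * nm (dv g a) = 16 * (16 * T).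
  exists (16 * (16 * T) / nm (dv g a)); last by rewrite divfK // gt_eqF.
  by rewrite divr_gt0 // !mulr_gt0.
have [M M0 HM] := @ccont_bounded R (dv g) a r (fun z _ => cdiff_ccont (entire_cdiff z eg')).
pose E := [set x : R | exists2 z, nm (z - a) <= r & x = (r - nm (z - a)) * nm (dv g z)].
have Ea : E (r * nm (dv g a)) by exists a; rewrite subrr nm0 ?subr0 // ltW.
have supE : has_sup E.
  split; first by eexists; exact: Ea.
  exists (r * M) => _ [z hz ->]; apply: ler_pM; rewrite ?nm_ge0 ?subr_ge0 //; last exact: HM.
  by rewrite gerBl nm_ge0.
have S0 : 0 < sup E.
  by apply: lt_le_trans (ub_le_sup (proj2 supE) Ea); rewrite mulr_gt0.
have [_ [p hp ->] hsup] := sup_adherent (divr_gt0 S0 (ltr0Sn R 1)) supE.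
have [d rp] : exists d, r - nm (p - a) = 2 * d.
  by exists ((r - nm (p - a)) / 2); field.
have [A AE] : exists A, nm (dv g p) = A by eexists.
rewrite rp AE in hsup.
have A0 : 0 <= A by rewrite -AE nm_ge0.
have d0' : 0 <= d by rewrite -(pmulr_rge0 d (ltr0Sn R 1)) -rp subr_ge0.
have hsup2 : sup E < 4 * (d * A) by move: (sup E) hsup => S; clear; lra.
have dA : 0 < d * A by move: (sup E) hsup2 S0 => S; clear; lra.
have d0 : 0 < d.
  by rewrite lt_def d0' andbT; apply: contraTneq dA => ->; rewrite mul0r ltxx.
have {}A0 : 0 < A.
  by rewrite lt_def A0 andbT; apply: contraTneq dA => ->; rewrite mulr0 ltxx.
have dAT : 64 * T < d * A.
  have := ub_le_sup (proj2 supE) Ea; rewrite rT.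
  by move: (sup E) hsup2 => S; clear; lra.
have b1 z : nm (z - p) <= d -> nm (dv g z) <= 4 * A.
  move=> hz; have hza : d <= r - nm (z - a).
    have := nm_tri p z a; have -> : nm (p - a) = r - 2 * d by rewrite -rp; ring.
    by move: hz; clear; lra.
  have : (r - nm (z - a)) * nm (dv g z) <= sup E.
    apply: ub_le_sup; first exact: (proj2 supE).
    by exists z => //; move: hza d0; clear; lra.
  have : d * nm (dv g z) <= (r - nm (z - a)) * nm (dv g z) by rewrite ler_wpM2r ?nm_ge0.
  move=> h1 h2; rewrite -(ler_pM2l d0); apply: (le_trans h1); apply: (le_trans h2).
  by rewrite mulrCA ltW.
have d20 : 0 < d / 2 by rewrite divr_gt0.
have b2 z : nm (z - p) <= d / 2 -> nm (dv (dv g) z) <= 8 * A / d.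
  move=> hz; have d21 : d / 2 < d by move: d0; clear; lra.
  apply: le_trans (cauchy_deriv (M := 4 * A) d20 d21 (entire_hol eg') _) _.
    move=> w hw; apply: b1; have := nm_tri z w p; rewrite hw; move: hz; clear; lra.
  by rewrite le_eqVlt; apply/orP; left; apply/eqP; field; rewrite gt_eqF.
have seg z t : 0 <= t -> t <= 1 -> nm (p + t%:C * (z - p) - p) <= nm (z - p).
  by move=> t0 t1; rewrite addrC addKr normcM nmC (ger0_norm t0) ler_piMl ?nm_ge0.
have b3 z : nm (z - p) <= d / 2 -> nm (dv g z - dv g p) <= 8 * A / d * nm (z - p).
  move=> hz; apply: mean_value => t t0 t1; exists (dv (dv g) (p + t%:C * (z - p))).
    exact: entire_cdiff.
  by apply: b2; exact: le_trans (seg z t t0 t1) hz.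
have b4 z : nm (z - p) <= d / 2 -> nm (g z - g p - dv g p * (z - p)) <= 8 * A / d * nm (z - p) * nm (z - p).
  move=> hz; rewrite (_ : g z - _ - _ = (g z - dv g p * z) - (g p - dv g p * p)); last by ring.
  apply: (@mean_value R (fun z => g z - dv g p * z)) => t t0 t1.
  have hs := seg z t t0 t1.
  exists (dv g (p + t%:C * (z - p)) - dv g p).
    apply: cdiffB; first exact: entire_cdiff.
    by apply: (cdiff_eq (cdiffZ _ (cdiff_id _))); rewrite mulr1.
  apply: le_trans (b3 _ (le_trans hs hz)) _; rewrite ler_pM2l //.
  by rewrite divr_gt0 // mulr_gt0.
(* On the circle of radius [d / 16] the linear part has modulus [A d / 16], the remainder is at most
   [A d / 32], and [|w - g p| < T < A d / 64]. If [g - w] had no zeros, its modulus at [p] would be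
   at least [A d / 64]. *)
exists (g p) => w hw; apply: contrapT => nz.
have gw z : g z - w != 0.
  by rewrite subr_eq0; apply/eqP => E1; apply: nz; exists z.
have d160 : 0 < d / 16 by rewrite divr_gt0.
have d161 : d / 16 < d by move: d0; clear; lra.
have eh : entire (fun z => g z - w).
  by move=> z; eexists; exact: (cdiffB (entire_cdiff z eg) (cdiff_cst w z)).
have Ad0 : 0 < A * d / 64 by rewrite divr_gt0 // mulr_gt0.
have := @min_modulus R (fun z => g z - w) p (d / 16) d (A * d / 64) d160 d161 (entire_hol eh) Ad0 _ (fun z _ => gw z).
rewrite nmBC => K.
have {}K : A * d / 64 <= nm (w - g p).
  apply: K => z hz.
  have h1 := b4 z ltac:(by rewrite hz; move: d0; clear; lra).
  rewrite hz in h1.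
  have e1 : 8 * A / d * (d / 16) * (d / 16) = A * d / 32 by field; rewrite gt_eqF.
  rewrite e1 in h1.
  have h2 : nm (dv g p * (z - p)) = A * d / 16 by rewrite normcM hz AE mulrA.
  have t1 := nm_triB (dv g p * (z - p)) (- (g z - g p - dv g p * (z - p))).
  rewrite opprK normcN (_ : dv g p * (z - p) + _ = (g z - w) + (w - g p)) in t1; last by ring.
  have := le_normcD (g z - w) (w - g p).
  by move: t1 h1 h2 hw dAT; clear; lra.
by move: K hw dAT; clear; lra.
Qed.

End Entire.

(** * A variant of Picard's theorem *)

Section Picard.
Context {R : realType}.
Local Notation C := R[i].
Implicit Types (f g h : C -> C) (z w : C).

Definition ipi : C := 0 +i* pi.

Lemma cexp_2ipi_int (l : int) : cexp (ipi *+ 2 * l%:~R) = 1.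
Proof.
have nat n : cexp (ipi *+ 2 * n%:R) = 1.
  rewrite mulr_natr cexpMn (_ : ipi *+ 2 = 0 +i* (pi *+ 2)); last first.
    by rewrite /ipi; apply/eqP; rewrite eq_complex /= addr0 mulr2n !eqxx.
  by rewrite cexp_2pi expr1n.
case: l => n; first exact: nat.
by rewrite NegzE mulrNz mulrN cexpN nat invr1.
Qed.

Lemma ipi_int (l : int) : ipi * l%:~R = 0 +i* (pi * l%:~R).
Proof.
rewrite -(rmorph_int (real_complex R)) /ipi; apply/eqP; rewrite eq_complex /=.
by rewrite !mul0r mulr0 subr0 add0r !eqxx.
Qed.

(* Landau's grid: these points are where (cosh s)^2 is a positive integer. *)
Lemma landau_grid z : exists2 s, nm (z - s) <= 10 &
  exists2 m, (0 < m)%N & (cexp s + cexp (- s)) ^+ 2 = 4%:R * m%:R.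
Proof.
pose X := `|Re z|; pose e := expR X.
have X0 : 0 <= X by rewrite normr_ge0.
have e1 : 1 <= e by rewrite /e -expR0 ler_expR.
have e0 : 0 < e by exact: lt_le_trans e1.
(* [m] is the integer part of [e^2], so [sqrt m] and [e = exp |Re z|] differ by a factor of at most
   2. *)
have [m m0 [m1 m2]] : exists2 m, (0 < m)%N & m%:R <= e ^+ 2 /\ e ^+ 2 <= 4 * m%:R.
  have /andP[a b] := Num.Theory.truncn_itv (sqr_ge0 e).
  set m := Num.truncn _ in a b.
  have m0 : (0 < m)%N.
    rewrite lt0n; apply/eqP => mE; rewrite mE in b.
    have : 1 <= e ^+ 2 by rewrite exprn_ege1.
    by rewrite leNgt b.
  exists m => //; split => //; apply: (le_trans (ltW b)).
  by rewrite -natrM ler_nat mulSn -addn1 leq_add2l muln_gt0.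
have mR : (1 : R) <= m%:R by rewrite ler1n.
pose a := Num.sqrt (m%:R : R); pose b := Num.sqrt (m%:R - 1 : R).
have a2 : a ^+ 2 = m%:R by rewrite sqr_sqrtr.
have b2 : b ^+ 2 = m%:R - 1 by rewrite sqr_sqrtr // subr_ge0.
have a0 : 0 <= a := sqrtr_ge0 _; have b0 : 0 <= b := sqrtr_ge0 _.
have ba : b <= a by rewrite ler_sqrt ?gerBl // lerBlDr lerDl.
have ae : a <= e by rewrite -(ler_pXn2r (n := 2)) ?nnegrE ?a2 // ltW.
have ea : e <= 2 * a.
  by rewrite -(ler_pXn2r (n := 2)) ?nnegrE ?mulr_ge0 ?(ltW e0) // exprMn a2 -natrX.
(* [y] and its inverse [a - b] have sum [2 sqrt m], so the square of the hyperbolic cosine of [ln y]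
   is [m]. *)
pose y := a + b.
have y0 : 0 < y by rewrite /y; move: ea e0 b0; clear; lra.
have yV : y^-1 = a - b.
  have yab : y * (a - b) = 1 by rewrite /y mulrC -subr_sqr a2 b2 opprB addrC subrK.
  by rewrite -[RHS](mulKf (x := y)) ?gt_eqF // yab mulr1.
have ln2 : ln 2 <= 1 :> R.
  by have := @le_ln1Dx R 1 (lt_trans (ltrN10 R) ltr01); rewrite -(natrD _ 1 1).
have l1 : ln y <= X + 1.
  apply: (@le_trans _ _ (ln (e * 2))).
    by rewrite ler_ln ?posrE ?mulr_gt0 // /y; move: ae ba; clear; lra.
  by rewrite lnM ?posrE // /e expRK lerD2l.
have l2 : X - 1 <= ln y.
  have : ln e <= ln (y * 2).
    by rewrite ler_ln ?posrE ?mulr_gt0 // /y; move: ea b0; clear; lra.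
  by rewrite lnM ?posrE // /e expRK; move: ln2; clear; lra.
pose l := Num.floor (Im z / pi).
have p0 : 0 < pi :> R := pi_gt0 _.
have lz : `|Im z - pi * l%:~R| <= 4.
  have /andP[f1 f2] := Num.Theory.floor_itv (Im z / pi); rewrite -/l in f1 f2.
  rewrite ler_pdivlMr // in f1; rewrite ltr_pdivrMr // intrD mulrDl mul1r in f2.
  rewrite mulrC ger0_norm ?subr_ge0 //.
  have p4 : pi <= 4 :> R.
    have := @pihalf_lt2 R. lra.
  by move: f1 f2 p4; clear; lra.
(* [ln y] approximates [|Re z|]; passing to the inverse of [y] restores the sign. *)
pose Y := if 0 <= Re z then y else y^-1.
pose t := if 0 <= Re z then ln y else - ln y.
have tz : `|Re z - t| <= 1.
  rewrite /t; case: ifP => rz.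
    by move: l1 l2; rewrite /X ger0_norm // ler_norml; clear; lra.
  by move: l1 l2; rewrite /X ltr0_norm ?ltNge ?rz // ler_norml; clear; lra.
have tY : expR t = Y.
  by rewrite /t /Y; case: ifP => _; rewrite ?expRN lnK.
have YY : Y ^+ 2 + 2 + Y ^- 2 = 4 * m%:R.
  have : y ^+ 2 + 2 + y ^- 2 = 4 * m%:R.
    rewrite -exprVn yV /y -a2.
    have : b ^+ 2 = a ^+ 2 - 1 by rewrite a2.
    by rewrite !expr2; clear; nra.
  by rewrite /Y; case: ifP => // _; rewrite -!exprVn invrK; move: (y ^+ 2) (y^-1 ^+ 2) => s1 s2; clear; lra.
pose s := t%:C + ipi * l%:~R.
have ct : cexp t%:C = Y%:C by rewrite /cexp /= cos0 sin0 tY mulr1.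
have E2 : cexp s ^+ 2 = (Y ^+ 2)%:C.
  by rewrite /s cexpD exprMn ct rmorphXn /= -cexpMn -mulrnAl cexp_2ipi_int mulr1.
exists s.
  apply: le_trans (nm_ReIm _) _; rewrite !raddfB /= /s ipi_int /= addr0 add0r.
  by move: tz lz; clear; lra.
exists m => //.
have c0 := cexp_neq0 s.
rewrite cexpN (_ : _ ^+ 2 = cexp s ^+ 2 + 2%:R + (cexp s ^+ 2)^-1); last by field.
rewrite E2 -fmorphV -!(rmorph_nat (real_complex R)) -!rmorphD -rmorphM /=.
by congr (_%:C).
Qed.

Lemma picard_variant h (p q : C) : entire h -> p != q -> (forall z, h z != p) ->
  (forall z w, h z = q -> h w = q -> z = w) -> forall z w, h z = h w.
Proof.
move=> eh pq hp hq.
have ehp : entire (fun z => h z - p).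
  by move=> z; eexists; exact: (cdiffB (entire_cdiff z eh) (cdiff_cst p z)).
have [phi ephi phiE] := entire_log ehp ltac:(by move=> z; rewrite subr_eq0).
have [c0 Hc] := @cexp_surj R (q - p) ltac:(by rewrite subr_eq0 eq_sym).
pose tau : C := ipi *+ 2.
have tau0 : tau != 0.
  rewrite /tau /ipi; apply/eqP => /(congr1 (@complex.Im R)) /= .
  have := pi_gt0 R; move: (pi : R) => t; clear; lra.
(* At an integer value of [k], the function [h] takes the value [q]. This happens at one point at
   most, so [k] takes at most one integer value [m0]. *)
pose k z := (phi z - c0) / tau.
have kq z (l : int) : k z = l%:~R -> h z = q.
  move=> kz; have : phi z = c0 + tau * l%:~R.
    by rewrite -kz /k mulrC divfK // addrC subrK.
  by move=> pz; have := phiE z; rewrite pz cexpD cexp_2ipi_int mulr1 Hc => /(addIr _).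
have [m0 Hm0] : exists m0 : int, forall z (l : int), k z = l%:~R -> l = m0.
  have [[z [l kz]]|no] := pselect (exists z, exists l : int, k z = l%:~R); last first.
    by exists 0 => z l kz; case: no; exists z, l.
  exists l => w l' kw; have zw := hq _ _ (kq _ _ kz) (kq _ _ kw).
  by apply: (@intr_inj C); rewrite -kz -kw zw.
(* A natural value [n] of [h1] would be the integer value [m0 + 1 + n] of [k], which is not [m0]. *)
pose h1 z := k z - (m0 + 1)%:~R.
have h1nat z (n : nat) : h1 z != n%:R.
  apply/eqP => E; have : k z = (m0 + 1 + n%:Z)%:~R by rewrite intrD -[n%:Z%:~R]/(n%:R) -E /h1 addrC subrK.
  move=> /Hm0 /eqP; rewrite -addrA -[X in _ == X]addr0 (inj_eq (addrI _)) -PoszD.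
  by [].
have dphi z := entire_cdiff z ephi.
have eh1 : entire h1.
  move=> z; eexists.
  exact: (cdiffB (cdiffM (cdiffB (dphi z) (cdiff_cst c0 z)) (cdiff_cst tau^-1 z)) (cdiff_cst _ z)).
have [psi epsi psiE] := entire_log eh1 (fun z => h1nat z 0%N).
have eh2 : entire (fun z => h1 z - 1).
  by move=> z; eexists; exact: (cdiffB (entire_cdiff z eh1) (cdiff_cst 1 z)).
have [chi echi chiE] := entire_log eh2 ltac:(by move=> z; rewrite subr_eq0; exact: (h1nat z 1%N)).
have half f : entire f -> entire (fun z => cexp (f z / 2%:R)).
  move=> ef z; eexists.
  exact: (cdiff_comp (cdiffM (entire_cdiff z ef) (cdiff_cst 2%:R^-1 z)) (cexp_diff (f z / 2%:R))).
have half2 w : cexp (w / 2%:R) ^+ 2 = cexp w.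
  by rewrite -cexpMn mulr2n -splitr.
(* Square roots of [h1] and [h1 - 1], which have no zeros. As [(u - v)(u + v) = 1], writing
   [u - v = exp g] gives [u = cosh g], so [h1] is the square of [cosh g]. *)
pose u z := cexp (psi z / 2%:R); pose v z := cexp (chi z / 2%:R).
have uE z : u z ^+ 2 = h1 z by rewrite /u half2 -psiE.
have vE z : v z ^+ 2 = h1 z - 1 by rewrite /v half2 -chiE.
have uv z : (u z - v z) * (u z + v z) = 1 by rewrite -subr_sqr uE vE opprB addrC subrK.
have euv : entire (fun z => u z - v z).
  by move=> z; eexists; exact: (cdiffB (entire_cdiff z (half _ epsi)) (entire_cdiff z (half _ echi))).
have [|g eg gE] := entire_log euv.
  by move=> z; apply/eqP => E; have := uv z; rewrite E mul0r => /eqP; rewrite eq_sym oner_eq0.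
have gN z : u z + v z = cexp (- g z).
  by rewrite cexpN -gE; apply: (mulfI (x := u z - v z)); rewrite ?gE ?cexp_neq0 // -gE uv divff // gE cexp_neq0.
have uG z : u z = (cexp (g z) + cexp (- g z)) / 2%:R.
  by rewrite -gE -gN; field.
have h1G z : h1 z = ((cexp (g z) + cexp (- g z)) / 2%:R) ^+ 2 by rewrite -uG uE.
have gconst : forall z w, g z = g w.
  (* A disc of radius 11 contains a point of the grid; if [g] took this value, [h1] would be a
     positive integer there. *)
  case: (bloch eg) => // big; have [w0 Hw0] := big 11 ltac:(by []).
  have [s sw [m mp sm]] := landau_grid w0.
  have [|z gz] := Hw0 s; first by rewrite nmBC; apply: (le_lt_trans sw); rewrite ltr_nat.
  have := h1nat z m; rewrite h1G gz expr_div_n sm => /eqP; case.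
  by field.
have h1c z w : h1 z = h1 w by rewrite !h1G (gconst z w).
have kc z w : k z = k w by have := h1c z w; rewrite /h1 => /(addIr _).
have pc z w : phi z = phi w.
  by have := kc z w; rewrite /k => /(mulIf (invr_neq0 tau0)) /(addIr _).
by move=> z w; have := phiE z; rewrite (pc z w) -phiE => /(addIr _).
Qed.

End Picard.

(** * Sphere-valued functions *)

Section Sphere.
Context {R : realType}.
Local Notation C := R[i].
Local Notation S := (sphere R).
Local Notation fp := finite_part.
Implicit Types (p q v : S) (f g : C -> S) (c z w a : C) (r e M : R).

Definition sinv p : S :=
  if p is Some w then (if w == 0 :> C then None else Some (w^-1 : C)) else Some (0 : C).

Lemma sinvK : involutive sinv.
Proof.
move=> [w|] /=; last by rewrite eqxx.
have [->|w0] := eqVneq w (0 : C) => //=.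
by rewrite invr_eq0 (negbTE w0) invrK.
Qed.

Lemma fpE f z : f z <> None -> f z = Some (fp f z).
Proof. by rewrite /fp /finite_part; case: (f z). Qed.

Lemma fp_some f z a : f z = Some a -> fp f z = a.
Proof. by rewrite /fp /finite_part => ->. Qed.

(** Basic neighbourhoods read in the two charts: at infinity, [1 / p] is close to 0. *)
Definition snear p v e := if v is Some a then exists2 w : C, p = Some w & nm (w - a) < e
  else exists2 w : C, sinv p = Some w & nm w < e.

Definition sconv (s : nat -> S) v := forall e : R, 0 < e ->
  exists J, forall j, (J <= j)%N -> snear (s j) v e.

Lemma snear_nbhs v e : 0 < e -> nbhs v [set p | snear p v e].
Proof.
move=> e0; case: v => [a|] /=.
  apply/nbhsC_P; exists e => // w hw; exists w => //.
exists (cdisc 0 (e^-1)); first split.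
- exact: cdisc_compact.
- rewrite -openC openE => z /= /negP; rewrite -ltNge => hz; apply/nbhsC_P.
  exists (nm (z - 0) - e^-1); first by rewrite subr_gt0.
  move=> w hw /=; apply/negP; rewrite -ltNge.
  by have := nm_tri w z 0; rewrite (nmBC z w); move: hw; clear; lra.
move=> p [[w /= /negP hw <-]|->] /=; last by exists 0 => //; rewrite nm0.
have w0 : 0 < nm w.
  by rewrite -ltNge subr0 in hw; apply: lt_trans hw; rewrite invr_gt0.
exists (w^-1); first by rewrite ifN // -nm_gt0.
rewrite normcV -[e]invrK ltf_pV2 ?posrE ?invr_gt0 //.
by move: hw; rewrite -ltNge subr0.
Qed.

Lemma sconv_unique s v v' : sconv s v -> sconv s v' -> v = v'.
Proof.
move=> sv sv'.
have two e : 0 < e -> exists p, snear p v e /\ snear p v' e.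
  move=> e0; have [J HJ] := sv e e0; have [J' HJ'] := sv' e e0.
  by exists (s (maxn J J')); split; [apply: HJ|apply: HJ']; rewrite ?leq_maxl ?leq_maxr.
have mixed a : (forall e, 0 < e -> exists p, snear p (Some a) e /\ snear p None e) -> False.
  move=> H; pose e := (nm a + 2)^-1; have a0 := nm_ge0 a.
  have e0 : 0 < e by rewrite invr_gt0; move: a0; clear; lra.
  have e1 : e <= 1 by rewrite invf_le1; move: a0; clear; lra.
  have [p [[w -> hw] [u /=]]] := H e e0.
  case: ifP => // w0 [<-]; rewrite normcV => h.
  have wn : 0 < nm w by rewrite nm_gt0 w0.
  move: h; rewrite ltf_pV2 ?posrE //; last by move: a0; clear; lra.
  by have := nm_triB w a; move: hw e1; clear; lra.
case: v v' two {sv sv'} => [a|] [b|] two //.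
- congr Some; apply/eqP; rewrite -subr_eq0 -nm_eq0 eq_le nm_ge0 andbT.
  apply/ler_addgt0Pr => e e0; rewrite add0r.
  have [p [[w -> h1] [u [<-] h2]]] := two (e / 2) ltac:(by rewrite divr_gt0).
  by have := nm_tri w a b; rewrite (nmBC a w); move: h1 h2; clear; lra.
- by case: (mixed a).
- by case: (mixed b) => e /two [p [h1 h2]]; exists p.
Qed.

Lemma inv_near a e : a != 0 -> 0 < e -> exists2 del : R, 0 < del & forall w, nm (w - a) < del ->
  w != 0 /\ nm (w^-1 - a^-1) < e.
Proof.
move=> a0 e0; have [del del0 Hd] := cdiff_cont (cdiff_inv a0) e0.
have na : 0 < nm a by rewrite nm_gt0.
exists (Num.min del (nm a)); first by rewrite lt_min del0.
move=> w; rewrite lt_min => /andP[h1 h2]; split; last exact: Hd.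
by apply: contraTneq h2 => ->; rewrite sub0r normcN ltxx.
Qed.

Lemma sconv_inv s v : sconv s v -> sconv (fun j => sinv (s j)) (sinv v).
Proof.
case: v => [a|] H /=.
  have [a0|a0] := eqVneq a (0 : C).
    move=> e /H [J HJ]; exists J => j /HJ [w sw]; rewrite a0 subr0 => hw.
    by exists w => //; rewrite sinvK.
  move=> e e0; have [del del0 Hd] := inv_near a0 e0.
  have [J HJ] := H del del0; exists J => j /HJ [w -> /Hd [w0 hw]].
  by exists (w^-1) => //=; rewrite (negbTE w0).
by move=> e /H [J HJ]; exists J => j /HJ [w sw hw]; exists w => //; rewrite subr0.
Qed.

Lemma increasing_choice (P : nat -> nat -> Prop) :
  (forall n N, exists2 j, (N <= j)%N & P n j) ->
  exists phi : nat -> nat, increasing_seq phi /\ forall n, P n (phi n).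
Proof.
move=> H; have H' (nN : nat * nat) : exists j, (nN.2 <= j)%N /\ P nN.1 j.
  by have [j h1 h2] := H nN.1 nN.2; exists j.
have [g Hg] := choice H'.
pose phi := fix phi n := if n is m.+1 then g (n, (phi m).+1) else g (0%N, 0%N).
exists phi; split.
  by apply/increasing_seqP => n; have [] := Hg (n.+1, (phi n).+1).
by case=> [|n]; [have [] := Hg (0%N, 0%N)|have [] := Hg (n.+1, (phi n).+1)].
Qed.

(* Tychonoff on the countable power of the sphere replaces the diagonal argument. *)
Lemma diagonal_subsequence (s : nat -> nat -> S) : exists phi : nat -> nat,
  increasing_seq phi /\ forall i, exists v, sconv (fun j => s i (phi j)) v.
Proof.
have cpt : compact [set x : prod_topology (fun _ : nat => S) | forall i, [set: S] (x i)].
  exact: (@tychonoff nat (fun _ => S) (fun _ => [set: S]) (fun _ => @one_point_compactification_compact R[i]^o)).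
pose x (j : nat) : prod_topology (fun _ : nat => S) := fun i => s i j.
have [|V [_ HV]] := cpt (x @ \oo) _; first by exists 0%N.
have nb n e : 0 < e -> nbhs V [set y : prod_topology (fun _ : nat => S) |
    forall i, (i < n)%N -> snear (y i) (V i) e].
  move=> e0; elim: n => [|n IH].
    by apply: filterS filterT => y _ i.
  have := @proj_continuous nat (fun _ => S) n V _ (snear_nbhs (V n) e0).
  move=> /(filterI IH); apply: filterS => y [h1 h2] i.
  by rewrite ltnS leq_eqVlt => /orP[/eqP -> //|/h1].
have [|phi [inc Hphi]] := @increasing_choice (fun n j => forall i, (i < n)%N ->
    snear (s i j) (V i) (n.+1%:R^-1)).
  move=> n N.
  have A : (x @ \oo) (x @` [set j | (N <= j)%N]) by exists N => // j /= Nj; exists j.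
  have e0 : 0 < n.+1%:R^-1 :> R by rewrite invr_gt0.
  have [_ [[j Nj <-] Hj]] := HV _ _ A (nb n _ e0).
  by exists j.
exists phi; split => // i; exists (V i) => e e0.
exists (maxn i.+1 (Num.bound e^-1)) => j; rewrite geq_max => /andP[ij ej].
have := Hphi j i ij.
have le : j.+1%:R^-1 <= e.
  rewrite invf_ple ?posrE //; apply: ltW; apply: lt_le_trans (archi_boundP _) _.
    by rewrite invr_ge0 ltW.
  by rewrite ler_nat ltnW.
by case: (V i) => [a|] [w ? hw]; exists w => //; exact: lt_le_trans le.
Qed.

Lemma increasing_ge (phi : nat -> nat) : increasing_seq phi -> forall n, (n <= phi n)%N.
Proof.
move=> /increasing_seqP inc; elim=> // n IH; exact: leq_ltn_trans IH (inc n).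
Qed.

Definition finb f c r := (forall w, nm (w - c) < r -> f w <> None) /\ holomorphic c r (fp f).

Definition chart0 f z := exists2 r, 0 < r & finb f z r.

(** Holomorphy as a map to the sphere, read in one of its two charts. It is symmetric under [sinv]
    and, unlike [meromorphic_on], admits the constant infinity, which can occur as a limit. *)
Definition mero f z := chart0 f z \/ chart0 (fun w => sinv (f w)) z.

Lemma finb_sub f c r c' r' : finb f c r -> nm (c' - c) + r' <= r -> finb f c' r'.
Proof.
move=> [h1 h2] h; split; last exact: hol_sub h2 h.
by move=> w hw; apply: h1; have := nm_tri c' w c; move: hw h; clear; lra.
Qed.

Lemma finb_chart0 f c r z : finb f c r -> nm (z - c) < r -> chart0 f z.
Proof.
move=> hf hz; exists (r - nm (z - c)); first by rewrite subr_gt0.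
by apply: finb_sub hf _; rewrite addrC subrK.
Qed.

Lemma fp_sinv f z : f z <> None -> fp f z != 0 -> fp (fun w => sinv (f w)) z = (fp f z)^-1.
Proof.
by rewrite /fp /finite_part; case: (f z) => //= w _ w0; rewrite (negbTE w0).
Qed.

Lemma sinv_none f z : sinv (f z) <> None -> fp (fun w => sinv (f w)) z != 0 -> f z <> None.
Proof. by rewrite /fp /finite_part; case: (f z) => //= _ /eqP. Qed.

Lemma sinv_finite f z : f z <> None -> fp f z != 0 -> sinv (f z) <> None.
Proof. by rewrite /fp /finite_part; case: (f z) => //= w _ w0; rewrite (negbTE w0). Qed.

Lemma finb_inv f c r : finb f c r -> (forall w, nm (w - c) < r -> fp f w != 0) ->
  finb (fun w => sinv (f w)) c r.
Proof.
move=> [h1 h2] h0; split; first by move=> w hw; apply: sinv_finite; [exact: h1|exact: h0].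
apply: (hol_ext _ (hol_V h0 h2)) => z hz; rewrite fp_sinv //; [exact: h1|exact: h0].
Qed.

Lemma chart0_inv f z : chart0 f z -> fp f z != 0 -> chart0 (fun w => sinv (f w)) z.
Proof.
move=> [r r0 hf] fz.
have zz : nm (z - z) < r by rewrite subrr nm0.
have [del del0 Hd] := hol_ccont (proj2 hf) zz (eq_ind_r (fun b => is_true b) fz (nm_gt0 (fp f z))).
exists (Num.min r del); first by rewrite lt_min r0.
apply: finb_inv.
  by apply: finb_sub hf _; rewrite subrr nm0 add0r ge_min lexx.
move=> w; rewrite lt_min => /andP[_ /Hd h].
by apply: contraTneq h => ->; rewrite sub0r normcN ltxx.
Qed.

Lemma mero_inv f z : mero f z -> mero (fun w => sinv (f w)) z.
Proof.
move=> [H|H]; [right|by left].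
by under eq_fun do rewrite sinvK.
Qed.

Lemma mero_finite f z : mero f z -> f z <> None -> chart0 f z.
Proof.
move=> [//|H] fz; suff: chart0 (fun w => sinv (sinv (f w))) z by under eq_fun do rewrite sinvK.
apply: chart0_inv => //; rewrite /fp /finite_part; move: fz.
have [r r0 [/(_ z)]] := H; rewrite subrr nm0 => /(_ r0).
by case: (f z) => //= w; case: eqP => // w0 _ _ _ /=; rewrite invr_eq0; apply/eqP.
Qed.

Lemma chart0_finite f z : chart0 f z -> f z <> None.
Proof. by move=> [r r0 [h _]]; apply: h; rewrite subrr nm0. Qed.

Lemma chart0_cdiff f z : chart0 f z -> cdiff (fp f) z (dv (fp f) z).
Proof. by move=> [r r0 [_ h]]; apply: (hol_cdiff h); rewrite subrr nm0. Qed.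

(** A bound on the spherical derivative, imposed at finite points only; poles are reached through
    [sph_le_inv]. *)
Definition sph_le M f c r := forall w, nm (w - c) < r ->
  mero f w /\ (chart0 f w -> nm (dv (fp f) w) <= M * (1 + nm (fp f w) ^+ 2)).

Lemma sph_le_sub M f c r c' r' : sph_le M f c r -> nm (c' - c) + r' <= r -> sph_le M f c' r'.
Proof.
by move=> H h w hw; apply: H; have := nm_tri c' w c; move: hw h; clear; lra.
Qed.

(** The spherical derivative is invariant under [1 / f]: a computation where [1 / f] is finite and
    nonzero. At its zeros, the poles of [f], the hypothesis gives no estimate; either [1 / f]
    vanishes on a disc, or the bound follows by continuity from nearby points. *)
Lemma sph_le_inv M f c r : 0 < M -> sph_le M f c r -> sph_le M (fun w => sinv (f w)) c r.
Proof.
move=> M0 H w hw; have [mf _] := H w hw; split; first exact: mero_inv.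
set g := fun w => sinv (f w); move=> cg.
have E z : chart0 g z -> fp g z != 0 -> nm (z - c) < r ->
    nm (dv (fp g) z) <= M * (1 + nm (fp g z) ^+ 2).
  move=> gz g0 hz; have [_ hb] := H z hz.
  have fz := sinv_none (chart0_finite gz) g0.
  have cf : chart0 f z by apply: mero_finite fz; exact: (H z hz).1.
  have gf : fp g z = (fp f z)^-1.
    rewrite fp_sinv //; apply: contraNneq g0 => f0.
    by move: (fpE fz); rewrite f0 /g /fp /finite_part => -> /=; rewrite eqxx.
  have f0 : fp f z != 0 by rewrite gf invr_eq0 in g0.
  have [s s0 [hfin hs]] := cf.
  have zz : nm (z - z) < s by rewrite subrr nm0.
  have [del del0 Hd] := hol_ccont hs zz (eq_ind_r (fun b => is_true b) f0 (nm_gt0 (fp f z))).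
  have -> : dv (fp g) z = - dv (fp f) z / fp f z ^+ 2.
    apply: cdiff_dv; have := cdiffV f0 (chart0_cdiff cf).
    have m0 : 0 < Num.min s del by rewrite lt_min s0.
    apply: (cdiff_near m0) => u; rewrite lt_min => /andP[h1 /Hd h2].
    rewrite fp_sinv //; first exact: hfin.
    by apply: contraTneq h2 => ->; rewrite sub0r normcN ltxx.
  have n0 : 0 < nm (fp f z) by rewrite nm_gt0.
  rewrite gf normcM normcN !normcV nmX ler_pdivrMr ?exprn_gt0 //.
  apply: le_trans (hb cf) _; rewrite -mulrA ler_pM2l // mulrDl mul1r -exprMn mulVf ?gt_eqF //.
  by rewrite expr1n addrC.
have [g0|g0] := eqVneq (fp g w) 0; last exact: E.
have [s s0 hg] := cg.
have [z0|[t [t0 ts] H0]] := isolated_zeros s0 (proj2 hg).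
  have -> : dv (fp g) w = 0.
    apply: cdiff_dv; apply: (cdiff_near s0 _ (cdiff_cst 0 w)) => z hz; by rewrite z0.
  by rewrite nm0 mulr_ge0 ?ltW // ltr_pwDl ?exprn_ge0 ?nm_ge0.
rewrite g0 nm0 expr0n addr0 mulr1.
have ww : nm (w - w) < s by rewrite subrr nm0.
apply/ler_addgt0Pr => e e0; have e20 : 0 < e / 2 by rewrite divr_gt0.
have M20 : 0 < e / (2 * M) by rewrite divr_gt0 // mulr_gt0.
have [d1 d10 H1] := hol_dv_cont (proj2 hg) ww e20.
pose K := Num.min 1 (e / (2 * M)).
have K0 : 0 < K by rewrite lt_min ltr01.
have [d2 d20 H2] := hol_ccont (proj2 hg) ww K0.
pose b := Num.min (Num.min d1 d2) (Num.min t (r - nm (w - c))).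
have b0 : 0 < b by rewrite !lt_min d10 d20 t0 subr_gt0.
pose z := w + (b / 2)%:C.
have b20 : 0 < b / 2 by rewrite divr_gt0.
have zw : nm (z - w) = b / 2 by rewrite /z addrC addKr nmC gtr0_norm.
have : b / 2 < b by rewrite ltr_pdivrMr // ltr_pMr // ltr1n.
rewrite /b !lt_min -/b => /andP[/andP[b1 b2] /andP[b3 b4]].
have zne : z != w by rewrite -subr_eq0 -nm_gt0 zw.
have zs : nm (z - w) < s by rewrite zw; exact: lt_le_trans ts.
have hz : nm (z - c) < r by have := nm_tri w z c; rewrite zw; move: b4; clear; lra.
have := E z (finb_chart0 hg zs) (H0 z ltac:(by rewrite zw) zne) hz.
have h1 := H1 z ltac:(by rewrite zw).
have h2 := H2 z ltac:(by rewrite zw); rewrite g0 subr0 in h2.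
have k1 : nm (fp g z) ^+ 2 <= e / (2 * M).
  have : nm (fp g z) ^+ 2 <= K * 1.
    rewrite expr2; apply: ler_pM; rewrite ?nm_ge0 ?ltW //.
    by apply: lt_le_trans h2 _; rewrite /K ge_min lexx.
  by rewrite mulr1 => /le_trans; apply; rewrite /K ge_min lexx orbT.
have k2 : M * nm (fp g z) ^+ 2 <= e / 2.
  by move: k1; rewrite invfM mulrA ler_pdivlMr // mulrC.
rewrite mulrDr mulr1 => h3.
have h4 := nm_triB (dv (fp g) w) (dv (fp g) z); rewrite (nmBC (dv (fp g) w)) in h4.
have arith (a1 a2 a3 a4 : R) : a1 - a2 <= a3 -> a3 < e / 2 -> a2 <= M + a4 -> a4 <= e / 2 -> a1 <= M + e.
  by clear; lra.
exact: arith h4 h1 h3 k2.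
Qed.

End Sphere.

(** * Marty's criterion *)

Section Marty.
Context {R : realType}.
Local Notation C := R[i].
Local Notation S := (sphere R).
Local Notation fp := finite_part.
Implicit Types (p q v : S) (f g : C -> S) (c z w a : C) (r e M : R).

Lemma chart0_finb f c r : (forall w, nm (w - c) < r -> chart0 f w) -> finb f c r.
Proof.
move=> H; split=> w /H hw; first exact: chart0_finite.
by exists (dv (fp f) w); exact: chart0_cdiff.
Qed.

(** While [|f - f c| <= 1], one has [|f| <= 3] and [|f'| <= M (1 + 9)]. Continuing along a radius
    with slope [11 M], which leaves [M] for the error, the variation stays below 1 because
    [20 M r <= 1]. A pole cannot be met on the way, as [|f| <= 3] just before it. *)
Lemma bounded_chart M f c r : 0 < M -> 20 * (M * r) <= 1 -> sph_le M f c r ->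
  f c <> None -> nm (fp f c) <= 2 ->
  finb f c r /\ forall w, nm (w - c) < r -> nm (fp f w) <= 3.
Proof.
move=> M0 Mr H fc fc2.
suff K w : nm (w - c) < r -> f w <> None /\ nm (fp f w - fp f c) <= 1.
  split.
    by apply: chart0_finb => w hw; apply: mero_finite; [case: (H w hw)|case: (K w hw)].
  move=> w /K [_ h]; have := nm_triB (fp f w) (fp f c).
  by move: h fc2; clear; lra.
move=> hw; set L := nm (w - c) in hw.
have L0 : 0 <= L := nm_ge0 _.
pose x t := c + t%:C * (w - c).
have xc t : 0 <= t -> t <= 1 -> nm (x t - c) < r.
  move=> t0 t1; rewrite /x addrC addKr normcM nmC (ger0_norm t0).
  by apply: le_lt_trans hw; rewrite ler_piMl.
have xx s t : nm (x s - x t) = `|s - t| * L.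
  by rewrite -nmC -normcM rmorphB /=; congr nm; rewrite /x; ring.
have ML : 11 * (M * L) <= 1.
  have : M * L <= M * r by rewrite ler_pM2l // ltW.
  have : 0 <= M * L by rewrite mulr_ge0 // ltW.
  by move: Mr; move: (M * L) (M * r) => u v; clear; lra.
pose Q t := f (x t) <> None /\ nm (fp f (x t) - fp f c) <= 11 * (M * L) * t.
have Q1 t : 0 <= t -> t <= 1 -> Q t -> nm (fp f (x t) - fp f c) <= 1.
  move=> t0 t1 [_ h]; apply: (le_trans h); rewrite -[leRHS]mulr1.
  by apply: ler_pM => //; rewrite ?mulr_ge0 // ltW.
have ex : x 1 = w by rewrite /x rmorph1; ring.
suff QQ : forall t, 0 <= t -> t <= 1 -> Q t.
  have := QQ 1 ler01 (lexx 1) => q1; have := Q1 1 ler01 (lexx 1) q1.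
  by case: q1; rewrite ex.
apply: real_induction.
- by rewrite /Q /x rmorph0 mul0r addr0 subrr nm0 mulr0.
- move=> t t0 t1 qt; have [mt bt] := H _ (xc t t0 (ltW t1)).
  have ct := mero_finite mt (proj1 qt).
  have d10 : nm (dv (fp f) (x t)) <= 10 * M.
    apply: le_trans (bt ct) _; rewrite mulrC ler_pM2r //.
    have h1 := Q1 t t0 (ltW t1) qt.
    have h2 : nm (fp f (x t)) <= 3.
      by have := nm_triB (fp f (x t)) (fp f c); move: h1 fc2; clear; lra.
    have := nm_ge0 (fp f (x t)); move: h2; move: (nm (fp f (x t))) => u; rewrite expr2; clear; nra.
  have [del del0 Hd] := chart0_cdiff ct M0.
  have [s s0 [hs _]] := ct.
  pose b := Num.min del s.
  have b0 : 0 < b by rewrite /b lt_min del0.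
  have L1 : 0 < L + 1 by rewrite ltr_wpDl.
  exists (b / (L + 1)); first by rewrite divr_gt0.
  move=> y ty yb _.
  have yt : y - t < b / (L + 1) by rewrite ltrBlDl.
  have yt0 : 0 <= y - t by rewrite subr_ge0 ltW.
  have nxy : nm (x y - x t) < b.
    rewrite xx ger0_norm //; move: yt; rewrite ltr_pdivlMr // => yt.
    by apply: le_lt_trans yt; rewrite ler_wpM2l // lerDl.
  have [n1 n2] : nm (x y - x t) < del /\ nm (x y - x t) < s.
    by move: nxy; rewrite /b lt_min => /andP[].
  split; first exact: hs.
  have k := Hd _ n1.
  have e1 : nm (fp f (x y) - fp f (x t)) <= 11 * M * ((y - t) * L).
    rewrite (_ : fp f (x y) - fp f (x t) = (fp f (x y) - fp f (x t) - dv (fp f) (x t) * (x y - x t))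
       + dv (fp f) (x t) * (x y - x t)); last by ring.
    apply: le_trans (le_normcD _ _) _; rewrite normcM.
    have e2 : nm (dv (fp f) (x t)) * nm (x y - x t) <= 10 * M * nm (x y - x t).
      by rewrite ler_wpM2r ?nm_ge0.
    have e3 : nm (x y - x t) = (y - t) * L by rewrite xx ger0_norm.
    rewrite e3 in k e2 *.
    apply: le_trans (lerD k e2) _; rewrite -mulrDl ler_wpM2r ?mulr_ge0 //.
    by move: M0; clear; lra.
  apply: le_trans (nm_tri (fp f (x t)) _ _) _.
  apply: le_trans (lerD e1 (proj2 qt)) _; rewrite le_eqVlt; apply/orP; left; apply/eqP; ring.
- move=> t t0 t1 qt; have [mt _] := H _ (xc t (ltW t0) t1).
  have near (e : R) : 0 < e -> exists y, [/\ 0 <= y, y < t & nm (x y - x t) < e].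
    move=> e0; have L1 : 0 < L + 1 by rewrite ltr_wpDl.
    pose d := Num.min t (e / (L + 1)).
    have d0 : 0 < d by rewrite /d lt_min t0 divr_gt0.
    have d20 : d / 2 < d by rewrite ltr_pdivrMr // ltr_pMr // ltr1n.
    have [d1 d2] : d <= t /\ d <= e / (L + 1) by rewrite /d !ge_min !lexx orbT.
    exists (t - d / 2); split.
    - by rewrite subr_ge0 ltW // (lt_le_trans d20).
    - by rewrite gtrBl divr_gt0.
    - rewrite xx addrAC subrr sub0r normrN ger0_norm; last by rewrite ltW // divr_gt0.
      move: d2; rewrite ler_pdivlMr // => d2; apply: lt_le_trans d2.
      apply: (@le_lt_trans _ _ (d / 2 * (L + 1))); last by rewrite ltr_pM2r.
      by rewrite ler_wpM2l ?lerDl // ltW // divr_gt0.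
  have ct : chart0 f (x t).
    case: mt => // -[s s0 hs]; apply: mero_finite; first by right; exists s.
    move=> fn.
    have zz : nm (x t - x t) < s by rewrite subrr nm0.
    have g0 : fp (fun w => sinv (f w)) (x t) = 0 by rewrite /fp /finite_part fn.
    have q0 : (0 : R) < 4^-1 by rewrite invr_gt0.
    have [del del0 Hd] := hol_ccont (proj2 hs) zz q0.
    have m0 : 0 < Num.min del s by rewrite lt_min del0.
    have [y [y0 yt]] := near _ m0; rewrite lt_min => /andP[/Hd h1 h2].
    rewrite g0 subr0 in h1.
    have [fy by_] := qt y y0 yt.
    have y1 : y <= 1 by rewrite (le_trans (ltW yt)).
    have := Q1 y y0 y1 (qt y y0 yt) => k1.
    have k3 : nm (fp f (x y)) <= 3.
      by have := nm_triB (fp f (x y)) (fp f c); move: k1 fc2; clear; lra.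
    have f0 : fp f (x y) != 0.
      apply/eqP => f0; have := proj1 hs _ h2; move: (fpE fy); rewrite f0 => -> /=.
      by rewrite eqxx.
    have n0 : 0 < nm (fp f (x y)) by rewrite nm_gt0.
    move: h1; rewrite fp_sinv // normcV ltf_pV2 ?posrE //.
    by move: k3; clear; lra.
  split; first exact: chart0_finite.
  apply/ler_addgt0Pr => e e0.
  have [s s0 [hs1 hs2]] := ct.
  have zz : nm (x t - x t) < s by rewrite subrr nm0.
  have [del del0 Hd] := hol_ccont hs2 zz e0.
  have [y [y0 yt /Hd h1]] := near _ del0.
  have [_ by_] := qt y y0 yt.
  have k : 11 * (M * L) * y <= 11 * (M * L) * t 
    by apply: ler_wpM2l; [rewrite mulr_ge0 // mulr_ge0 // ltW|exact: ltW].
  have := nm_tri (fp f (x y)) (fp f (x t)) (fp f c); rewrite (nmBC (fp f (x t)) (fp f (x y))) => k2.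
  have arith (a1 a2 a3 a4 a5 : R) : a1 <= a2 + a3 -> a2 < e -> a3 <= a4 -> a4 <= a5 -> a1 <= a5 + e.
    by clear; lra.
  exact: arith k2 h1 by_ k.
Qed.

Lemma rational_dense z e : 0 < e -> exists q : rat * rat, nm ((ratr q.1 +i* ratr q.2) - z) < e.
Proof.
move=> e0; have e20 : 0 < e / 2 by rewrite divr_gt0.
have h (x : R) : x < x + e / 2 by rewrite ltrDl.
have [a] := rat_in_itvoo (h (Re z)); have [b] := rat_in_itvoo (h (Im z)).
rewrite !in_itv /= => /andP[b1 b2] /andP[a1 a2]; exists (a, b).
apply: le_lt_trans (nm_ReIm _) _; case: z a1 a2 b1 b2 => x y /= a1 a2 b1 b2.
rewrite !ger0_norm ?subr_ge0 ?ltW //.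
by move: a2 b2; clear; lra.
Qed.

Definition ratpt (n : nat) : C :=
  if @unpickle (rat * rat)%type n is Some q then ratr q.1 +i* ratr q.2 else 0.

Lemma ratpt_dense z e : 0 < e -> exists n, nm (ratpt n - z) < e.
Proof.
by move=> /(rational_dense z) [q hq]; exists (pickle q); rewrite /ratpt pickleK.
Qed.

Lemma hol_lip (F : C -> C) c r B z w : 0 < r -> holomorphic c r F ->
  (forall x, nm (x - c) < r -> nm (F x) <= B) -> nm (z - c) < r / 2 -> nm (w - c) < r / 2 ->
  nm (F w - F z) <= 4 * B / r * nm (w - z).
Proof.
move=> r0 hF FB hz hw.
apply: mean_value => t t0 t1; set x := z + t%:C * (w - z).
have xc : nm (x - c) < r / 2.
  rewrite (_ : x - c = (1 - t)%:C * (z - c) + t%:C * (w - c)); last first.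
    by rewrite /x rmorphB rmorph1; ring.
  apply: le_lt_trans (le_normcD _ _) _; rewrite !normcM !nmC (ger0_norm t0).
  rewrite ger0_norm ?subr_ge0 //.
  have := @segment_itv R (nm (z - c)) (nm (w - c)) t (r / 2).
  have := nm_ge0 (z - c); have := nm_ge0 (w - c).
  move=> p1 p2 /(_ ltac:(lra) hz ltac:(lra) hw t0 t1) [_].
  by rewrite (_ : nm (z - c) + _ = (1 - t) * nm (z - c) + t * nm (w - c)); last by ring.
have k y : nm (y - x) < r / 2 -> nm (y - c) < r.
  by move=> hy; have := nm_tri x y c; move: hy xc; clear; lra.
exists (dv F x).
  by apply: (hol_cdiff hF); apply: k; rewrite subrr nm0 divr_gt0.
have r40 : 0 < r / 4 by rewrite divr_gt0.
have r42 : r / 4 < r / 2 by move: r0; clear; lra.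
apply: le_trans (cauchy_deriv (M := B) r40 r42 _ _) _.
- by move=> y /k; exact: hF.
- by move=> y hy; apply: FB; apply: k; rewrite hy.
- by rewrite le_eqVlt; apply/orP; left; apply/eqP; field; rewrite gt_eqF.
Qed.

(** Uniformly bounded holomorphic functions are uniformly Lipschitz on a smaller disc, so
    convergence on the dense set of the [ratpt n] becomes uniform there. *)
Lemma equilip_cauchy (F : nat -> C -> C) c r B J0 : 0 < r -> 
  (forall j, (J0 <= j)%N -> holomorphic c r (F j) /\ forall x, nm (x - c) < r -> nm (F j x) <= B) ->
  (forall n, nm (ratpt n - c) < r -> exists l, tends (fun j => F j (ratpt n)) l) ->
  exists h, ucvg c (r / 4) F h.
Proof.
move=> r0 HF Hl.
have B0 : 0 <= B.
  by apply: le_trans (nm_ge0 (F J0 c)) ((HF J0 (leqnn _)).2 _ _); rewrite subrr nm0.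
have r4 : r / 4 < r / 2 by move: r0; clear; lra.
have cauchy (e : R) : 0 < e -> exists J, forall j, (J <= j)%N ->
    forall w, cdisc c (r / 4) w -> forall i, (J <= i)%N -> nm (F i w - F j w) < e.
  move=> e0.
  pose K := 4 * B / r; have K0 : 0 <= K by rewrite divr_ge0 ?mulr_ge0 // ltW.
  have K1 : 0 < 8 * (K + 1) by rewrite mulr_gt0 // ltr_wpDl.
  (* Points within [d] of [z] are within [2 d] of a rational point [q], and [2 K d <= e / 4] pays
     for the passage from one to the other. *)
  have [d [d0 d1 d2]] : exists d, [/\ 0 < d, d <= r / 8 & d <= e / (8 * (K + 1))].
    by exists (Num.min (r / 8) (e / (8 * (K + 1)))); rewrite lt_min !ge_min !lexx orbT !divr_gt0.
  have [|J HJ] := @compact_nat R (cdisc c (r / 4)) (fun J w => forall i j, (J <= i)%N -> (J <= j)%N ->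
      nm (F i w - F j w) < e) (cdisc_compact (c := c) (r := r / 4)).
    move=> z hz; have [n hn] := ratpt_dense z d0.
    move: (ratpt n) hn (Hl n) => q hn Hlq.
    have hq : nm (q - c) < r / 2.
      by have := nm_tri z q c; move: r0 hn d1 hz; rewrite /cdisc /=; clear; lra.
    have r2 : r / 2 < r by move: r0; clear; lra.
    have [l Hq] := Hlq (lt_trans hq r2).
    have e80 : 0 < e / 8 by rewrite divr_gt0.
    have [J HJ] := Hq _ e80.
    exists d => //; exists (maxn J J0) => w hw m hm i j mi mj.
    have hwc : nm (w - c) < r / 2.
      by have := nm_tri z w c; move: r0 hw d1 hz; rewrite /cdisc /=; clear; lra.
    have wq : nm (w - q) < 2 * d.
      by have := nm_tri z w q; rewrite (nmBC z q); move: hw hn; clear; lra.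
    have [Ji J0i] : (J <= i)%N /\ (J0 <= i)%N by have := leq_trans hm mi; rewrite geq_max => /andP.
    have [Jj J0j] : (J <= j)%N /\ (J0 <= j)%N by have := leq_trans hm mj; rewrite geq_max => /andP.
    have lip k : (J0 <= k)%N -> nm (F k w - F k q) <= e / 4.
      move=> hk; have [hol bd] := HF k hk.
      apply: le_trans (hol_lip r0 hol bd hq hwc) _; rewrite -/K.
      have : K * nm (w - q) <= (K + 1) * (2 * d).
        by apply: ler_pM; rewrite ?nm_ge0 ?lerDl // ltW.
      have : d * (8 * (K + 1)) <= e by rewrite -ler_pdivlMr.
      by move: (K * nm (w - q)) => u; clear; lra.
    have l1 := lip i J0i; have l2 := lip j J0j.
    have c1 := HJ i Ji; have c2 := HJ j Jj.
    have t1 := nm_tri (F i q) (F i w) (F j w).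
    have t2 := nm_tri l (F i q) (F j w); have t3 := nm_tri (F j q) l (F j w).
    rewrite (nmBC l (F j q)) in t3; rewrite (nmBC (F j q) (F j w)) in t3.
    by move: l1 l2 c1 c2 t1 t2 t3 e0; clear; lra.
  exists J => j Jj w hw i Ji; exact: (HJ J (leqnn J) w hw i j).
have lim w : exists l, nm (w - c) <= r / 4 -> tends (fun j => F j w) l.
  have [hw|] := leP (nm (w - c)) (r / 4); last by exists 0.
  have [|l Hl'] := @cauchy_tends R (fun j => F j w).
    by move=> e /cauchy [J HJ]; exists J => n m Jn Jm; exact: (HJ m Jm w hw n Jn).
  by exists l.
have [h Hh] := choice lim.
exists h => e e0; have e20 : 0 < e / 2 by rewrite divr_gt0.
have [J HJ] := cauchy _ e20; exists J => j Jj w hw.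
have [J' HJ'] := Hh w (ltW hw) _ e20.
have h1 := HJ' _ (leq_maxr J J').
have h2 := HJ j Jj w (ltW hw) _ (leq_maxl J J').
have := nm_tri (F (maxn J J') w) (F j w) (h w); rewrite (nmBC (F j w) (F (maxn J J') w)).
by move: h1 h2; clear; lra.
Qed.

Definition lconv0 (u : nat -> C -> S) g z := exists2 r, 0 < r &
  [/\ exists J, forall j, (J <= j)%N -> finb (u j) z r, finb g z r &
      ucvg z r (fun j => fp (u j)) (fp g)].

(** Phrased with charts instead of the chordal distance, so that Hurwitz's theorem and the
    convergence of derivatives apply directly. *)
Definition lconv u g z := lconv0 u g z \/
  lconv0 (fun j w => sinv (u j w)) (fun w => sinv (g w)) z.

Lemma sconv_some (s : nat -> S) a : sconv s (Some a) ->
  tends (fun j => odflt 0 (s j : option C)) a.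
Proof. by move=> H e /H [J HJ]; exists J => j /HJ [w -> hw]. Qed.

Lemma tends_sconv (s : nat -> S) a J : (forall j, (J <= j)%N -> s j <> None) ->
  tends (fun j => odflt 0 (s j : option C)) a -> sconv s (Some a).
Proof.
move=> sN H e /H [J' HJ']; exists (maxn J J') => j; rewrite geq_max => /andP[/sN sj /HJ'].
by case: (s j) sj => // w _ hw; exists w.
Qed.

(** [|v| <= 3/2] gives [|u j c| <= 2] for large [j], and then [|u j| <= 3] on the whole disc; the
    limits at the rational points in it are therefore finite. *)
Lemma marty_local (u : nat -> C -> S) c r M J0 (v : C) : 0 < r -> 0 < M -> 20 * (M * r) <= 1 ->
  (forall j, (J0 <= j)%N -> sph_le M (u j) c r) ->
  (forall n, exists v, sconv (fun j => u j (ratpt n)) v) ->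
  sconv (fun j => u j c) (Some v) -> nm v <= 3 / 2 ->
  exists h, [/\ exists J, forall j, (J <= j)%N -> finb (u j) c (r / 4),
    ucvg c (r / 4) (fun j => fp (u j)) h &
    forall w, nm (w - c) < r / 4 -> sconv (fun j => u j w) (Some (h w))].
Proof.
move=> r0 M0 Mr Hs Hq Hv v2.
have h20 : (0 : R) < 2^-1 by rewrite invr_gt0.
have [J1 HJ1] := Hv _ h20; pose J := maxn J0 J1.
have good j : (J <= j)%N -> finb (u j) c r /\ forall w, nm (w - c) < r -> nm (fp (u j) w) <= 3.
  rewrite geq_max => /andP[/Hs hj /HJ1 [w uw hw]].
  apply: (bounded_chart M0 Mr hj); first by rewrite uw.
  by rewrite (fp_some uw); have := nm_triB w v; move: hw v2; clear; lra.
have [||h Hh] := @equilip_cauchy (fun j => fp (u j)) c r 3 J r0.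
- by move=> j /good [[]].
- move=> n hn; have [[a|] Ha] := Hq n; first by exists a; exact: (sconv_some Ha).
  have q0 : (0 : R) < 4^-1 by rewrite invr_gt0.
  have [J2 HJ2] := Ha _ q0; pose j := maxn J J2.
  have [[fin _] bd] := good j (leq_maxl _ _).
  have := HJ2 j (leq_maxr _ _) => -[w]; have := bd _ hn; have := fin _ hn.
  move=> /fpE -> /=; case: ifP => // a0; set a := fp _ _ in a0 * => b3 [<-].
  have an : 0 < nm a by rewrite nm_gt0 a0.
  by rewrite normcV ltf_pV2 ?posrE //; move: b3; clear; lra.
have r4 : r / 4 < r by move: r0; clear; lra.
exists h; split => //.
  by exists J => j /good [hf _]; apply: finb_sub hf _; rewrite subrr nm0 add0r ltW.
move=> w hw; apply: (@tends_sconv _ _ J).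
  by move=> j /good [[hf _] _]; apply: hf; exact: lt_trans r4.
by move=> e /Hh [J' HJ']; exists J' => j /HJ' /(_ w hw).
Qed.

Lemma marty (D : C -> Prop) (u : nat -> C -> S) :
  (forall z, D z -> exists r M J, [/\ 0 < r, 0 < M &
     forall j, (J <= j)%N -> sph_le M (u j) z r]) ->
  exists phi : nat -> nat, increasing_seq phi /\
    exists g, forall z, D z -> lconv (fun j => u (phi j)) g z.
Proof.
move=> H.
have [phi [inc Hphi]] := diagonal_subsequence (fun i j => u j (ratpt i)).
exists phi; split => //.
pose U j := u (phi j).
(* [g] is the pointwise limit where there is one; elsewhere its value is arbitrary. *)
have ex z : exists v, (exists v', sconv (fun j => U j z) v') -> sconv (fun j => U j z) v.
  have [[v hv]|no] := pselect (exists v', sconv (fun j => U j z) v'); first by exists v.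
  by exists None.
have [g Hg] := choice ex.
have gE z v : sconv (fun j => U j z) v -> g z = v.
  by move=> hv; exact: sconv_unique (Hg z (ex_intro _ v hv)) hv.
exists g => z /H [r [M [J [r0 M0 HJ]]]].
have {}HJ j : (J <= j)%N -> sph_le M (U j) z r.
  by move=> Jj; apply: HJ; exact: leq_trans (increasing_ge inc j).
have M200 : 0 < 20 * M by rewrite mulr_gt0.
have [s [s0 s1 s2]] : exists s, [/\ 0 < s, s <= r / 2 & s <= 1 / (20 * M)].
  by exists (Num.min (r / 2) (1 / (20 * M))); rewrite lt_min !ge_min !lexx orbT !divr_gt0.
have Ms : 20 * (M * s) <= 1 by rewrite mulrA mulrC -ler_pdivlMr.
have s80 : 0 < s / 8 by rewrite divr_gt0.
(* Convergence of the subsequence is known at the points [ratpt n] only, so the disc is recentred at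
   one of them. The disc of radius [s / 4] about [q] still contains that of radius [s / 8] about
   [z]. *)
have [n hn] := ratpt_dense z s80; set q := ratpt n in hn.
have hq : nm (q - z) + s <= r by move: hn s1 s0; clear; lra.
have Hs j : (J <= j)%N -> sph_le M (U j) q s by move=> /HJ hj; apply: sph_le_sub hj hq.
have Hs' j : (J <= j)%N -> sph_le M (fun w => sinv (U j w)) q s.
  by move=> /Hs; exact: sph_le_inv.
have [v Hv] := Hphi n; rewrite -/q in Hv.
have fin (W : nat -> C -> S) (k : C -> S) : (exists h, [/\ exists J, forall j, (J <= j)%N -> finb (W j) q (s / 4),
    ucvg q (s / 4) (fun j => fp (W j)) h &
    forall w, nm (w - q) < s / 4 -> sconv (fun j => W j w) (Some (h w))]) ->
    (forall w v, sconv (fun j => W j w) v -> k w = v) -> lconv0 W k z.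
  move=> [h [[J' HJ'] uh sh]] kE; exists (s / 8) => //.
  have zq : nm (z - q) + s / 8 <= s / 4 by rewrite nmBC; move: hn; clear; lra.
  have kh w : nm (w - q) < s / 4 -> k w = Some (h w) by move=> /sh; exact: kE.
  have s40 : 0 < s / 4 by rewrite divr_gt0.
  have uk : ucvg q (s / 4) (fun j => fp (W j)) (fp k).
    move=> e /uh [J2 HJ2]; exists J2 => j /HJ2 hj w hw.
    by rewrite (fp_some (kh w hw)); exact: hj.
  split.
  - by exists J' => j /HJ' hj; apply: finb_sub hj zq.
  - apply: finb_sub zq; split; first by move=> w /kh ->.
    by apply: weierstrass s40 _ uk; exists J' => j /HJ' [].
  - exact: ucvg_sub uk zq.
have Hq i : exists v, sconv (fun j => U j (ratpt i)) v := Hphi i.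
have Hq' i : exists v, sconv (fun j => sinv (U j (ratpt i))) v.
  by have [x Hx] := Hq i; exists (sinv x); exact: sconv_inv.
have gE' w x : sconv (fun j => sinv (U j w)) x -> sinv (g w) = x.
  move=> /sconv_inv hx; rewrite -[x]sinvK; congr sinv; apply: gE.
  by move: hx; under eq_fun do rewrite sinvK.
have Hv' := sconv_inv Hv.
case: v Hv Hv' => [a|] Hv Hv'.
  (* Either [|a| <= 3/2] or [|1 / a| <= 2/3], so one of the two charts is within reach of
     [marty_local]. *)
  have [a1|a1] := leP (nm a) (3 / 2); first by left; apply: (fin U g) => //; exact: (marty_local s0 M0 Ms Hs Hq Hv a1).
  right; apply: (fin (fun j w => sinv (U j w))) => //.
  move: Hv' => /=; case: eqP => [a0|_ Hv'].
    by move: a1; rewrite a0 nm0; lra.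
  apply: (marty_local s0 M0 Ms Hs' Hq' Hv').
  have an : 0 < nm a by move: a1; lra.
  rewrite normcV invf_ple ?posrE //; move: a1; lra.
right; apply: (fin (fun j w => sinv (U j w))) => //.
by apply: (marty_local s0 M0 Ms Hs' Hq' Hv'); rewrite nm0 divr_ge0.
Qed.

End Marty.

(** * Zalcman's lemma *)

Section Conversions.
Context {R : realType}.
Local Notation C := R[i].
Local Notation S := (sphere R).
Local Notation fp := finite_part.
Implicit Types (f g : C -> S) (c z w a : C) (r e M : R).

Lemma nm_le_add a z e : nm (a - z) < e -> nm a <= nm z + e.
Proof. by have := nm_triB a z; move: (nm a) (nm z) (nm _) => x y u; clear; lra. Qed.

Lemma nm_half_le a z : nm (a - z) < nm z / 2 -> nm z / 2 <= nm a /\ nm a <= 2 * nm z.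
Proof.
have := nm_triB a z; have := nm_triB z a; rewrite (nmBC z a); have := nm_ge0 z.
by move: (nm a) (nm z) (nm _) => x y u; clear; move=> *; split; lra.
Qed.

Lemma derivable_exists (F : C -> C) z : derivable (F : C^o -> C^o) z 1 <-> exists d, cdiff F z d.
Proof.
by split=> [/derivable_cdiff H|[d /cdiff_derivable]] //; eexists; exact: H.
Qed.

Lemma regular_chart0 f z : regular_at f z -> chart0 f z.
Proof.
move=> [/nbhsC_P [r r0 hr] /nbhsC_P [s s0 hs]].
exists (Num.min r s); first by rewrite lt_min r0.
by split=> w; rewrite lt_min => /andP[h1 h2]; [exact: hr|apply/derivable_exists; exact: hs].
Qed.

Lemma chart0_regular f z : chart0 f z -> regular_at f z.
Proof.
move=> [r r0 [h1 h2]]; split; apply/nbhsC_P; exists r => //.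
by move=> w hw; apply/derivable_exists; exact: h2.
Qed.

Lemma dv_sinv f z : chart0 f z -> fp f z != 0 ->
  dv (fp (fun w => sinv (f w))) z = - dv (fp f) z / fp f z ^+ 2.
Proof.
move=> cf f0; have [s s0 [hfin hs]] := cf.
have zz : nm (z - z) < s by rewrite subrr nm0.
have [del del0 Hd] := hol_ccont hs zz (eq_ind_r (fun b => is_true b) f0 (nm_gt0 (fp f z))).
apply: cdiff_dv; have := cdiffV f0 (chart0_cdiff cf).
have m0 : 0 < Num.min s del by rewrite lt_min s0.
apply: (cdiff_near m0) => u; rewrite lt_min => /andP[h1 /Hd h2].
rewrite fp_sinv //; first exact: hfin.
by apply: contraTneq h2 => ->; rewrite sub0r normcN ltxx.
Qed.

(** [1 / f] tends to 0 at a pole, so it is continuous there and the singularity is removable. *)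
Lemma pole_chart0 f z : pole_at f z -> chart0 (fun w => sinv (f w)) z.
Proof.
move=> [fz /nbhsC_P [r r0 hr] lim].
have near e : 0 < e -> exists2 s : R, 0 < s & forall w, nm (w - z) < s -> w != z ->
    exists2 a : C, sinv (f w) = Some a & nm a < e.
  move=> e0; have := lim _ (snear_nbhs None e0) => /nbhsC_P [s s0 hs].
  by exists s => // w hw wz; exact: hs.
have [s s0 hs] := near 1 ltr01.
pose m := Num.min r s; have m0 : 0 < m by rewrite lt_min r0.
exists m => //; split.
  move=> w; rewrite lt_min => /andP[_ hw]; have [->|wz] := eqVneq w z; first by rewrite fz.
  by have [a ->] := hs w hw wz.
have hc : ccont (fp (fun w => sinv (f w))) z.
  move=> e /near [s' s'0 hs']; exists s' => // w hw.
  rewrite [fp _ z](@fp_some _ _ _ 0) ?fz // subr0; have [->|wz] := eqVneq w z.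
    by rewrite (@fp_some _ _ _ 0) ?fz //; have [a _] := hs' (z + (s' / 2)%:C) ltac:(by rewrite addrC addKr nmC gtr0_norm ?divr_gt0 // ltr_pdivrMr // ltr_pMr // ltr1n) ltac:(by rewrite -subr_eq0 addrC addKr -nm_gt0 nmC normr_gt0 gt_eqF // divr_gt0); rewrite nm0; exact: le_lt_trans (nm_ge0 a).
  by have [a fa ha] := hs' w hw wz; rewrite (fp_some fa).
have off w : nm (w - z) < m -> w != z -> exists d, cdiff (fp (fun w => sinv (f w))) w d.
  move=> hw wz; have [hw1 hw2] : nm (w - z) < r /\ nm (w - z) < s.
    by move: hw; rewrite lt_min => /andP.
  have [b fb _] := hs w hw2 wz.
  have cf : chart0 f w.
    have wz0 : 0 < nm (w - z) by rewrite nm_gt0 subr_eq0.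
    have t0 : 0 < Num.min (nm (w - z)) (r - nm (w - z)) by rewrite lt_min wz0 subr_gt0.
    exists (Num.min (nm (w - z)) (r - nm (w - z))) => //.
    have key x : nm (x - w) < Num.min (nm (w - z)) (r - nm (w - z)) -> f x <> None /\ derivable (fp f) x 1.
      rewrite lt_min => /andP[x1 x2]; apply: hr.
        by have := nm_tri w x z; move: x2; clear; lra.
      by apply: contraTneq x1 => ->; rewrite nmBC ltxx.
    by split=> x /key [k1 k2] //; apply/derivable_exists.
  have f0 : fp f w != 0.
    apply/eqP => E; move: (fpE (chart0_finite cf)) => fw; move: fb; rewrite fw E /=.
    by rewrite eqxx.
  have [t t0 [_ ht]] := chart0_inv cf f0.
  by apply: ht; rewrite subrr nm0.
apply: (@removable R _ z m z m0) => // w hw.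
have [->//|wz] := eqVneq w z.
by have [d] := off w hw wz; exact: cdiff_ccont.
Qed.

Lemma meromorphic_mero (D : set C^o) f z : meromorphic_on D f -> D z -> mero f z.
Proof. by move=> H /H [/regular_chart0|/pole_chart0]; [left|right]. Qed.

(** Stated with local factorisations: a function that vanishes near [z] satisfies it vacuously, and
    [0 < m] discards the points where [f] is nonzero. *)
Definition zmult k f z := forall m (h : C -> C) r, 0 < r -> holomorphic z r h -> h z != 0 ->
  (forall w, nm (w - z) < r -> f w = Some ((w - z) ^+ m * h w)) -> (0 < m)%N -> (k < m)%N.

Lemma zeros_zmult (D : set C^o) k f z : zeros_multiplicity_ge D f (2 * k + 1)%N -> D z -> zmult k f z.
Proof.
move=> H Dz m h r r0 hh hz fE m0.
suff : (2 * k + 1 <= m)%N by apply: leq_trans; rewrite addn1 ltnS mul2n -addnn leq_addr.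
apply: (H z m Dz); split.
  have := fE z; rewrite subrr nm0 => /(_ r0); rewrite expr0n.
  by rewrite (gtn_eqF m0) mul0r.
exists h; split => //.
  by apply/nbhsC_P; exists r => // w hw; apply/derivable_exists; exact: hh.
by apply/nbhsC_P; exists r.
Qed.

(** Models a zero of order [m] at distance [y], with [|f| >= c y^m] and [|f'| <= B y^(m-1)]. If
    [t B < 2 c y], the inequality between arithmetic and geometric means suffices. Otherwise [y] is
    at most a multiple of [t], the left side is of order [t^(k+m)], and [k < m] makes it smaller
    than [t^(2k)]. *)
Lemma zalcman_arith (c B : R) (k m : nat) : 0 < c -> 0 < B -> (k < m)%N -> exists2 tau, 0 < tau &
  forall t y, 0 < t -> t < tau -> 0 <= y ->
    t ^+ k.+1 * (B * y ^+ m.-1) < t ^+ (2 * k) + (c * y ^+ m) ^+ 2.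
Proof.
move=> c0 B0 km.
have m0 : (0 < m)%N by exact: leq_ltn_trans km.
pose q := B / (2 * c); have q0 : 0 < q by rewrite divr_gt0 // mulr_gt0.
pose K := B * q ^+ m.-1; have K0 : 0 < K by rewrite mulr_gt0 // exprn_gt0.
exists (Num.min 1 (1 / (K + 1))).
  by rewrite lt_min ltr01 divr_gt0 // ltr_wpDl // ltW.
move=> t y t0; rewrite lt_min => /andP[t1 tK] y0.
have [h|h] := ltP (t * B) (2 * c * y).
  have yp : 0 < y.
    rewrite lt_def y0 andbT; apply: contraTneq h => ->; rewrite mulr0 -leNgt.
    by rewrite mulr_ge0 // ltW.
  have amgm : 2 * c * t ^+ k * y ^+ m <= t ^+ (2 * k) + (c * y ^+ m) ^+ 2.
    rewrite mulnC exprM; move: (t ^+ k) (y ^+ m) => u v.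
    by have := sqr_ge0 (u - c * v); rewrite !expr2; clear; nra.
  apply: lt_le_trans amgm.
  rewrite exprS -{2}(prednK m0) exprS.
  have -> : t * t ^+ k * (B * y ^+ m.-1) = (t * B) * (t ^+ k * y ^+ m.-1) by ring.
  have -> : 2 * c * t ^+ k * (y * y ^+ m.-1) = (2 * c * y) * (t ^+ k * y ^+ m.-1) by ring.
  by rewrite ltr_pM2r // mulr_gt0 // exprn_gt0.
have yq : y <= q * t.
  by rewrite /q mulrAC ler_pdivlMr ?mulr_gt0 // mulrC (mulrC B).
have l1 : B * y ^+ m.-1 <= K * t ^+ m.-1.
  rewrite /K -mulrA ler_pM2l // -exprMn; apply: lerXn2r => //; rewrite nnegrE //.
  by rewrite mulr_ge0 // ltW.
have l2 : t ^+ k.+1 * (B * y ^+ m.-1) <= K * t ^+ (k + m).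
  apply: (@le_trans _ _ (t ^+ k.+1 * (K * t ^+ m.-1))); first by rewrite ler_pM2l ?exprn_gt0.
  by rewrite mulrCA -exprD addSnnS prednK.
apply: (le_lt_trans l2); apply: (@lt_le_trans _ _ (t ^+ (2 * k))); last by rewrite lerDl sqr_ge0.
have -> : (k + m = 2 * k + (m - k))%N by rewrite mul2n -addnn -addnA subnKC // ltnW.
rewrite exprD mulrCA gtr_pMr ?exprn_gt0 //.
have l3 : t ^+ (m - k) <= t.
  rewrite -[leRHS]expr1; apply: ler_wiXn2l; [exact: ltW|exact: ltW|by rewrite subn_gt0].
apply: (@le_lt_trans _ _ (K * t)); first by rewrite ler_pM2l.
move: tK; rewrite ltr_pdivlMr ?ltr_wpDl ?ltW // mulrDr mulr1 mulrC => tK.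
by apply: lt_trans tK; rewrite ltrDl.
Qed.

Lemma exprS_le_self (t : R) k : 0 < t -> t <= 1 -> t ^+ k.+1 <= t.
Proof. by move=> t0 t1; rewrite exprS ger_pMr // exprn_ile1 // ltW. Qed.

Lemma phi_small k f z : mero f z -> zmult k f z -> exists2 e, 0 < e &
  forall w, nm (w - z) < e -> chart0 f w -> forall t, 0 < t -> t < e ->
    t ^+ k.+1 * nm (dv (fp f) w) < t ^+ (2 * k) + nm (fp f w) ^+ 2.
Proof.
move=> mf zf.
have tpos t : 0 < t -> 0 < t ^+ (2 * k) by move=> t0; rewrite exprn_gt0.
have [fz|fz] := pselect (f z = None).
  have [cf|[r r0 hg]] := mf; first by have := chart0_finite cf; rewrite fz.
  have zz : nm (z - z) < r by rewrite subrr nm0.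
  have [del del0 Hd] := hol_dv_cont (proj2 hg) zz ltr01.
  set g := fp _ in Hd; pose B := nm (dv g z) + 1.
  have B0 : 0 < B by rewrite ltr_wpDl ?nm_ge0.
  exists (Num.min (Num.min r del) (Num.min 1 (1 / B))); first by rewrite !lt_min r0 del0 ltr01 divr_gt0.
  move=> w; rewrite !lt_min => /andP[/andP[w1 w2] _] cf t t0; rewrite !lt_min => /andP[_ /andP[t1 tB]].
  have f0 : fp f w != 0.
    apply/eqP => E; have := proj1 hg w w1; move: (fpE (chart0_finite cf)) => ->.
    by rewrite E /= eqxx.
  have gB : nm (dv g w) <= B.
    exact: nm_le_add (Hd w w2).
  (* With [g = 1 / f] one has [|f'| = |g'| |f|^2], and [g'] is bounded near the pole. *)
  have E : nm (dv (fp f) w) = nm (dv g w) * nm (fp f w) ^+ 2.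
    rewrite /g dv_sinv // normcM normcN normcV nmX divfK // expf_neq0 // gt_eqF //.
    by rewrite nm_gt0.
  rewrite E mulrA; apply: (@le_lt_trans _ _ (1 * nm (fp f w) ^+ 2)); last first.
    by rewrite mul1r ltrDr tpos.
  rewrite ler_wpM2r ?exprn_ge0 ?nm_ge0 //.
  apply: (@le_trans _ _ (t * B)).
    by apply: ler_pM => //; [rewrite exprn_ge0 // ltW|exact: nm_ge0|rewrite exprS_le_self // ltW].
  by move: tB; rewrite ltr_pdivlMr // => /ltW.
have [r r0 hf] := mero_finite mf fz.
have zz : nm (z - z) < r by rewrite subrr nm0.
have [f0|[m [h [hh hz fE]]]] := zero_order r0 (proj2 hf).
  exists r => // w hw cf t t0 _.
  have -> : dv (fp f) w = 0.
    apply: cdiff_dv; have rw : 0 < r - nm (w - z) by rewrite subr_gt0.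
    apply: (cdiff_near rw _ (cdiff_cst 0 w)) => x hx; rewrite f0 //.
    by have := nm_tri w x z; move: hx; clear; lra.
  by rewrite nm0 mulr0 ltr_wpDr ?tpos // exprn_ge0 // nm_ge0.
have hz0 : 0 < nm (h z) by rewrite nm_gt0.
have hz20 : 0 < nm (h z) / 2 by rewrite divr_gt0.
have [d1 d10 H1] := hol_ccont hh zz hz20.
have [d2 d20 H2] := hol_dv_cont hh zz ltr01.
have [d3 d30 H3] := hol_dv_cont (proj2 hf) zz ltr01.
have [m0|m0] := posnP m.
  pose B := nm (dv (fp f) z) + 1; pose c := (nm (h z) / 2) ^+ 2.
  have B0 : 0 < B by rewrite ltr_wpDl ?nm_ge0.
  have c0 : 0 < c by rewrite exprn_gt0.
  exists (Num.min (Num.min d1 d3) (Num.min 1 (c / B))); first by rewrite !lt_min d10 d30 ltr01 divr_gt0.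
  move=> w; rewrite !lt_min => /andP[/andP[/H1 w1 /H3 w3] _] cf t t0; rewrite !lt_min => /andP[_ /andP[t1 tB]].
  have fc : c <= nm (fp f w) ^+ 2.
    have [a1 _] := nm_half_le w1.
    have fh : fp f w = h w by rewrite fE m0 expr0 mul1r.
    by rewrite fh /c; apply: lerXn2r a1; rewrite nnegrE ?nm_ge0 // ltW.
  have dB : nm (dv (fp f) w) <= B by exact: nm_le_add w3.
  apply: (@lt_le_trans _ _ c); last by apply: (le_trans fc); rewrite lerDr ltW // tpos.
  apply: (@le_lt_trans _ _ (t * B)); last by rewrite -ltr_pdivlMr.
  by apply: ler_pM => //; [rewrite exprn_ge0 // ltW|exact: nm_ge0|rewrite exprS_le_self // ltW].
have km : (k < m)%N.
  apply: (zf m h r) => // w hw; rewrite -fE; apply: fpE; exact: (proj1 hf).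
have [c [B [c0 B0 [cE BE]]]] : exists c B : R, [/\ 0 < c, 0 < B &
    c = nm (h z) / 2 /\ B = m%:R * (2 * nm (h z)) + (nm (dv h z) + 1)].
  exists (nm (h z) / 2), (m%:R * (2 * nm (h z)) + (nm (dv h z) + 1)); split => //.
  by rewrite ltr_wpDl ?ltr_wpDl ?nm_ge0 // mulr_ge0 // mulr_ge0 // ltW.
have [tau tau0 Ht] := zalcman_arith c0 B0 km.
exists (Num.min (Num.min (Num.min d1 d2) r) (Num.min 1 tau)).
  by rewrite !lt_min d10 d20 r0 ltr01.
move=> w; rewrite !lt_min => /andP[/andP[/andP[/H1 w1 /H2 w2] wr] /andP[wl1 _]] cf t t0; rewrite !lt_min => /andP[_ /andP[t1 tt]].
pose y := nm (w - z); have y0 : 0 <= y := nm_ge0 _.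
have [hw1 hw2] := nm_half_le w1; rewrite -cE in hw1.
have hw3 : nm (dv h w) <= nm (dv h z) + 1 by exact: nm_le_add w2.
have dE : dv (fp f) w = (w - z) ^+ m * dv h w + h w * (m%:R * (w - z) ^+ m.-1 * 1).
  apply: cdiff_dv.
  have := cdiffM (cdiffX m (cdiffB (cdiff_id w) (cdiff_cst z w))) (hol_cdiff hh wr).
  rewrite subr0; apply: (cdiff_near ltr01) => x _; by rewrite fE.
have fl : (c * y ^+ m) ^+ 2 <= nm (fp f w) ^+ 2.
  apply: lerXn2r; rewrite ?nnegrE ?nm_ge0 ?mulr_ge0 ?exprn_ge0 ?(ltW c0) //.
  by rewrite fE normcM nmX -/y mulrC; apply: ler_wpM2l => //; rewrite exprn_ge0.
have dl : nm (dv (fp f) w) <= B * y ^+ m.-1.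
  rewrite dE mulr1; apply: le_trans (le_normcD _ _) _.
  rewrite !normcM !nmX nm_nat -/y BE mulrDl addrC; apply: lerD.
    rewrite mulrC -mulrA [_ * nm (h w)]mulrC mulrA ler_wpM2r ?exprn_ge0 //.
    by rewrite ler_wpM2l.
  have yy : y ^+ m <= y ^+ m.-1.
    by rewrite -{1}(prednK m0) exprS; apply: ler_piMl; [rewrite exprn_ge0|exact: ltW].
  by rewrite mulrC; apply: ler_pM => //; rewrite ?nm_ge0 ?exprn_ge0.
apply: (@le_lt_trans _ _ (t ^+ k.+1 * (B * y ^+ m.-1))).
  by rewrite ler_pM2l // exprn_gt0.
by apply: lt_le_trans (Ht t y t0 tt y0) _; rewrite lerD2l.
Qed.

End Conversions.

(** * Rescaled functions and the choice of the scale *)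

Section Rescaling.
Context {R : realType}.
Local Notation C := R[i].
Local Notation S := (sphere R).
Local Notation fp := finite_part.
Implicit Types (f g : C -> S) (c z w a : C) (r e M : R).

Fixpoint dvn (k : nat) (F : C -> C) : C -> C := if k is k'.+1 then dv (dvn k' F) else F.

Lemma dvnE k (F : C -> C) : dvn k F = (F : C^o -> C^o)^`(k)%classic.
Proof. by elim: k => [|k IH]; [|rewrite derive1nS -IH]. Qed.

Lemma dvnS k F : dvn k.+1 F = dv (dvn k F). Proof. by []. Qed.

Lemma dvnSr k F : dvn k.+1 F = dvn k (dv F).
Proof. by elim: k => [|k IH]; [|rewrite dvnS IH]. Qed.

Lemma hol_dvn k F c r : holomorphic c r F -> holomorphic c r (dvn k F).
Proof. by move=> hF; elim: k => // k IH; rewrite dvnS; exact: hol_dv. Qed.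

Lemma dvn_affine k (F : C -> C) c z t zeta r : (forall x, nm (x - zeta) < r ->
    exists2 s, 0 < s & holomorphic (z + t * x) s F) ->
  forall x, nm (x - zeta) < r ->
  dvn k (fun x => c * F (z + t * x)) x = c * t ^+ k * dvn k F (z + t * x).
Proof.
move=> hF; elim: k => [|k IH] x hx; first by rewrite expr0 mulr1.
rewrite !dvnS; apply: cdiff_dv.
have m0 : 0 < r - nm (x - zeta) by rewrite subr_gt0.
have [s s0 hs] := hF x hx.
have zz : nm (z + t * x - (z + t * x)) < s by rewrite subrr nm0.
have h := cdiffZ (c * t ^+ k) (cdiff_compZ (hol_cdiff (hol_dvn k hs) zz)).
apply: (cdiff_eq (cdiff_near m0 _ h)); last by rewrite exprSr; ring.
move=> w hw; rewrite IH //.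
by have := nm_tri x w zeta; move: hw; clear; lra.
Qed.

Definition scal c (p : S) : S := if p is Some w then Some (c * w : C) else None.

Definition rescale c z t f : C -> S := fun x => scal c (f (z + t * x)).

Lemma fp_rescale c z t f x : fp (rescale c z t f) x = c * fp f (z + t * x).
Proof.
rewrite /fp /finite_part /rescale; case: (f _) => //=.
by rewrite mulr0.
Qed.

Lemma rescaleK c z t f : c != 0 -> t != 0 ->
  rescale c^-1 (- (z / t)) t^-1 (rescale c z t f) = f.
Proof.
move=> c0 t0; apply/funext => x; rewrite /rescale.
have -> : z + t * (- (z / t) + t^-1 * x) = x by field.
by case: (f x) => //= w; rewrite mulKf.
Qed.

Lemma sinv_scal c p : c != 0 -> sinv (scal c p) = scal c^-1 (sinv p).
Proof.
move=> c0; case: p => [w|] /=; last by rewrite mulr0.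
by rewrite mulf_eq0 (negbTE c0) /=; case: eqP => //= _; rewrite invfM.
Qed.

Lemma finb_rescale c z t f x r : t != 0 -> finb f (z + t * x) r ->
  finb (rescale c z t f) x (r / nm t).
Proof.
move=> t0 [h1 h2]; have tn : 0 < nm t by rewrite nm_gt0.
have key w : nm (w - x) < r / nm t -> nm (z + t * w - (z + t * x)) < r.
  by rewrite opprD addrACA subrr add0r -mulrBr normcM ltr_pdivlMr // [nm t * _]mulrC.
split=> w /key hw.
  rewrite /rescale; move: (h1 _ hw); case: (f _) => [v|] h; last by case: h.
  by move=> E; discriminate E.
have [d Hd] := h2 _ hw; exists (c * (d * t)).
apply: (cdiff_near ltr01 _ (cdiffZ c (cdiff_compZ Hd))) => y _.
by rewrite fp_rescale.
Qed.

Lemma chart0_rescale c z t f x : t != 0 -> chart0 f (z + t * x) -> chart0 (rescale c z t f) x.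
Proof.
move=> t0 [r r0 hf]; exists (r / nm t); first by rewrite divr_gt0 // nm_gt0.
exact: finb_rescale.
Qed.

Lemma chart0_rescale_inv c z t f x : c != 0 -> t != 0 -> chart0 (rescale c z t f) x ->
  chart0 f (z + t * x).
Proof.
move=> c0 t0 h; rewrite -(rescaleK z f c0 t0); apply: chart0_rescale.
  by rewrite invr_eq0.
by rewrite (_ : _ + _ = x) //; field.
Qed.

Lemma mero_rescale c z t f x : c != 0 -> t != 0 -> mero f (z + t * x) -> mero (rescale c z t f) x.
Proof.
move=> c0 t0 [h|h]; [left|right]; first exact: chart0_rescale.
rewrite (_ : (fun w => _) = rescale c^-1 z t (fun w => sinv (f w))); last first.
  by apply/funext => w; rewrite /rescale sinv_scal.
exact: chart0_rescale.
Qed.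

Lemma dv_rescale c z t f x : chart0 f (z + t * x) ->
  dv (fp (rescale c z t f)) x = c * (dv (fp f) (z + t * x) * t).
Proof.
move=> cf; apply: cdiff_dv.
apply: (cdiff_near ltr01 _ (cdiffZ c (cdiff_compZ (chart0_cdiff cf)))) => y _.
by rewrite fp_rescale.
Qed.

(** Each point receives the scale [t = s d], with [d] its distance to the circle of radius [2 r0].
    Call [s] admissible if the rescaled spherical derivative is at least 1 at some point. [1 / N] is
    admissible because of the large derivative at [z1], and small [s] are not, by compactness and
    [phi_small]; so halving from [1 / N] meets an admissible [s] with [s / 2] not admissible.
    Failure at [s / 2] bounds the rescaled derivative around the point found for [s]. *)
Lemma zalcman_point f z0 r0 k (N : nat) z1 : 0 < r0 -> r0 <= 1 / 2 -> (0 < N)%N ->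
  (forall z, nm (z - z0) <= 2 * r0 -> mero f z /\ zmult k f z) ->
  nm (z1 - z0) < r0 -> chart0 f z1 ->
  (N%:R / r0) ^+ k.+1 * (1 + nm (fp f z1) ^+ 2) <= nm (dv (fp f) z1) ->
  exists z, exists2 td : R * R, [/\ nm (z - z0) + td.2 = 2 * r0, 0 < td.2, 0 < td.1,
      td.1 * N%:R <= td.2 & chart0 f z] &
    td.1 ^+ (2 * k) + nm (fp f z) ^+ 2 <= td.1 ^+ k.+1 * nm (dv (fp f) z) /\
    forall w, nm (w - z) <= td.2 / 2 -> chart0 f w ->
      td.1 ^+ k.+1 * nm (dv (fp f) w) <= 4 ^+ k.+1 * (td.1 ^+ (2 * k) + nm (fp f w) ^+ 2).
Proof.
move=> r00 r01 N0 hf hz1 c1 big.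
have Nn : (0 : R) < N%:R by rewrite ltr0n.
pose A (s : R) z t d := [/\ nm (z - z0) + d = 2 * r0, 0 < d, t = s * d & chart0 f z] /\
   t ^+ (2 * k) + nm (fp f z) ^+ 2 <= t ^+ k.+1 * nm (dv (fp f) z).
pose E (s : R) := exists z, exists t, exists d, A s z t d.
have start : E (N%:R^-1).
  have [d dE] : exists d, d = 2 * r0 - nm (z1 - z0) by eexists.
  have d0 : r0 < d by rewrite dE; move: hz1; clear; lra.
  have d1 : d <= 1 by rewrite dE; have := nm_ge0 (z1 - z0); move: r01; clear; lra.
  have d00 : 0 < d by exact: lt_trans d0.
  exists z1, (N%:R^-1 * d), d; split.
    by split => //; rewrite dE addrC subrK.
  have t1 : N%:R^-1 * d <= 1.
    by rewrite mulrC ler_pdivrMr // mul1r (le_trans d1) // ler1n.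
  have t0 : 0 < N%:R^-1 * d by rewrite mulr_gt0 // invr_gt0.
  move: t1 t0 => tl tp.
  (* [t <= 1] gives [t^(2k) <= 1], and [d > r0] turns the hypothesis at [z1] into the lower bound
     sought. *)
  apply: (@le_trans _ _ (1 + nm (fp f z1) ^+ 2)).
    by rewrite lerD2r exprn_ile1 // ltW.
  apply: le_trans (ler_wpM2l (exprn_ge0 k.+1 (ltW tp)) big).
  rewrite mulrA -exprMn ler_peMl ?addr_ge0 ?exprn_ge0 ?nm_ge0 //.
  apply: exprn_ege1; rewrite (_ : _ * _ = d / r0); last by field; rewrite !gt_eqF.
  by rewrite ler_pdivlMr // mul1r ltW.
have [sig sig0 Hsig] : exists2 sig : R, 0 < sig & forall s, 0 < s -> E s -> sig <= s.
  have [||e e0 He] := @compact_eps R (cdisc z0 (2 * r0)) (fun e w => chart0 f w ->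
      forall t, 0 < t -> t < e -> t ^+ k.+1 * nm (dv (fp f) w) < t ^+ (2 * k) + nm (fp f w) ^+ 2)
      (cdisc_compact (c := z0) (r := 2 * r0)).
  - by move=> e e' w ee H cw t t0 te; apply: H => //; exact: lt_le_trans ee.
  - move=> z hz; have [mz fz] := hf z hz; have [e e0 He] := phi_small mz fz.
    by exists e => // w hw cw t t0 te; exact: (He w hw cw t t0 te).
  exists e => // s s0 [z [t [d [[zd d0 tE cz] hA]]]].
  rewrite leNgt; apply/negP => se.
  have d1 : d <= 1 by have := nm_ge0 (z - z0); move: zd r01; clear; lra.
  have zK : cdisc z0 (2 * r0) z by rewrite /cdisc /=; move: zd d0; clear; lra.
  have t0 : 0 < t by rewrite tE mulr_gt0.
  have te : t < e by rewrite tE; apply: le_lt_trans se; rewrite ger_pMr.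
  by have := He z zK cz t t0 te; rewrite ltNge hA.
have [s [s0 sN Es noE]] : exists s, [/\ 0 < s, s <= N%:R^-1, E s & ~ E (s / 2)].
  apply: contrapT => no.
  have all n : exists2 s, 0 < s & s <= N%:R^-1 / 2 ^+ n /\ E s.
    elim: n => [|n [s s0 [sn Es]]].
      by exists N%:R^-1; rewrite ?invr_gt0 // expr0 divr1.
    exists (s / 2); first by rewrite divr_gt0.
    split; first by rewrite exprSr invfM mulrA ler_pM2r ?invr_gt0.
    apply: contrapT => nE; apply: no; exists s; split => //.
    apply: le_trans sn _; rewrite ler_pdivrMr ?exprn_gt0 // ler_peMr //.
    by apply: exprn_ege1; rewrite ler1n.
  have [n Hn] := exists_pow2_gt (N%:R^-1 / sig).
  have [s s0 [sn Es]] := all n.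
  have := le_trans (Hsig s s0 Es) sn; rewrite leNgt => /negP; apply.
  by rewrite ltr_pdivrMr ?exprn_gt0 // mulrC -ltr_pdivrMr.
have [z [t [d [[zd d0 tE cz] hA]]]] := Es.
have t0 : 0 < t by rewrite tE mulr_gt0.
exists z, (t, d) => /=.
  split => //; rewrite tE mulrAC -[leRHS]mul1r ler_pM2r //.
  by move: sN; rewrite -[N%:R^-1]mul1r ler_pdivlMr.
split => // w hw cw.
(* For [|w - z| <= d / 2] the scale [t' = (s / 2) d'] at [w] lies between [t / 4] and [t]. Replacing
   [t'] by [t / 4] on the left and by [t] on the right produces the factor [4^(k+1)]. *)
have [d' d'E] : exists d', d' = 2 * r0 - nm (w - z0) by eexists.
have d'0 : d / 2 <= d'.
  by rewrite d'E; have := nm_tri z w z0; move: hw zd; clear; lra.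
have d'1 : d' <= d * (3 / 2).
  by rewrite d'E; have := nm_tri w z z0; rewrite (nmBC z w); move: hw zd; clear; lra.
have d'00 : 0 < d' by apply: lt_le_trans d'0; rewrite divr_gt0.
have [t' t'E] : exists t', t' = s / 2 * d' by eexists.
have t't : t' <= t.
  rewrite t'E tE -mulrA ler_pM2l // ; move: d'1 d0; clear; lra.
have tt' : t / 4 <= t'.
  rewrite t'E tE -!mulrA ler_pM2l //; move: d'0; clear; lra.
have t40 : 0 < t / 4 by rewrite divr_gt0.
have t'0 : 0 < t' by exact: lt_le_trans tt'.
have lt1 : t' ^+ k.+1 * nm (dv (fp f) w) <= t' ^+ (2 * k) + nm (fp f w) ^+ 2.
  rewrite leNgt; apply/negP => /ltW h; apply: noE; exists w, t', d'; split => //.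
  by split => //; rewrite d'E addrC subrK.
have lt2 : (t / 4) ^+ k.+1 * nm (dv (fp f) w) <= t ^+ (2 * k) + nm (fp f w) ^+ 2.
  apply: (@le_trans _ _ (t' ^+ k.+1 * nm (dv (fp f) w))).
    by apply: ler_wpM2r; [exact: nm_ge0|apply: lerXn2r => //; rewrite nnegrE ltW].
  by apply: (le_trans lt1); rewrite lerD2r; apply: lerXn2r => //; rewrite nnegrE ltW.
have := ler_wpM2l (exprn_ge0 k.+1 (ler0n R 4)) lt2.
by rewrite mulrA -exprMn (mulrC 4) divfK.
Qed.

Lemma rescale_bound f z (t : R) k x B : 0 < t -> chart0 f (z + t%:C * x) ->
  t ^+ k.+1 * nm (dv (fp f) (z + t%:C * x)) <= B * (t ^+ (2 * k) + nm (fp f (z + t%:C * x)) ^+ 2) ->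
  nm (dv (fp (rescale (t%:C ^- k) z t%:C f)) x) <=
  B * (1 + nm (fp (rescale (t%:C ^- k) z t%:C f) x) ^+ 2).
Proof.
move=> t0 cf h; rewrite dv_rescale // fp_rescale !normcM normcV nmX nmC gtr0_norm //.
have t2 : 0 < t ^+ (2 * k) by rewrite exprn_gt0.
rewrite -(ler_pM2l t2); move: h; rewrite mulnC exprM exprS; have : 0 < t ^+ k by rewrite exprn_gt0.
move: (nm (dv (fp f) (z + t%:C * x))) (nm (fp f (z + t%:C * x))) (t ^+ k) => u v tk tk0 h.
rewrite (_ : tk ^+ 2 * _ = t * tk * u); last by field; rewrite gt_eqF.
by rewrite (_ : tk ^+ 2 * _ = B * (tk ^+ 2 + v ^+ 2)); last by field; rewrite gt_eqF.
Qed.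

Lemma rescale_bound_inv f z (t : R) k x : 0 < t -> chart0 f (z + t%:C * x) ->
  t ^+ (2 * k) + nm (fp f (z + t%:C * x)) ^+ 2 <= t ^+ k.+1 * nm (dv (fp f) (z + t%:C * x)) ->
  1 + nm (fp (rescale (t%:C ^- k) z t%:C f) x) ^+ 2 <=
  nm (dv (fp (rescale (t%:C ^- k) z t%:C f)) x).
Proof.
move=> t0 cf h; rewrite dv_rescale // fp_rescale !normcM normcV nmX nmC gtr0_norm //.
have t2 : 0 < t ^+ (2 * k) by rewrite exprn_gt0.
rewrite -(ler_pM2l t2); move: h; rewrite mulnC exprM [t ^+ k.+1]exprS; have : 0 < t ^+ k by rewrite exprn_gt0.
move: (nm (dv (fp f) (z + t%:C * x))) (nm (fp f (z + t%:C * x))) (t ^+ k) => u v tk tk0 h.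
rewrite (_ : tk ^+ 2 * (_ * (_ * _)) = t * tk * u); last by field; rewrite gt_eqF.
by rewrite (_ : tk ^+ 2 * _ = tk ^+ 2 + v ^+ 2); last by field; rewrite gt_eqF.
Qed.

End Rescaling.

Section ZalcmanSequence.
Context {R : realType}.
Local Notation C := R[i].
Local Notation S := (sphere R).
Local Notation fp := finite_part.
Implicit Types (f g : C -> S) (c z w a : C) (r e M : R).

(** Taken on the compact sphere; boundedness excludes the limit infinity. *)
Lemma bounded_subsequence (z : nat -> C) c M : (forall j, nm (z j - c) <= M) ->
  exists phi, increasing_seq phi /\ exists l, tends (fun j => z (phi j)) l.
Proof.
move=> zM; have [phi [inc H]] := diagonal_subsequence (fun _ j => Some (z j) : S).
exists phi; split => //; have [[l|] Hl] := H 0%N.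
  by exists l => e /Hl [J HJ]; exists J => j /HJ [w [->]].
exfalso; have M0 : 0 < nm c + M + 1.
  have := zM 0%N; have := nm_ge0 (z 0%N - c); have := nm_ge0 c; clear; lra.
have [|J /(_ J (leqnn J))] := Hl (nm c + M + 1)^-1; first by rewrite invr_gt0.
rewrite /snear /=; have [_ [w]|zn [w [<-]]] := eqVneq (z (phi J)) 0; first by [].
rewrite normcV ltf_pV2 ?posrE // ?nm_gt0 // => h.
by have := zM (phi J); have := nm_tri c (z (phi J)) 0; rewrite !subr0; move: h; clear; lra.
Qed.

Definition zalcman_seq k (D : C -> Prop) (F : set (C -> S)) (f : nat -> C -> S) (z : nat -> C)
    (t : nat -> R) zs g :=
  [/\ forall j, F (f j), D zs, tends z zs, forall j, 0 < t j & tends (fun j => (t j)%:C) 0] /\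
  let U j := rescale ((t j)%:C ^- k) (z j) (t j)%:C (f j) in
  (forall zeta, lconv U g zeta) /\
  forall j, chart0 (U j) 0 /\ 1 + nm (fp (U j) 0) ^+ 2 <= nm (dv (fp (U j)) 0).

(** Without a common bound near [z0], each [j] has a function violating the bound
    [((j + 1) / r0)^(k+1)], and [zalcman_point] applies to it with [N = j + 1]. The rescaled
    functions have spherical derivative at most [4^(k+1)] on discs of radius [(j + 1) / 2], so
    Marty's criterion applies in the whole plane. *)
Lemma zalcman k (D : C -> Prop) (F : set (C -> S)) z0 r1 : 0 < r1 ->
  (forall z, nm (z - z0) < r1 -> D z) ->
  (forall f z, F f -> D z -> mero f z /\ zmult k f z) ->
  (exists r M, [/\ 0 < r, 0 < M & forall f, F f -> sph_le M f z0 r]) \/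
  exists (f : nat -> C -> S) (z : nat -> C) t zs g, zalcman_seq k D F f z t zs g.
Proof.
move=> r10 r1D FD; have [H|noM] := pselect (exists r M, [/\ 0 < r, 0 < M & forall f, F f -> sph_le M f z0 r]).
  by left.
right; have [r0 [r00 r012 r03]] : exists r0, [/\ 0 < r0, r0 <= 1 / 2 & 3 * r0 <= r1].
  exists (Num.min (1 / 2) (r1 / 3)); split.
  - by rewrite lt_min !divr_gt0.
  - by rewrite ge_min lexx.
  - by rewrite mulrC -ler_pdivlMr // ge_min lexx orbT.
have inD z : nm (z - z0) <= 2 * r0 -> D z.
  by move=> hz; apply: r1D; move: hz r00 r03; clear; lra.
pose Q (j : nat) (x : (C -> S) * C * (R * R)) := F x.1.1 /\
  [/\ nm (x.1.2 - z0) + x.2.2 = 2 * r0, 0 < x.2.2, 0 < x.2.1, x.2.1 * j.+1%:R <= x.2.2 & chart0 x.1.1 x.1.2] /\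
  (x.2.1 ^+ (2 * k) + nm (fp x.1.1 x.1.2) ^+ 2 <= x.2.1 ^+ k.+1 * nm (dv (fp x.1.1) x.1.2) /\
    forall w, nm (w - x.1.2) <= x.2.2 / 2 -> chart0 x.1.1 w ->
      x.2.1 ^+ k.+1 * nm (dv (fp x.1.1) w) <= 4 ^+ k.+1 * (x.2.1 ^+ (2 * k) + nm (fp x.1.1 w) ^+ 2)).
have /boolp.choice [s Hs] : forall j, exists x, Q j x.
  move=> j; apply: contrapT => nQ; apply: noM.
  have M0 : 0 < (j.+1%:R / r0) ^+ k.+1 by rewrite exprn_gt0 // divr_gt0.
  exists r0, ((j.+1%:R / r0) ^+ k.+1); split => // f Ff w hw; split.
    by apply: (FD f w Ff _).1; apply: inD; move: hw r00; clear; lra.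
  move=> cw; rewrite leNgt; apply/negP => /ltW big; apply: nQ.
  have [|z [td h1 h2]] := zalcman_point r00 r012 (ltn0Sn j) _ hw cw big.
    by move=> z hz; apply: FD => //; exact: inD.
  by exists (f, z, td).
have zb j : nm ((s j).1.2 - z0) <= 2 * r0.
  by have [_ [[h1 h2 _ _ _] _]] := Hs j; move: h1 h2; clear; lra.
have [phi [incphi [zs zlim]]] := bounded_subsequence zb.
have Dzs : D zs by apply: inD; apply: (tends_le zlim) => j; exact: zb.
pose f j := (s (phi j)).1.1; pose z j := (s (phi j)).1.2; pose t j := (s (phi j)).2.1.
pose U j := rescale ((t j)%:C ^- k) (z j) (t j)%:C (f j).
have t0 j : 0 < t j by have [_ [[]]] := Hs (phi j).
have tn0 j : (t j)%:C != 0 by rewrite -nm_gt0 nmC normr_gt0 gt_eqF.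
have tk0 j : (t j)%:C ^- k != 0 by rewrite invr_eq0 expf_neq0.
have td j : t j * j.+1%:R <= (s (phi j)).2.2.
  have [_ [[_ _ _ h _] _]] := Hs (phi j); apply: le_trans h.
  by rewrite ler_pM2l // ler_nat ltnS increasing_ge.
have tj j : t j * j.+1%:R <= 1.
  apply: (le_trans (td j)); have [_ [[h _ _ _ _] _]] := Hs (phi j).
  by have := nm_ge0 ((s (phi j)).1.2 - z0); move: h r012; clear; lra.
have [|psi [incpsi [g Hg]]] := @marty R (fun=> True) U.
  move=> zeta _; exists 1, (4 ^+ k.+1), (Num.bound (2 * (nm zeta + 1))); split => //.
  move=> j Jj x hx.
  have bj : 2 * nm x <= j.+1%:R.
    have := archi_boundP (x := 2 * (nm zeta + 1)); rewrite mulr_ge0 ?addr_ge0 ?nm_ge0 // => /(_ isT) h.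
    have : (Num.bound (2 * (nm zeta + 1)))%:R <= j.+1%:R :> R by rewrite ler_nat ltnW.
    by have := nm_tri zeta x 0; rewrite !subr0; move: hx h; clear; lra.
  have tx : nm ((t j)%:C * x) <= (s (phi j)).2.2 / 2.
    rewrite normcM nmC gtr0_norm // ler_pdivlMr // -mulrA [nm x * 2]mulrC.
    by apply: le_trans (td j); rewrite ler_pM2l.
  have wz : nm (z j + (t j)%:C * x - z j) <= (s (phi j)).2.2 / 2 by rewrite addrC addKr.
  have wz0 : nm (z j + (t j)%:C * x - z0) <= 2 * r0.
    have [_ [[h1 h2 _ _ _] _]] := Hs (phi j).
    by have := nm_tri (z j) (z j + (t j)%:C * x) z0; move: wz h1 h2; rewrite /z; clear; lra.
  have [Ff [_ [_ hB]]] := Hs (phi j).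
  split; first by apply: mero_rescale => //; exact: (FD _ _ Ff (inD _ wz0)).1.
  move=> /(chart0_rescale_inv (tk0 j) (tn0 j)) cx; apply: rescale_bound => //.
  exact: hB.
exists (fun j => f (psi j)), (fun j => z (psi j)), (fun j => t (psi j)), zs, g.
split; [split => //|split].
- by move=> j; have [] := Hs (phi (psi j)).
- move=> e /zlim [J HJ]; exists J => j Jj; apply: HJ.
  exact: leq_trans (increasing_ge incpsi j).
- move=> e e0; exists (Num.bound e^-1) => j Jj; rewrite subr0 nmC gtr0_norm //.
  have e'0 : 0 < e^-1 by rewrite invr_gt0.
  have := archi_boundP (ltW e'0) => h.
  have h2 : e^-1 < (psi j).+1%:R.
    apply: (lt_le_trans h); rewrite ler_nat ltnW // ltnS.
    exact: leq_trans (increasing_ge incpsi j).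
  have := tj (psi j); rewrite -ler_pdivlMr // mul1r => /le_lt_trans; apply.
  by rewrite invf_plt ?posrE.
- by move=> zeta; exact: Hg.
- move=> j; have [_ [[_ _ _ _ cz] [h _]]] := Hs (phi (psi j)).
  have E : z (psi j) + (t (psi j))%:C * 0 = z (psi j) by rewrite mulr0 addr0.
  split; first by apply: chart0_rescale; rewrite ?E.
  by apply: rescale_bound_inv; rewrite ?E.
Qed.

End ZalcmanSequence.

(** * Analysis of the limit function *)

Section Limits.
Context {R : realType}.
Local Notation C := R[i].
Local Notation S := (sphere R).
Local Notation fp := finite_part.
Implicit Types (f g : C -> S) (c z w a : C) (r e M : R).

(** Connectedness of the plane, by real induction along the segment from [p] to [q]. *)
Lemma clopen_all (P : C -> Prop) p :
  (forall z, P z -> exists2 e : R, 0 < e & forall w, nm (w - z) < e -> P w) ->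
  (forall z, (forall e : R, 0 < e -> exists2 w, nm (w - z) < e & P w) -> P z) ->
  P p -> forall q, P q.
Proof.
move=> Po Pc Pp q.
have dist (s t : R) : nm (p + s%:C * (q - p) - (p + t%:C * (q - p))) = `|s - t| * nm (q - p).
  by rewrite opprD addrACA subrr add0r -mulrBl normcM -rmorphB nmC.
have n1 : 0 < nm (q - p) + 1 by have := nm_ge0 (q - p); clear; lra.
have small (s t e : R) : 0 < e -> `|s - t| < e / (nm (q - p) + 1) ->
    nm (p + s%:C * (q - p) - (p + t%:C * (q - p))) < e.
  move=> e0; rewrite dist ltr_pdivlMr //; apply: le_lt_trans.
  by apply: ler_wpM2l => //; rewrite lerDl.
have step : forall t : R, 0 <= t -> t <= 1 -> P (p + t%:C * (q - p)).
  apply: real_induction; first by rewrite mul0r addr0.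
  - move=> t _ _ /Po [e e0 He]; exists (e / (nm (q - p) + 1)); first by rewrite divr_gt0.
    move=> s ts st _; apply: He; apply: small => //; rewrite gtr0_norm ?subr_gt0 //.
    by rewrite ltrBlDl.
  - move=> t t0 _ H; apply: Pc => e e0.
    have d0 : 0 < Num.min t (e / (nm (q - p) + 1)) / 2.
      by rewrite divr_gt0 // lt_min t0 divr_gt0.
    have [d dE] : exists d, d = Num.min t (e / (nm (q - p) + 1)) / 2 by eexists.
    have [d1 d2] : 2 * d <= t /\ 2 * d <= e / (nm (q - p) + 1).
      by rewrite dE [2 * _]mulrC divfK // !ge_min !lexx orbT.
    rewrite -dE in d0.
    exists (p + (t - d)%:C * (q - p)).
      apply: small => //; rewrite addrAC subrr sub0r normrN gtr0_norm //.
      by move: d0 d2; move: (e / _) => x; clear; lra.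
    by apply: H; move: d0 d1; clear; lra.
by have := step 1 ler01 (lexx 1); rewrite mul1r addrC subrK.
Qed.

Lemma dvn_zero_form i (F h : C -> C) c r m : holomorphic c r h ->
  (forall w, nm (w - c) < r -> F w = (w - c) ^+ (m + i) * h w) ->
  exists2 h', holomorphic c r h' & forall w, nm (w - c) < r -> dvn i F w = (w - c) ^+ m * h' w.
Proof.
elim: i m => [|i IH] m hh FE; first by exists h => // w hw; rewrite /= FE // addn0.
have [|h' hh' E] := IH m.+1 hh; first by move=> w /FE ->; rewrite addSnnS.
exists (fun w => m.+1%:R * h' w + (w - c) * dv h' w).
  apply: hol_D; first by apply: hol_M => //; exact: hol_cst.
  apply: hol_M; last exact: hol_dv.
  by move=> w _; exists 1; apply: (cdiff_eq (cdiffB (cdiff_id w) (cdiff_cst c w))); rewrite subr0.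
move=> w hw; rewrite dvnS; apply: cdiff_dv.
have m0 : 0 < r - nm (w - c) by rewrite subr_gt0.
have hx x : nm (x - w) < r - nm (w - c) -> nm (x - c) < r.
  by have := nm_tri w x c; clear; lra.
have d1 := cdiffX m.+1 (cdiffB (cdiff_id w) (cdiff_cst c w)).
apply: (cdiff_eq (cdiff_near m0 _ (cdiffM d1 (hol_cdiff hh' hw)))).
  by move=> x /hx /E ->.
by rewrite /= exprS; ring.
Qed.

(** Each derivative raises the order of the pole by exactly one: at [c] the new numerator is
    [-(m + i)] times the old one. *)
Lemma dvn_pole_form i (F v : C -> C) c r m : 0 < r -> (0 < m)%N -> holomorphic c r v -> v c != 0 ->
  (forall w, nm (w - c) < r -> w != c -> F w = v w / (w - c) ^+ m) ->
  exists v', [/\ holomorphic c r v', v' c != 0 &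
    forall w, nm (w - c) < r -> w != c -> dvn i F w = v' w / (w - c) ^+ (m + i)].
Proof.
move=> r0 m0 hv vc FE; elim: i => [|i [u [hu uc E]]]; first by exists v; rewrite addn0.
exists (fun w => (w - c) * dv u w - (m + i)%:R * u w); split.
- apply: hol_B; last by apply: hol_M => //; exact: hol_cst.
  apply: hol_M; last exact: hol_dv.
  by move=> w _; exists 1; apply: (cdiff_eq (cdiffB (cdiff_id w) (cdiff_cst c w))); rewrite subr0.
- by rewrite subrr mul0r sub0r oppr_eq0 mulf_neq0 // pnatr_eq0 -lt0n addn_gt0 m0.
move=> w hw wc; rewrite dvnS; apply: cdiff_dv.
have wc0 : w - c != 0 by rewrite subr_eq0.
have mp : 0 < Num.min (r - nm (w - c)) (nm (w - c)) by rewrite lt_min subr_gt0 hw nm_gt0.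
have d1 := cdiffX (m + i) (cdiffB (cdiff_id w) (cdiff_cst c w)).
have d2 := @cdiffV _ (fun w => (w - c) ^+ (m + i)) _ _ (expf_neq0 (m + i) wc0) d1.
apply: (cdiff_eq (cdiff_near mp _ (cdiffM (hol_cdiff hu hw) d2))).
  move=> x; rewrite lt_min => /andP[x1 x2]; rewrite E //.
    by have := nm_tri w x c; move: x1; clear; lra.
  by apply: contraTneq x2 => ->; rewrite nmBC ltxx.
have [l] : exists l, (m + i)%N = l.+1 by exists (m + i).-1; rewrite prednK // addn_gt0 m0.
rewrite addnS => lE; rewrite lE /= subr0 mulr1 !exprS; have := expf_neq0 l wc0.
move: (w - c) ((w - c) ^+ l) (l.+1%:R) wc0 => x y q x0 y0; field.
by rewrite x0 y0.
Qed.
Lemma ucvg_inv u (f : C -> C) c r : 0 < r -> holomorphic c r f -> ucvg c r u f -> f c != 0 ->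
  exists2 s, 0 < s /\ s <= r & [/\ forall w, nm (w - c) < s -> f w != 0,
    exists J, forall j, (J <= j)%N -> forall w, nm (w - c) < s -> u j w != 0 &
    ucvg c s (fun j w => (u j w)^-1) (fun w => (f w)^-1)].
Proof.
move=> r0 hf uf fc.
have [m m0 mE] : exists2 m, 0 < m & m = nm (f c) / 2.
  by eexists; last reflexivity; rewrite divr_gt0 // nm_gt0.
have cc : nm (c - c) < r by rewrite subrr nm0.
have [del del0 Hd] := hol_ccont hf cc m0.
exists (Num.min del r); first by rewrite lt_min del0 r0 ge_min lexx orbT.
have fm w : nm (w - c) < Num.min del r -> m <= nm (f w).
  rewrite lt_min => /andP[/Hd h _]; rewrite mE; apply: (nm_half_le _).1.
  by rewrite -mE.
have um j w : nm (w - c) < Num.min del r -> nm (u j w - f w) < m / 2 -> m / 2 <= nm (u j w).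
  move=> /fm h1 h2; have := nm_triB (f w) (u j w); rewrite nmBC; move: h1 h2; clear; lra.
have m20 : 0 < m / 2 by rewrite divr_gt0.
split.
- by move=> w /fm h; rewrite -nm_gt0; exact: lt_le_trans h.
- have [J HJ] := uf _ m20; exists J => j Jj w hw; rewrite -nm_gt0.
  apply: lt_le_trans m20 (um j w hw (HJ j Jj w _)).
  by move: hw; rewrite lt_min => /andP[].
move=> e e0; have e'0 : 0 < Num.min (m / 2) (e * (m / 2 * m)).
  by rewrite lt_min m20 !mulr_gt0.
have [J HJ] := uf _ e'0; exists J => j Jj w hw.
have : nm (w - c) < r by move: hw; rewrite lt_min => /andP[].
move/(HJ j Jj w); rewrite lt_min => /andP[h1 h2].
have a1 := um j w hw h1; have a2 := fm w hw.
have p1 : 0 < nm (u j w) by exact: lt_le_trans a1.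
have p2 : 0 < nm (f w) by exact: lt_le_trans a2.
have -> : (u j w)^-1 - (f w)^-1 = (f w - u j w) * ((u j w) * (f w))^-1.
  by field; rewrite -!nm_gt0 p1 p2.
rewrite normcM normcV normcM ltr_pdivrMr ?mulr_gt0 // nmBC.
apply: (lt_le_trans h2); rewrite ler_pM2l //.
by apply: ler_pM => //; rewrite ltW.
Qed.

(** The limit of the inverses is nonzero at [z], so their convergence can be inverted back on a
    smaller disc. *)
Lemma lconv_finite u g z : lconv u g z -> g z <> None -> lconv0 u g z.
Proof.
case=> // -[r r0 [[J HJ] hg uc]] gz.
have zz : nm (z - z) < r by rewrite subrr nm0.
have g0 : fp (fun w => sinv (g w)) z != 0.
  have := hg.1 z zz; rewrite /fp /finite_part; case: (g z) gz => [a _|] //=.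
  by case: eqP => //= /eqP a0 _; rewrite invr_eq0.
have [s [s0 sr] [gs [J' us] cv]] := ucvg_inv r0 hg.2 uc g0.
have inr w : nm (w - z) < s -> nm (w - z) < r by move=> h; exact: lt_le_trans sr.
have fin f : finb (fun w => sinv (f w)) z r ->
    (forall w, nm (w - z) < s -> fp (fun w => sinv (f w)) w != 0) ->
    finb f z s /\ forall w, nm (w - z) < s -> fp f w = (fp (fun w => sinv (f w)) w)^-1.
  move=> hf fs.
  have E : (fun w => sinv (sinv (f w))) = f by apply/funext => w; rewrite sinvK.
  split.
    rewrite -{1}E; apply: finb_inv => //; apply: (finb_sub hf).
    by rewrite subrr nm0 add0r.
  move=> w hw; rewrite -{1}E; apply: fp_sinv; last exact: fs.
  exact: hf.1 (inr w hw).
have [fg eg] := fin _ hg gs.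
exists s => //; split => //.
  exists (maxn J J') => j; rewrite geq_max => /andP[j1 j2].
  exact: (fin _ (HJ j j1) (us j j2)).1.
move=> e /cv [J2 H2]; exists (maxn J2 (maxn J J')) => j; rewrite !geq_max => /and3P[j0 j1 j2] w hw.
have [_ ej] := fin _ (HJ j j1) (us j j2).
by rewrite eg // ej //; exact: H2.
Qed.

Definition none_near g z := exists2 e : R, 0 < e & forall w, nm (w - z) < e -> g w = None.

Lemma fp_none g w : sinv (g w) = Some 0 <-> g w = None.
Proof.
split=> [E|-> //]; have := congr1 (@sinv R) E; rewrite sinvK => ->.
by rewrite /= eqxx.
Qed.

Lemma near_other z w e : 0 < e -> exists2 x, x != z & nm (x - w) < e.
Proof.
move=> e0; have [->|wz] := eqVneq w z; last by exists w; rewrite // subrr nm0.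
exists (z + (e / 2)%:C).
  by rewrite -subr_eq0 addrC addKr -nm_gt0 nmC normr_gt0 gt_eqF // divr_gt0.
by rewrite addrC addKr nmC gtr0_norm ?divr_gt0 //; move: e0; clear; lra.
Qed.

Lemma none_near_closed u g z : lconv u g z ->
  (forall e : R, 0 < e -> exists2 w, nm (w - z) < e & none_near g w) -> none_near g z.
Proof.
have self w e : 0 < e -> nm (w - w) < e by rewrite subrr nm0.
case=> -[r r0 [_ hg _]] H.
  have [w wr [e e0 He]] := H r r0.
  by case: (hg.1 w wr); exact: (He w (self w e e0)).
have [Z|[s [s0 sr] Hs]] := isolated_zeros r0 hg.2.
  exists r => // w hw; apply/fp_none.
  by have := fpE (hg.1 w hw); rewrite (Z w hw).
have [w ws [e e0 He]] := H s s0.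
have m0 : 0 < Num.min e (s - nm (w - z)) by rewrite lt_min e0 subr_gt0.
have [x xz] := near_other z w m0; rewrite lt_min => /andP[xe xs].
have xs' : nm (x - z) < s by have := nm_tri w x z; move: xs; clear; lra.
have := Hs x xs' xz; rewrite /fp /finite_part (He x xe) /= eqxx //.
Qed.

(** Were [g] infinite near a point, it would be infinite everywhere, and the derivatives of
    [1 / u j] at 0 would tend to 0. But their moduli are [|u'| / |u|^2], at least
    [(1 + |u|^2) / |u|^2 >= 1]. *)
Lemma limit_not_none (u : nat -> C -> S) g : (forall z, lconv u g z) ->
  (forall j, chart0 (u j) 0 /\ 1 + nm (fp (u j) 0) ^+ 2 <= nm (dv (fp (u j)) 0)) ->
  forall z, ~ none_near g z.
Proof.
move=> cv u0 z nz.
have [e e0 He] : none_near g 0.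
  apply: (clopen_all _ _ nz); last by move=> x; exact: none_near_closed.
  move=> x [e e0 He]; exists (e / 2); first by rewrite divr_gt0.
  move=> w hw; exists (e / 2); first by rewrite divr_gt0.
  by move=> y hy; apply: He; have := nm_tri w y x; move: hw hy; clear; lra.
have self r : 0 < r -> nm (0 - 0) < r by rewrite subrr nm0.
case: (cv 0) => -[r r0 [[J HJ] hg uc]].
  by case: (hg.1 0 (self r r0)); exact: (He 0 (self e e0)).
have dg : dv (fp (fun w => sinv (g w))) 0 = 0.
  apply: cdiff_dv; apply: (cdiff_near e0 _ (cdiff_cst 0 0)) => w hw.
  by rewrite /fp /finite_part He //= eqxx.
have r20 : 0 < r / 2 by rewrite divr_gt0.
have [||J2 H2] := ucvg_dv (r := r / 2) _ hg.2 uc _ ltr01.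
- by exists J => j /HJ [].
- by move: r0; clear; lra.
pose j := maxn J J2.
have := H2 j (leq_maxr _ _) 0 (self _ r20); rewrite dg subr0.
have [cj bj] := u0 j; have vj := (HJ j (leq_maxl _ _)).1 0 (self r r0).
have uj : fp (u j) 0 != 0.
  apply: contra_not_neq vj => E; rewrite (fpE (chart0_finite cj)) E /=.
  by rewrite eqxx.
rewrite dv_sinv // normcM normcV nmX normcN; apply/negP; rewrite -leNgt.
rewrite ler_pdivlMr ?exprn_gt0 ?nm_gt0 // mul1r; apply: le_trans bj.
by rewrite lerDr.
Qed.

End Limits.

(** * Picard's theorem applied to the derivative of the limit *)

Section OmittedDerivative.
Context {R : realType}.
Local Notation C := R[i].
Local Notation S := (sphere R).
Local Notation fp := finite_part.
Implicit Types (f g : C -> S) (c z w a : C) (r e M : R).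

Lemma near_neq0 (F : C -> C) z r : 0 < r -> holomorphic z r F -> F z != 0 ->
  exists2 s, 0 < s /\ s <= r & forall w, nm (w - z) < s -> F w != 0.
Proof.
move=> r0 hF Fz; have zz : nm (z - z) < r by rewrite subrr nm0.
have F0 : 0 < nm (F z) by rewrite nm_gt0.
have [d d0 Hd] := hol_ccont hF zz F0.
exists (Num.min d r); first by rewrite lt_min d0 r0 ge_min lexx orbT.
move=> w; rewrite lt_min => /andP[/Hd h1 _]; apply: contraTneq h1 => ->.
by rewrite sub0r normcN ltxx.
Qed.

Definition polar g z := g z = None /\ exists r m (v : C -> C), [/\ 0 < r, (0 < m)%N,
  holomorphic z r v, v z != 0 &
  forall w, nm (w - z) < r -> w != z -> chart0 g w /\ fp g w = v w / (w - z) ^+ m].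

Definition polefn g := forall z, chart0 g z \/ polar g z.

Lemma lconv_pole (u : nat -> C -> S) g z : lconv u g z -> ~ none_near g z ->
  chart0 g z \/ polar g z.
Proof.
move=> cv nn; have self r : 0 < r -> nm (z - z) < r by rewrite subrr nm0.
have [gz|gz] := pselect (g z <> None).
  by left; have [r r0 [_ hg _]] := lconv_finite cv gz; exact: (finb_chart0 hg (self r r0)).
have {}gz : g z = None by case: (g z) gz => // a h; case: h.
right; split => //; case: cv => -[r r0 [_ hg _]].
  by case: (hg.1 z (self r r0)).
case: (zero_order r0 hg.2) => [Z|[m [h [hh hz hE]]]].
  case: nn; exists r => // w hw; apply/fp_none.
  by have := fpE (hg.1 w hw); rewrite (Z w hw).
have m0 : (0 < m)%N.
  rewrite lt0n; apply/eqP => m0; move: (hE z); rewrite m0 expr0 mul1r => E.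
  by move: hz; rewrite -E /fp /finite_part gz /= eqxx // eqxx.
have [s [s0 sr] hs] := near_neq0 r0 hh hz.
exists s, m, (fun w => (h w)^-1); split => //.
- by apply: hol_V => //; apply: (hol_sub hh); rewrite subrr nm0 add0r.
- by rewrite invr_eq0.
move=> w hw wz; have hw' : nm (w - z) < r by exact: lt_le_trans sr.
have nz : fp (fun w => sinv (g w)) w != 0.
  by rewrite hE mulf_neq0 ?hs // expf_neq0 // subr_eq0.
have E : (fun w => sinv (sinv (g w))) = g by apply/funext => x; rewrite sinvK.
split; first by rewrite -E; apply: chart0_inv => //; exact: (finb_chart0 hg hw').
by rewrite -{1}E fp_sinv // ?hE ?invfM 1?mulrC //; exact: hg.1.
Qed.

Lemma lconv_polefn (u : nat -> C -> S) g : (forall z, lconv u g z) ->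
  (forall z, ~ none_near g z) -> polefn g.
Proof. by move=> cv nn z; exact: lconv_pole (cv z) (nn z). Qed.

Lemma polar_dvn k g z : polar g z -> exists r m (v : C -> C), [/\ 0 < r, (0 < m)%N,
  holomorphic z r v, v z != 0 &
  forall w, nm (w - z) < r -> w != z -> chart0 g w /\ dvn k (fp g) w = v w / (w - z) ^+ m].
Proof.
move=> [_ [r [m [v [r0 m0 hv vz H]]]]].
have [|v' [hv' vz' H']] := dvn_pole_form (F := fp g) k r0 m0 hv vz.
  by move=> w hw wz; exact: (H w hw wz).2.
exists r, (m + k)%N, v'; split => //; first by rewrite addn_gt0 m0.
by move=> w hw wz; split; [exact: (H w hw wz).1|exact: H'].
Qed.

Lemma hol_subX c r m : holomorphic c r (fun w => (w - c) ^+ m).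
Proof.
apply: hol_X => w _; exists 1.
by apply: (cdiff_eq (cdiffB (cdiff_id w) (cdiff_cst c w))); rewrite subr0.
Qed.

Definition const_near k g c z := exists2 e : R, 0 < e &
  forall w, nm (w - z) < e -> chart0 g w /\ dvn k (fp g) w = c.

(** The identity theorem for the [k]-th derivative, carried across poles: near a pole it is
    [v / (w - z)^m] with [v z != 0], and cannot equal [c] at points close to [z]. *)
Lemma const_spread k g c z0 : polefn g -> const_near k g c z0 -> forall z, const_near k g c z.
Proof.
move=> pg c0; apply: clopen_all c0.
  move=> x [e e0 He]; exists (e / 2); first by rewrite divr_gt0.
  move=> w hw; exists (e / 2); first by rewrite divr_gt0.
  by move=> y hy; apply: He; have := nm_tri w y x; move: hw hy; clear; lra.
have pt z s : 0 < s -> (forall e : R, 0 < e -> exists2 w, nm (w - z) < e & const_near k g c w) ->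
    exists x, [/\ nm (x - z) < s, x != z & dvn k (fp g) x = c].
  move=> s0 /(_ s s0) [w ws [e e0 He]].
  have m0 : 0 < Num.min e (s - nm (w - z)) by rewrite lt_min e0 subr_gt0.
  have [x xz] := near_other z w m0; rewrite lt_min => /andP[xe xs].
  exists x; split => //; last exact: (He x xe).2.
  by have := nm_tri w x z; move: xs; clear; lra.
move=> z H; case: (pg z) => [[r r0 hg]|/(polar_dvn k) [r [m [v [r0 m0 hv vz E]]]]].
  have hG : holomorphic z r (fun w => dvn k (fp g) w - c).
    by apply: hol_B; [exact: hol_dvn hg.2|exact: hol_cst].
  have [Z|[s [s0 sr] Hs]] := isolated_zeros r0 hG.
    exists r => // w hw; split; first exact: (finb_chart0 hg hw).
    by apply/eqP; rewrite -subr_eq0 Z.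
  have [x [xs xz xc]] := pt z s s0 H.
  by have := Hs x xs xz; rewrite xc subrr eqxx.
have hV : holomorphic z r (fun w => v w - c * (w - z) ^+ m).
  by apply: hol_B => //; apply: hol_M; [exact: hol_cst|exact: hol_subX].
have [|s [s0 sr] Hs] := near_neq0 r0 hV.
  by rewrite subrr expr0n gtn_eqF // mulr0 subr0.
have [x [xs xz xc]] := pt z s s0 H.
have := Hs x xs; rewrite -xc (E x _ xz).2; last exact: lt_le_trans sr.
by rewrite divfK ?subrr ?eqxx // expf_neq0 // subr_eq0.
Qed.

Definition inv_shift k g c : C -> C := fun w => if g w is Some _ then (dvn k (fp g) w - c)^-1 else 0.

Lemma inv_shift_entire k g c : polefn g -> (forall w, g w <> None -> dvn k (fp g) w <> c) ->
  entire (inv_shift k g c).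
Proof.
move=> pg nc z; have zz r : 0 < r -> nm (z - z) < r by rewrite subrr nm0.
case: (pg z) => [[r r0 hg]|pz].
  have gz : dvn k (fp g) z - c != 0 by rewrite subr_eq0; apply/eqP/nc/(hg.1 z (zz r r0)).
  have h := cdiffB (hol_cdiff (hol_dvn k hg.2) (zz r r0)) (cdiff_cst c z).
  have {}h := @cdiffV _ (fun w => dvn k (fp g) w - c) _ _ gz h.
  eexists; apply: (cdiff_near r0 _ h) => w hw.
  by rewrite /inv_shift; case: (g w) (hg.1 w hw).
have [r [m [v [r0 m0 hv vz E]]]] := polar_dvn k pz.
have hV : holomorphic z r (fun w => v w - c * (w - z) ^+ m).
  by apply: hol_B => //; apply: hol_M; [exact: hol_cst|exact: hol_subX].
have [|s [s0 sr] Hs] := near_neq0 r0 hV.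
  by rewrite subrr expr0n gtn_eqF // mulr0 subr0.
(* Near the pole [1 / (v / (w - z)^m - c)] is this product, which vanishes at [z] in agreement with
   the default value of [inv_shift]. *)
have hH : holomorphic z s (fun w => (w - z) ^+ m * (v w - c * (w - z) ^+ m)^-1).
  apply: hol_M; first exact: hol_subX.
  by apply: hol_V => //; apply: (hol_sub hV); rewrite subrr nm0 add0r.
have [d hd] := hH z (zz s s0); exists d; apply: (cdiff_near s0 _ hd) => w hw.
have [->|wz] := eqVneq w z.
  by rewrite /inv_shift pz.1 subrr expr0n gtn_eqF // mul0r.
have [cw Ew] := E w (lt_le_trans hw sr) wz.
rewrite /inv_shift; case: (g w) (chart0_finite cw) => // _ _; rewrite Ew.
have wz0 : (w - z) ^+ m != 0 by rewrite expf_neq0 // subr_eq0.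
by have := Hs w hw; move: ((w - z) ^+ m) (v w) wz0 => x y x0 y0; field; rewrite x0 mulNr y0.
Qed.

Lemma omit_const k g (c c' c'' : C) : polefn g -> c != c' -> c != c'' -> c' != c'' ->
  (forall w, g w <> None -> dvn k (fp g) w <> c) ->
  (forall w, g w <> None -> dvn k (fp g) w <> c') ->
  (forall z w, g z <> None -> g w <> None -> dvn k (fp g) z = c'' -> dvn k (fp g) w = c'' -> z = w) ->
  exists b, forall z, chart0 g z /\ dvn k (fp g) z = b.
Proof.
move=> pg cc' cc'' c'c'' nc nc' uc.
have HE w : g w <> None -> inv_shift k g c w = (dvn k (fp g) w - c)^-1.
  by rewrite /inv_shift; case: (g w).
have val (q : C) w : c != q -> inv_shift k g c w = (q - c)^-1 -> g w <> None /\ dvn k (fp g) w = q.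
  move=> cq; have [gw|gw] := pselect (g w <> None).
    by rewrite HE // => /invr_inj /addIr ->.
  rewrite /inv_shift; case: (g w) gw => [a [] //|_ /esym/eqP].
  by rewrite invr_eq0 subr_eq0 eq_sym (negbTE cq).
have cst : forall z w, inv_shift k g c z = inv_shift k g c w.
  apply: (@picard_variant R _ (c' - c)^-1 (c'' - c)^-1).
  - exact: inv_shift_entire.
  - by apply: contra_neq c'c'' => /invr_inj /addIr.
  - by move=> z; apply/eqP => /(val c' z cc') [h1 h2]; exact: nc' h2.
  - by move=> z w /(val c'' z cc'') [h1 h2] /(val c'' w cc'') [h3 h4]; exact: uc.
have [z1 c1] : exists z1, chart0 g z1.
  case: (pg 0) => [h|[_ [r [m [v [r0 _ _ _ H]]]]]]; first by exists 0.
  have [x x0 xr] := near_other 0 0 r0.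
  by exists x; exact: (H x xr x0).1.
have n1 : dvn k (fp g) z1 - c != 0.
  by rewrite subr_eq0; apply/eqP; apply: nc; exact: chart0_finite.
(* A pole would be a zero of the constant function [inv_shift k g c], which is not 0 at [z1]. *)
have fin z : g z <> None.
  move=> gz; have := cst z1 z; rewrite HE; last exact: chart0_finite.
  by rewrite {1}/inv_shift gz; apply/eqP; rewrite invr_eq0.
exists (dvn k (fp g) z1) => z; split.
  by case: (pg z) => // -[gz]; case: (fin z gz).
by have := cst z z1; rewrite !HE // => /invr_inj /addIr.
Qed.

Lemma three_roots n (b : C) : (2 < n)%N -> b != 0 -> exists c0 c1 c2 : C,
  [/\ c0 ^+ n = b, c1 ^+ n = b & c2 ^+ n = b] /\ [/\ c0 != c1, c0 != c2 & c1 != c2].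
Proof.
move=> n2 b0; have n0 : (0 < n)%N by exact: ltn_trans n2.
have [w0 w0b] := cexp_surj b0.
pose c := cexp (w0 / n%:R); have cn : c ^+ n = b.
  by rewrite /c -cexpMn -[(_ / _) *+ n]mulr_natr divfK // pnatr_eq0 -lt0n.
have c0 : c != 0 by exact: cexp_neq0.
have u0 : unity n != 0 :> C by exact: cexp_neq0.
have u1 : unity n != 1 :> C by rewrite -[unity n]expr1; apply: unity_prim; rewrite (ltn_trans _ n2).
have u2 : unity n ^+ 2 != 1 :> C by apply: unity_prim.
have un : unity n ^+ n = 1 :> C by exact: unity_root.
exists c, (c * unity n), (c * unity n ^+ 2); split; split.
- exact: cn.
- by rewrite exprMn un cn mulr1.
- by rewrite exprMn exprAC un expr1n cn mulr1.
- by rewrite -{1}[c]mulr1 (inj_eq (mulfI c0)) eq_sym.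
- by rewrite -{1}[c]mulr1 (inj_eq (mulfI c0)) eq_sym.
- by rewrite (inj_eq (mulfI c0)) expr2 -{1}[unity n]mulr1 (inj_eq (mulfI u0)) eq_sym.
Qed.

Lemma power_once_const n k g (b : C) : (2 < n)%N -> b != 0 -> polefn g ->
  (forall z w, g z <> None -> g w <> None -> dvn k (fp g) z ^+ n = b ->
     dvn k (fp g) w ^+ n = b -> z = w) ->
  exists c, forall z, chart0 g z /\ dvn k (fp g) z = c.
Proof.
move=> n2 b0 pg H; have [c0 [c1 [c2 [[e0 e1 e2] [d01 d02 d12]]]]] := three_roots n2 b0.
have once c : c ^+ n = b -> forall z w, g z <> None -> g w <> None ->
    dvn k (fp g) z = c -> dvn k (fp g) w = c -> z = w.
  by move=> cn z w gz gw hz hw; apply: H => //; rewrite ?hz ?hw.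
(* All [n]-th roots of [b] together are taken at one point at most, so a root that is attained
   excludes every other root. *)
have excl c c' : c ^+ n = b -> c' ^+ n = b -> c != c' ->
    (exists2 z, g z <> None & dvn k (fp g) z = c) -> forall w, g w <> None -> dvn k (fp g) w <> c'.
  move=> cn c'n cc' [z gz hz] w gw hw; move: cc'; rewrite -hz -hw.
  by rewrite (H z w) ?hz ?hw ?eqxx.
have none c : ~ (exists2 z, g z <> None & dvn k (fp g) z = c) ->
    forall w, g w <> None -> dvn k (fp g) w <> c.
  by move=> h w gw hw; apply: h; exists w.
have [A0|/none A0] := pselect (exists2 z, g z <> None & dvn k (fp g) z = c0).
  apply: (@omit_const k g c1 c2 c0); rewrite // 1?eq_sym //.
  - exact: excl A0.
  - exact: excl A0.
  - exact: once.
have [A1|/none A1] := pselect (exists2 z, g z <> None & dvn k (fp g) z = c1).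
  apply: (@omit_const k g c0 c2 c1); rewrite // 1?eq_sym //.
  - exact: excl A1.
  - exact: once.
by apply: (@omit_const k g c0 c1 c2) => //; exact: once.
Qed.

End OmittedDerivative.

Section UniformConvergence.
Context {R : realType}.
Local Notation C := R[i].
Local Notation S := (sphere R).
Local Notation fp := finite_part.
Implicit Types (f g : C -> S) (c z w a : C) (r e M : R).

Lemma ucvg_D c r u v (F G : C -> C) : ucvg c r u F -> ucvg c r v G ->
  ucvg c r (fun j w => u j w + v j w) (fun w => F w + G w).
Proof.
move=> uF vG e e0; have e20 : 0 < e / 2 by rewrite divr_gt0.
have [J1 H1] := uF _ e20; have [J2 H2] := vG _ e20.
exists (maxn J1 J2) => j; rewrite geq_max => /andP[j1 j2] w hw.
have := H1 j j1 w hw; have := H2 j j2 w hw; rewrite opprD addrACA.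
have := le_normcD (u j w - F w) (v j w - G w); clear; lra.
Qed.

Lemma ucvg_M c r u v (F G : C -> C) M : ucvg c r u F -> ucvg c r v G ->
  (forall w, nm (w - c) < r -> nm (F w) <= M /\ nm (G w) <= M) ->
  ucvg c r (fun j w => u j w * v j w) (fun w => F w * G w).
Proof.
move=> uF vG B e e0.
have [N [N1 NM]] : exists N, 1 <= N /\ M <= N.
  by exists (Num.max 1 M); rewrite !le_max !lexx orbT.
have N0 : 0 < N by exact: lt_le_trans N1.
(* Three products will be bounded, each by [e / 3]. *)
have d0 : 0 < Num.min 1 (e / (3 * N)) by rewrite lt_min ltr01 divr_gt0 // mulr_gt0.
have [J1 H1] := uF _ d0; have [J2 H2] := vG _ d0.
exists (maxn J1 J2) => j; rewrite geq_max => /andP[j1 j2] w hw.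
have := H1 j j1 w hw; have := H2 j j2 w hw; rewrite !lt_min => /andP[g1 g2] /andP[f1 f2].
have [bF bG] := B w hw.
have -> : u j w * v j w - F w * G w = (u j w - F w) * (v j w - G w) +
    (F w * (v j w - G w) + (u j w - F w) * G w) by ring.
apply: (le_lt_trans (le_normcD _ _)); rewrite normcM.
have := le_normcD (F w * (v j w - G w)) ((u j w - F w) * G w); rewrite !normcM.
have := nm_ge0 (u j w - F w); have := nm_ge0 (v j w - G w).
have := nm_ge0 (F w); have := nm_ge0 (G w).
move: g1 g2 f1 f2 bF bG; move: (nm (u j w - F w)) (nm (v j w - G w)) (nm (F w)) (nm (G w)).
move: (nm (F w * _ + _)) => s p q x y q1; rewrite ltr_pdivlMr ?mulr_gt0 // => q2 p1.
rewrite ltr_pdivlMr ?mulr_gt0 // => p2 x1 y1 y0 x0 q0 p0 h.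
have h1 : p * q <= p * N by apply: ler_wpM2l => //; apply: le_trans N1; exact: ltW.
have h2 : x * q <= N * q by apply: ler_wpM2r => //; exact: le_trans NM.
have h3 : p * y <= p * N by apply: ler_wpM2l => //; exact: le_trans NM.
move: h h1 h2 h3 q2 p2; clear; lra.
Qed.

Lemma ucvg_X c r u (F : C -> C) M n : ucvg c r u F ->
  (forall w, nm (w - c) < r -> nm (F w) <= M) ->
  ucvg c r (fun j w => u j w ^+ n) (fun w => F w ^+ n).
Proof.
move=> uF B; elim: n => [|n IH] /=.
  by move=> e e0; exists 0%N => j _ w _; rewrite !expr0 subrr nm0.
have [N [N1 NM NX]] : exists N, [/\ 1 <= N, M <= N & M ^+ n <= N].
  exists (Num.max 1 (Num.max M (M ^+ n))).
  by split; rewrite !le_max !lexx ?orbT.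
have K := ucvg_M (M := N) uF IH.
have {K}-> : (fun j w => u j w ^+ n.+1) = (fun j w => u j w * u j w ^+ n).
  by apply/funext => j; apply/funext => w; rewrite exprS.
rewrite (_ : (fun w => F w ^+ n.+1) = (fun w => F w * F w ^+ n)); last first.
  by apply/funext => w; rewrite exprS.
apply: (ucvg_M (M := N)) => // w hw; have b := B w hw; split; first exact: le_trans NM.
rewrite nmX; apply: le_trans NX; apply: lerXn2r => //; rewrite nnegrE ?nm_ge0 //.
exact: le_trans (nm_ge0 _) b.
Qed.

Lemma hol_bounded (F : C -> C) c r s : r < s -> holomorphic c s F ->
  exists M, forall w, nm (w - c) < r -> nm (F w) <= M.
Proof.
move=> rs hF; have [|M _ HM] := @ccont_bounded R F c r.
  by move=> z hz; apply: (hol_ccont hF); exact: le_lt_trans rs.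
by exists M => w /ltW; exact: HM.
Qed.

Lemma ucvg_dvn k (u : nat -> C -> C) F c s r : (exists J, forall j, (J <= j)%N -> holomorphic c s (u j)) ->
  holomorphic c s F -> ucvg c s u F -> r < s -> ucvg c r (fun j => dvn k (u j)) (dvn k F).
Proof.
move=> [J HJ] hF uF; elim: k r => [|k IH] r rs /=.
  move=> e /uF [J' HJ']; exists J' => j Jj w hw; apply: HJ' => //; exact: lt_trans rs.
have m1 : r < (r + s) / 2 by move: rs; clear; lra.
have m2 : (r + s) / 2 < s by move: rs; clear; lra.
apply: (ucvg_dv _ _ (IH _ m2) m1).
  exists J => j /HJ /(hol_dvn k) h; apply: (hol_sub h).
  by rewrite subrr nm0 add0r ltW.
by apply: (hol_sub (hol_dvn k hF)); rewrite subrr nm0 add0r ltW.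
Qed.

Lemma dvn_rescale i c z t f x : c != 0 -> t != 0 -> chart0 (rescale c z t f) x ->
  dvn i (fp (rescale c z t f)) x = c * t ^+ i * dvn i (fp f) (z + t * x).
Proof.
move=> c0 t0 [r r0 hx].
have -> : fp (rescale c z t f) = fun x => c * fp f (z + t * x).
  by apply/funext => y; rewrite fp_rescale.
apply: (@dvn_affine R i (fp f) c z t x r); last by rewrite subrr nm0.
move=> y hy; have [s s0 hs] := chart0_rescale_inv c0 t0 (finb_chart0 hx hy).
by exists s => //; exact: hs.2.
Qed.

End UniformConvergence.

(** * The derivative of the limit is constant *)

Section ConstantDerivative.
Context {R : realType}.
Local Notation C := R[i].
Local Notation S := (sphere R).
Local Notation fp := finite_part.
Implicit Types (f g : C -> S) (c z zs zeta w a : C) (r e M : R).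

Lemma power_const n (F : C -> C) c r (b : C) : (0 < n)%N -> b != 0 -> holomorphic c r F ->
  (forall w, nm (w - c) < r -> F w ^+ n = b) -> forall w, nm (w - c) < r -> F w = F c.
Proof.
move=> n0 b0 hF Fb.
have dF w : nm (w - c) < r -> cdiff F w 0.
  move=> hw; have h := hol_cdiff hF hw; apply: (cdiff_eq h).
  have m0 : 0 < r - nm (w - c) by rewrite subr_gt0.
  have hx x : nm (x - w) < r - nm (w - c) -> nm (x - c) < r.
    by have := nm_tri w x c; clear; lra.
  have h1 : cdiff (fun x => F x ^+ n) w 0.
    by apply: (cdiff_near m0 _ (cdiff_cst b w)) => x /hx /Fb.
  have Fw : F w != 0 by apply: contraNneq b0 => E; rewrite -(Fb w hw) E expr0n gtn_eqF.
  have /esym/eqP := cdiff_unique h1 (cdiffX n h); rewrite !mulf_eq0 pnatr_eq0 gtn_eqF //=.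
  by rewrite (negbTE (expf_neq0 _ Fw)) /= => /eqP.
move=> w hw; apply: cdiff0_const => t t0 t1; apply: dF.
rewrite addrC addKr normcM nmC ger0_norm //; apply: le_lt_trans hw.
by rewrite ler_piMl // nm_ge0.
Qed.

Lemma diff_poly_zero (a : C -> C) b n k f y : chart0 f y ->
  fp f y + a y * dvn k (fp f) y ^+ n - b = 0 -> is_zero (diff_poly a b n k f) y.
Proof.
move=> /chart0_finite /fpE fy; rewrite /is_zero /diff_poly /mderiv fy dvnE /=.
by move=> <-.
Qed.

Lemma zalcman_zero (D : C -> Prop) F n k (a : C -> C) (b : C) (f : nat -> C -> S) (z : nat -> C) t zs g zeta rho :
  (forall z, D z -> exists2 r : R, 0 < r & forall w, nm (w - z) < r -> D w) ->
  (forall z, D z -> exists2 r : R, 0 < r & holomorphic z r a) ->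
  a zs != 0 -> (0 < k)%N -> (0 < n)%N -> b != 0 -> zalcman_seq k D F f z t zs g ->
  g zeta <> None -> dvn k (fp g) zeta ^+ n = b / a zs ->
  ~ const_near k g (dvn k (fp g) zeta) zeta -> 0 < rho ->
  exists J, forall j, (J <= j)%N -> exists2 x, nm (x - zeta) < rho &
    D (z j + (t j)%:C * x) /\ is_zero (diff_poly a b n k (f j)) (z j + (t j)%:C * x).
Proof.
move=> Dopen ahol azs k0 n0 b0 [[Ff Dzs zlim t0 tlim] [cv _]] gz Gz nconst rho0.
have tn0 j : (t j)%:C != 0 by rewrite -nm_gt0 nmC normr_gt0 gt_eqF.
have tk0 j : (t j)%:C ^- k != 0 by rewrite invr_eq0 expf_neq0.
pose U j := rescale ((t j)%:C ^- k) (z j) (t j)%:C (f j).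
have [r r0 [[J0 hU] hg uc]] := lconv_finite (cv zeta) gz.
have r20 : 0 < r / 2 by rewrite divr_gt0.
have r2r : r / 2 < r by move: r0; clear; lra.
have sub x : nm (x - zeta) < r / 2 -> nm (x - zeta) < r by move=> h; exact: lt_trans r2r.
have loc e : 0 < e -> exists J, forall j, (J <= j)%N -> forall x, nm (x - zeta) < r ->
    nm (z j + (t j)%:C * x - zs) < e.
  move=> e0; have e20 : 0 < e / 2 by rewrite divr_gt0.
  have B0 : 0 < nm zeta + r by have := nm_ge0 zeta; move: r0; clear; lra.
  have [J1 H1] := zlim _ e20; have [J2 H2] := tlim _ (divr_gt0 e20 B0).
  exists (maxn J1 J2) => j; rewrite geq_max => /andP[/H1 j1 /H2 j2] x hx.
  rewrite subr0 ltr_pdivlMr // in j2.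
  have : nm ((t j)%:C * x) <= nm (t j)%:C * (nm zeta + r).
    rewrite normcM; apply: ler_wpM2l; first exact: nm_ge0.
    by have := nm_tri zeta x 0; rewrite !subr0; move: hx; clear; lra.
  have := le_normcD (z j - zs) ((t j)%:C * x); rewrite addrAC.
  by move: j1 j2; clear; lra.
have [s s0 hs] := ahol zs Dzs; have [s' s'0 Ds] := Dopen zs Dzs.
have [J1 H1] := loc s s0; have [J2 H2] := loc s' s'0.
(* [P j] is [diff_poly] of [f j] in the rescaled variable: [f j] is [t^k U j], and the [k]-th
   derivatives agree. The factor 0 in [P0] is the limit of [t^k], kept so that the convergence of
   products applies. *)
pose P j x := (t j)%:C ^+ k * fp (U j) x + a (z j + (t j)%:C * x) * dvn k (fp (U j)) x ^+ n - b.
pose P0 x := 0 * fp (g : C -> S) x + a zs * dvn k (fp g) x ^+ n - b.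
have hP : exists J, forall j, (J <= j)%N -> holomorphic zeta (r / 2) (P j).
  exists (maxn J0 J1) => j; rewrite geq_max => /andP[j0 j1].
  apply: (@hol_sub _ _ zeta r); last by rewrite subrr nm0 add0r ltW.
  apply: hol_B; last exact: hol_cst.
  apply: hol_D; first by apply: hol_M; [exact: hol_cst|exact: (hU j j0).2].
  apply: hol_M; last by apply: hol_X; apply: hol_dvn; exact: (hU j j0).2.
  move=> x hx; have [d hd] := hs _ (H1 j j1 x hx).
  by exists (d * (t j)%:C); exact: cdiff_compZ.
have hP0 : holomorphic zeta (r / 2) P0.
  apply: (@hol_sub _ _ zeta r); last by rewrite subrr nm0 add0r ltW.
  apply: hol_B; last exact: hol_cst.
  apply: hol_D; first by apply: hol_M; [exact: hol_cst|exact: hg.2].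
  by apply: hol_M; [exact: hol_cst|apply: hol_X; apply: hol_dvn; exact: hg.2].
have cvP : ucvg zeta (r / 2) P P0.
  have [M1 B1] := hol_bounded r2r hg.2.
  have [M2 B2] := hol_bounded r2r (hol_dvn k hg.2).
  have [M3 B3] := hol_bounded r2r (hol_X n (hol_dvn k hg.2)).
  have uc2 : ucvg zeta (r / 2) (fun j => fp (U j)) (fp g).
    by apply: (ucvg_sub uc); rewrite subrr nm0 add0r ltW.
  have ucd : ucvg zeta (r / 2) (fun j => dvn k (fp (U j))) (dvn k (fp g)).
    by apply: (@ucvg_dvn _ k _ _ zeta r) => //; [exists J0 => j /hU []|exact: hg.2].
  have cst (c : C) : ucvg zeta (r / 2) (fun _ _ => c) (fun=> c).
    by move=> e e0; exists 0%N => j _ w _; rewrite subrr nm0.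
  apply: ucvg_D; last exact: cst.
  apply: ucvg_D.
    apply: (ucvg_M (M := Num.max 0 M1)) => //.
      move=> e e0; have e'0 : 0 < Num.min 1 e by rewrite lt_min ltr01.
      have [J HJ] := tlim _ e'0; exists J => j /HJ; rewrite !subr0 lt_min => /andP[u1 u2] w _.
      rewrite nmX; apply: le_lt_trans u2; rewrite -(prednK k0) exprS ler_piMr ?nm_ge0 //.
      by apply: exprn_ile1; [exact: nm_ge0|exact: ltW].
    by move=> w hw; rewrite nm0 le_max lexx le_max (B1 w hw) orbT.
  apply: (ucvg_M (M := Num.max (nm (a zs)) M3)).
  - have zz : nm (zs - zs) < s by rewrite subrr nm0.
    move=> e e0; have [d d0 Hd] := hol_ccont hs zz e0.
    have [J HJ] := loc d d0; exists J => j Jj w hw.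
    by apply: Hd; apply: HJ => //; exact: sub.
  - exact: ucvg_X ucd B2.
  - by move=> w hw; rewrite !le_max lexx (B3 w hw) orbT.
have P0z : P0 zeta = 0 by rewrite /P0 Gz mul0r add0r mulrC divfK // subrr.
(* If [P0] vanished on the disc, the [k]-th derivative would have a constant nonzero [n]-th power
   there, hence be constant. *)
have nz : exists2 x, nm (x - zeta) < r / 2 & P0 x != 0.
  apply: contrapT => no; apply: nconst; exists (r / 2) => //.
  have all x : nm (x - zeta) < r / 2 -> dvn k (fp g) x ^+ n = b / a zs.
    move=> hx; have [E|E] := eqVneq (P0 x) 0; last by case: no; exists x.
    have {}E : a zs * dvn k (fp g) x ^+ n = b.
      by apply/eqP; rewrite -subr_eq0 -E /P0 mul0r add0r.
    by rewrite -E mulrC mulKf.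
  move=> x hx; split; first exact: (finb_chart0 hg (sub x hx)).
  apply: (power_const (r := r / 2) (b := b / a zs) n0) => //.
    by rewrite mulf_neq0 ?invr_eq0.
  by apply: (hol_sub (hol_dvn k hg.2)); rewrite subrr nm0 add0r ltW.
have m0 : 0 < Num.min rho (r / 2) by rewrite lt_min rho0.
have [J3 H3] := hurwitz r20 hP hP0 cvP P0z nz m0.
exists (maxn (maxn J0 J2) J3) => j; rewrite !geq_max => /andP[/andP[j0 j2] j3].
have [x] := H3 j j3; rewrite lt_min => /andP[x1 x2] Px.
exists x => //; split; first exact: Ds (H2 j j2 x (sub x x2)).
have cU : chart0 (U j) x by exact: (finb_chart0 (hU j j0) (sub x x2)).
apply: diff_poly_zero; first exact: chart0_rescale_inv cU.
move: Px; rewrite /P fp_rescale dvn_rescale // mulVKf ?expf_neq0 //.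
by rewrite mulVf ?expf_neq0 // mul1r.
Qed.

Lemma zalcman_const (D : C -> Prop) F n k (a : C -> C) (b : C) (f : nat -> C -> S) (z : nat -> C) t zs g :
  (forall z, D z -> exists2 r : R, 0 < r & forall w, nm (w - z) < r -> D w) ->
  (forall z, D z -> exists2 r : R, 0 < r & holomorphic z r a) ->
  (forall z, D z -> a z != 0) -> (0 < k)%N -> (2 < n)%N -> b != 0 ->
  (forall f, F f -> at_most_one_zero D (diff_poly a b n k f)) ->
  zalcman_seq k D F f z t zs g -> exists c, forall zeta, chart0 g zeta /\ dvn k (fp g) zeta = c.
Proof.
move=> Dopen ahol a0 k0 n2 b0 one zs_.
have [[Ff Dzs _ t0 _] [cv u0]] := zs_.
have azs := a0 zs Dzs; have n0 : (0 < n)%N by exact: ltn_trans n2.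
have pg := lconv_polefn cv (limit_not_none cv u0).
have [[c [x cx]]|nc] := pselect (exists c x, const_near k g c x).
  exists c => y; have [e e0 He] := const_spread pg cx y.
  by apply: He; rewrite subrr nm0.
apply: (power_once_const (b := b / a zs) n2) => //.
  by rewrite mulf_neq0 ?invr_eq0.
move=> x y gx gy Gx Gy; apply: contrapT => /eqP xy.
(* Half the distance keeps the zeros found near [x] and near [y] distinct. *)
have rho0 : 0 < nm (x - y) / 2 by rewrite divr_gt0 // nm_gt0 subr_eq0.
have zero w : g w <> None -> dvn k (fp g) w ^+ n = b / a zs ->
    exists J, forall j, (J <= j)%N -> exists2 x', nm (x' - w) < nm (x - y) / 2 &
    D (z j + (t j)%:C * x') /\ is_zero (diff_poly a b n k (f j)) (z j + (t j)%:C * x').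
  by move=> gw Gw; apply: (zalcman_zero Dopen ahol azs k0 n0 b0 zs_ gw Gw) => // h; apply: nc; eexists; eexists; exact: h.
have [J1 H1] := zero x gx Gx; have [J2 H2] := zero y gy Gy.
have [x' hx [Dx zx]] := H1 _ (leq_maxl J1 J2); have [y' hy [Dy zy]] := H2 _ (leq_maxr J1 J2).
have := one _ (Ff _) _ _ Dx Dy zx zy => /addrI /mulfI xy'.
have {}xy' : x' = y' by apply: xy'; rewrite -nm_gt0 nmC normr_gt0 gt_eqF.
move: hx hy; rewrite xy' => hx hy.
by have := nm_tri y' x y; rewrite (nmBC x y'); move: hx hy; clear; lra.
Qed.

End ConstantDerivative.

(** * The limit cannot be a polynomial *)

Section Polynomials.
Context {R : realType}.
Local Notation C := R[i].
Local Notation S := (sphere R).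
Local Notation fp := finite_part.
Implicit Types (f g : C -> S) (c z zs zeta w a : C) (r e M : R).

Lemma cdiff_horner (p : {poly C}) z : cdiff (fun w => p.[w]) z p^`().[z].
Proof.
elim/poly_ind: p => [|p c IH].
  rewrite deriv0 horner0; apply: (cdiff_near ltr01 _ (cdiff_cst 0 z)) => w _.
  by rewrite horner0.
apply: (cdiff_eq (cdiff_near ltr01 _ (cdiffD (cdiffM IH (cdiff_id z)) (cdiff_cst c z)))).
  by move=> w _; rewrite hornerMXaddC.
by rewrite derivD derivM derivX derivC !hornerE; ring.
Qed.

Lemma poly_antiderivative (p : {poly C}) : exists q : {poly C}, q^`() = p.
Proof.
exists (\poly_(i < (size p).+1) (p`_i.-1 / i%:R)); apply/polyP => i.
rewrite coef_deriv coef_poly ltnS /=; case: ltnP => h.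
  by rewrite -[_ *+ _]mulr_natr divfK // pnatr_eq0.
by rewrite mul0rn nth_default.
Qed.

Lemma entire_dvn k (h : C -> C) : entire h -> entire (dvn k h).
Proof. by move=> eh; elim: k => // k IH; exact: entire_dv. Qed.

Lemma dvn_const_poly k (h : C -> C) c : entire h -> (forall z, dvn k h z = c) ->
  exists p : {poly C}, forall z, h z = p.[z].
Proof.
elim: k h => [|k IH] h eh H; first by exists c%:P => z; rewrite hornerC; exact: H.
have [||p Hp] := IH (dv h); first exact: entire_dv.
  by move=> z; rewrite -dvnSr.
have [q qp] := poly_antiderivative p.
exists (q + (h 0 - q.[0])%:P) => z; rewrite hornerD hornerC.
have e : entire (fun w => h w - q.[w]).
  by move=> w; eexists; exact: cdiffB (entire_cdiff w eh) (cdiff_horner q w).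
have := dv0_const e _ z 0 => <-; first by rewrite addrC subrK.
move=> w; apply: cdiff_dv; apply: (cdiff_eq (cdiffB (entire_cdiff w eh) (cdiff_horner q w))).
by rewrite qp Hp subrr.
Qed.

Lemma dvn_zero k f y : chart0 f y -> zmult k f y -> fp f y = 0 ->
  forall i, (i <= k)%N -> dvn i (fp f) y = 0.
Proof.
move=> [r r0 hf] zf fy i ik; have yy : nm (y - y) < r by rewrite subrr nm0.
case: (zero_order r0 hf.2) => [Z|[m [h [hh hy hE]]]].
  have [|h' _ E] := @dvn_zero_form R i (fp f) (fun=> 0) y r 1 (@hol_cst R 0 y r).
    by move=> w hw; rewrite mulr0 Z.
  by rewrite E // subrr expr1 mul0r.
have m0 : (0 < m)%N.
  by rewrite lt0n; apply: contraNneq hy => m0; move: (hE y); rewrite fy m0 mul1r => <-.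
have km : (k < m)%N.
  by apply: (zf m h r) => // w hw; rewrite -hE; exact: fpE (hf.1 w hw).
have im : (i < m)%N by exact: leq_ltn_trans km.
have [|h' _ E] := @dvn_zero_form R i (fp f) h y r (m - i) hh.
  by move=> w hw; rewrite subnK // ltnW.
by rewrite E // subrr expr0n gtn_eqF ?subn_gt0 // mul0r.
Qed.

Lemma zalcman_contra (D : C -> Prop) F k (f : nat -> C -> S) (z : nat -> C) t zs g c :
  (forall z, D z -> exists2 r : R, 0 < r & forall w, nm (w - z) < r -> D w) ->
  (forall f z, F f -> D z -> zmult k f z) ->
  zalcman_seq k D F f z t zs g -> (forall zeta, chart0 g zeta /\ dvn k (fp g) zeta = c) -> False.
Proof.
move=> Dopen Fz [[Ff Dzs zlim t0 tlim] [cv u0]] gc.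
have tn0 j : (t j)%:C != 0 by rewrite -nm_gt0 nmC normr_gt0 gt_eqF.
have tk0 j : (t j)%:C ^- k != 0 by rewrite invr_eq0 expf_neq0.
pose U j := rescale ((t j)%:C ^- k) (z j) (t j)%:C (f j).
have eg : entire (fp g) by move=> y; exists (dv (fp g) y); exact: chart0_cdiff (gc y).1.
have cv0 y := lconv_finite (cv y) (chart0_finite (gc y).1).
have dg0 : ~ dv (fp g) 0 = 0.
  move=> dg; have [r r0 [[J hU] hg uc]] := cv0 0.
  have r2 : r / 2 < r by move: r0; clear; lra.
  have [|J2 H2] := ucvg_dv _ hg.2 uc r2 ltr01; first by exists J => j /hU [].
  have := H2 _ (leq_maxr J J2) 0; rewrite subrr nm0 => /(_ (divr_gt0 r0 (ltr0n _ 2))).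
  rewrite dg subr0 => /lt_geF/negP; apply; apply: le_trans (u0 (maxn J J2)).2.
  by rewrite lerDl exprn_ge0 // nm_ge0.
have [p hp] := dvn_const_poly eg (fun y => (gc y).2).
(* A polynomial that is not a nonzero constant has a root, the field being algebraically closed; a
   constant would contradict [dg0]. *)
have [y hy] : exists y, fp g y = 0.
  have [/eqP/size_poly1P [b _ pb]|/closed_rootP [y /rootP py]] := eqVneq (size p) 1%N.
    case: dg0; apply: cdiff_dv; apply: (cdiff_near ltr01 _ (cdiff_cst b 0)) => w _.
    by rewrite hp pb hornerC.
  by exists y; rewrite hp.
have [r r0 [[J hU] hg uc]] := cv0 y.
have yy e : 0 < e -> nm (y - y) < e by rewrite subrr nm0.
have r20 : 0 < r / 2 by rewrite divr_gt0.
have r2r : r / 2 < r by move: r0; clear; lra.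
(* Hurwitz puts zeros of [U j] close to [y]. The derivatives of [U j] up to order [k] vanish there
   and converge uniformly, so those of [g] take arbitrarily small values near [y]. *)
have van i : (i <= k)%N -> dvn i (fp g) y = 0.
  move=> ik; have [[w wr gw]|no] := pselect (exists2 w, nm (w - y) < r & fp g w != 0); last first.
    have [|h' _ E] := @dvn_zero_form R i (fp g) (fun=> 0) y r 1 (@hol_cst R 0 y r).
      move=> w hw; rewrite mulr0; apply: contrapT => /eqP gw; apply: no; by exists w.
    by rewrite E ?yy // subrr expr1 mul0r.
  apply/eqP; rewrite -nm_eq0 eq_le nm_ge0 andbT; apply/ler_addgt0Pr => e e0; rewrite add0r.
  have e20 : 0 < e / 2 by rewrite divr_gt0.
  have [d d0 Hd] := hol_ccont (hol_dvn i hg.2) (yy r r0) e20.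
  have [s s0 Ds] := Dopen zs Dzs; have s20 : 0 < s / 2 by rewrite divr_gt0.
  have [J1 H1] := zlim _ s20.
  have B0 : 0 < nm y + r by have := nm_ge0 y; move: r0; clear; lra.
  have [J2 H2] := tlim _ (divr_gt0 s20 B0).
  have hUr : exists J, forall j, (J <= j)%N -> holomorphic y r (fp (U j)).
    by exists J => j /hU [].
  have [J3 H3] := ucvg_dvn i hUr hg.2 uc r2r e20.
  have m0 : 0 < Num.min d (r / 2) by rewrite lt_min d0.
  have nz : exists2 w, nm (w - y) < r & fp g w != 0 by exists w.
  have [J4 H4] := hurwitz r0 hUr hg.2 uc hy nz m0.
  pose j := maxn (maxn J J1) (maxn J2 (maxn J3 J4)).
  have [jJ j1 j2 [j3 j4]] : [/\ (J <= j)%N, (J1 <= j)%N, (J2 <= j)%N & (J3 <= j)%N /\ (J4 <= j)%N].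
    by rewrite /j !leq_max !leqnn !orbT.
  have [x] := H4 j j4; rewrite lt_min => /andP[x1 x2] Ux.
  have xr : nm (x - y) < r by exact: lt_trans r2r.
  have cU : chart0 (U j) x := finb_chart0 (hU j jJ) xr.
  have cf := chart0_rescale_inv (tk0 j) (tn0 j) cU.
  have Dx : D (z j + (t j)%:C * x).
    apply: Ds; have := H1 j j1; have := H2 j j2; rewrite subr0 ltr_pdivlMr //.
    have : nm ((t j)%:C * x) <= nm (t j)%:C * (nm y + r).
      rewrite normcM; apply: ler_wpM2l; first exact: nm_ge0.
      by have := nm_tri y x 0; rewrite !subr0; move: xr; clear; lra.
    have := le_normcD (z j - zs) ((t j)%:C * x); rewrite [z j - zs + _]addrAC.
    clear; lra.
  have fx : fp (f j) (z j + (t j)%:C * x) = 0.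
    move: Ux; rewrite fp_rescale => /eqP; rewrite mulf_eq0 (negbTE (tk0 j)) /=.
    by move/eqP.
  have dU : dvn i (fp (U j)) x = 0.
    by rewrite dvn_rescale // (dvn_zero cf (Fz _ _ (Ff j) Dx) fx) // mulr0.
  have := H3 j j3 x x2; rewrite dU sub0r normcN => l1.
  have := Hd x x1; have := nm_tri (dvn i (fp g) x) (dvn i (fp g) y) 0.
  by rewrite !subr0 (nmBC (dvn i (fp g) y)); move: l1; clear; lra.
(* Descending from order [k]: each derivative is constant because the next one is 0, and its value
   at [y] is 0. *)
have all i : (i <= k)%N -> forall w, dvn (k - i) (fp g) w = 0.
  elim: i => [|i IH] ik w.
    by rewrite subn0 (gc w).2 -(gc y).2 van.
  rewrite -(van (k - i.+1)%N (leq_subr _ _)); apply: dv0_const; first exact: entire_dvn.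
  move=> x; rewrite -dvnS subnSK //; apply: IH; exact: ltnW.
apply: dg0; apply: cdiff_dv; apply: (cdiff_near ltr01 _ (cdiff_cst 0 0)) => w _.
by have := all k (leqnn k) w; rewrite subnn.
Qed.

End Polynomials.

(** * Spherical convergence *)

Section SphericalConvergence.
Context {R : realType}.
Local Notation C := R[i].
Local Notation S := (sphere R).
Local Notation fp := finite_part.
Implicit Types (f g : C -> S) (c z zs zeta w a : C) (r e M : R).

Lemma chordal_den_ge1 (x : R) : 1 <= Num.sqrt (1 + x ^+ 2).
Proof. by rewrite -[leLHS]sqrtr1 ler_wsqrtr // lerDl sqr_ge0. Qed.

Lemma chordal_den_inv (x : R) : 0 < x -> Num.sqrt (1 + x^-1 ^+ 2) = Num.sqrt (1 + x ^+ 2) / x.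
Proof.
move=> x0; have -> : 1 + x^-1 ^+ 2 = (1 + x ^+ 2) * x^-1 ^+ 2 by field; rewrite gt_eqF.
rewrite sqrtrM ?sqrtr_sqr ?ger0_norm ?invr_ge0 ?(ltW x0) //.
by rewrite addr_ge0 // sqr_ge0.
Qed.

Lemma chordal_le z w : chordal (Some z : S) (Some w) <= nm (z - w).
Proof.
rewrite /chordal ler_pdivrMr; last by rewrite mulr_gt0 // (lt_le_trans ltr01) ?chordal_den_ge1.
by rewrite ler_peMr ?nm_ge0 // mulr_ege1 ?chordal_den_ge1.
Qed.

(** Inversion is a rotation of the sphere. Convergence in the chart at infinity thereby reduces to
    the finite chart. *)
Lemma chordal_sinv (p p' : S) : chordal (sinv p) (sinv p') = chordal p p'.
Proof.
have dpos x : 0 < Num.sqrt (1 + x ^+ 2) :> R by exact: lt_le_trans ltr01 (chordal_den_ge1 x).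
have den0 : Num.sqrt (1 + nm (0 : C) ^+ 2) = 1 :> R by rewrite nm0 expr0n addr0 sqrtr1.
have si w : w != 0 -> sinv (Some w : S) = Some w^-1 by move=> w0; rewrite /= (negbTE w0).
have half w : chordal (sinv (Some w : S)) (Some 0) = chordal (Some w : S) None.
  have [->|w0] := eqVneq w 0; first by rewrite /sinv eqxx.
  have n0 : 0 < nm w by rewrite nm_gt0.
  rewrite si // /chordal den0 subr0 mulr1 normcV chordal_den_inv //.
  by have := dpos (nm w); move: (Num.sqrt _) => y y0; field; rewrite !gt_eqF.
have half' w : chordal (sinv (Some w : S)) None = chordal (Some w : S) (Some 0).
  have [->|w0] := eqVneq w 0; first by rewrite /sinv eqxx /chordal subrr nm0 mul0r.
  have n0 : 0 < nm w by rewrite nm_gt0.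
  by rewrite si // /chordal den0 subr0 mulr1 normcV chordal_den_inv // invf_div.
have sym (x y : S) : chordal x y = chordal y x.
  by case: x y => [x|] [y|] //=; rewrite nmBC mulrC [_ * Num.sqrt _]mulrC mulrC.
case: p p' => [z|] [w|].
- have [->|w0] := eqVneq w 0; first by rewrite -half' /sinv eqxx.
  have [->|z0] := eqVneq z 0; first by rewrite sym [RHS]sym -half' /sinv eqxx.
  rewrite !si // /chordal.
  have n0 : 0 < nm w by rewrite nm_gt0.
  have m0 : 0 < nm z by rewrite nm_gt0.
  have -> : z^-1 - w^-1 = (w - z) * (z * w)^-1 by field; rewrite w0 z0.
  rewrite !normcM !normcV normcM !chordal_den_inv // (nmBC w z).
  have := dpos (nm z); have := dpos (nm w); move: (Num.sqrt _) (Num.sqrt _) => x y x0 y0.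
  by field; rewrite !gt_eqF.
- exact: half.
- by rewrite sym half sym.
- by rewrite /sinv /chordal subrr nm0 mul0r.
Qed.

Definition chordal_cvg (u : nat -> C -> S) g z := exists2 r, 0 < r & forall e, 0 < e ->
  exists J, forall j, (J <= j)%N -> forall w, nm (w - z) < r -> chordal (u j w) (g w) < e.

Lemma lconv_chordal (u : nat -> C -> S) g z : lconv u g z -> chordal_cvg u g z.
Proof.
have main v h : lconv0 v h z -> chordal_cvg v h z.
  move=> [r r0 [[J HJ] hg uc]]; exists r => // e e0; have [J' HJ'] := uc e e0.
  exists (maxn J J') => j; rewrite geq_max => /andP[j1 j2] w hw.
  rewrite (fpE ((HJ j j1).1 w hw)) (fpE (hg.1 w hw)).
  exact: le_lt_trans (chordal_le _ _) (HJ' j j2 w hw).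
case=> [/main //|/main [r r0 H]]; exists r => // e /H [J HJ].
by exists J => j Jj w hw; rewrite -chordal_sinv; exact: HJ.
Qed.

Lemma lconv_uniform (D : set C^o) (u : nat -> C^o -> S) g : (forall z, D z -> lconv u g z) ->
  spherically_locally_uniform_cvg D u g.
Proof.
move=> cv K Kc KD e e0.
have [|J HJ] := @compact_nat R K (fun j w => chordal (u j w) (g w) < e) Kc.
  move=> z /KD /cv /lconv_chordal [r r0 H]; exists r => //.
  by have [J HJ] := H e e0; exists J => w hw j Jj; exact: HJ.
by exists J.
Qed.

(** A neighbourhood of infinity contains the complement of a compact set; that set is bounded by
    some [J], and [|v| / |w - z|^m] exceeds [J] close to [z]. *)
Lemma polar_pole g z : polar g z -> pole_at (g : C^o -> S) z.
Proof.
move=> [gz [r [m [v [r0 m0 hv vz H]]]]]; split => //.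
  apply/nbhsC_P; exists r => // w hw /= wz; have [cw _] := H w hw wz.
  split; first exact: chart0_finite cw.
  by apply/derivable_exists; exists (dv (fp g) w); exact: chart0_cdiff.
move=> V [K [Kc _] KV].
have [J HJ] : exists J, forall w, K w -> nm w <= J%:R.
  have [|J HJ] := @compact_nat R K (fun j w => nm w <= j%:R) Kc; last by exists J; exact: HJ.
  move=> x _; exists 1 => //; exists (Num.bound (nm x + 1)) => w hw j Jj.
  have := archi_boundP (x := nm x + 1); rewrite addr_ge0 ?nm_ge0 // => /(_ isT) h.
  apply: (@le_trans _ _ (Num.bound (nm x + 1))%:R); last by rewrite ler_nat.
  by have := nm_tri x w 0; rewrite !subr0; move: hw h; clear; lra.
have [c c0 cE] : exists2 c, 0 < c & c = nm (v z) / 2.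
  by eexists; last reflexivity; rewrite divr_gt0 // nm_gt0.
have zz : nm (z - z) < r by rewrite subrr nm0.
have [d d0 Hd] := hol_ccont hv zz c0.
have J0 : 0 < J%:R + 1 :> R by rewrite ltr_wpDl.
apply/nbhsC_P; exists (Num.min (Num.min r d) (Num.min 1 (c / (J%:R + 1)))).
  by rewrite !lt_min r0 d0 ltr01 divr_gt0.
move=> w; rewrite !lt_min => /andP[/andP[w1 w2] /andP[w3 w4]] /= wz.
have [cw gw] := H w w1 wz.
apply: KV; left; exists (fp g w); last by rewrite -fpE //; exact: chart0_finite.
move=> /= /HJ; apply/negP; rewrite -ltNge gw normcM normcV nmX.
have n0 : 0 < nm (w - z) by rewrite nm_gt0 subr_eq0.
have cv : c <= nm (v w) by rewrite cE; apply: (nm_half_le _).1; rewrite -cE; exact: Hd.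
rewrite ltr_pdivlMr ?exprn_gt0 //; apply: lt_le_trans cv.
have wm : nm (w - z) ^+ m <= nm (w - z).
  rewrite -(prednK m0) exprS; apply: ler_piMr; first exact: ltW.
  by apply: exprn_ile1; exact: ltW.
move: w4; rewrite ltr_pdivlMr //.
have : J%:R * nm (w - z) ^+ m <= J%:R * nm (w - z) by rewrite ler_wpM2l.
by move: n0; move: (nm (w - z) ^+ m) (nm (w - z)) (J%:R : R) => x y j; clear; lra.
Qed.

(** [P] is controlled at points of [D] only, so the splitting is made by the open sets [A P] and
    [A (fun w => ~ P w)] of the plane. *)
Lemma connected_split (D : set C^o) (P : C -> Prop) : connected D ->
  (forall z, D z -> P z -> exists2 e : R, 0 < e & forall w, nm (w - z) < e -> P w) ->
  (forall z, D z -> ~ P z -> exists2 e : R, 0 < e & forall w, nm (w - z) < e -> ~ P w) ->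
  (forall z, D z -> P z) \/ (forall z, D z -> ~ P z).
Proof.
move=> Dc Po Pc; have [[z0 Dz0 Pz0]|no] := pselect (exists2 z, D z & P z); last first.
  by right=> z Dz Pz; apply: no; exists z.
left; pose A (Q : C -> Prop) : set C^o := [set z | exists2 e : R, 0 < e & forall w, nm (w - z) < e -> Q w].
have Aopen Q : open (A Q).
  rewrite openE => z [e e0 He]; apply/nbhsC_P; exists (e / 2); first by rewrite divr_gt0.
  move=> w hw; exists (e / 2); first by rewrite divr_gt0.
  by move=> y hy; apply: He; have := nm_tri w y z; move: hw hy; clear; lra.
have self z (e : R) : 0 < e -> nm (z - z) < e by rewrite subrr nm0.
have DA z : D z -> (A P z <-> P z).
  by move=> Dz; split=> [[e e0 He]|/(Po z Dz)//]; exact: He (self z e e0).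
have E : D `&` A P = D.
  apply: Dc; first by exists z0; split => //; apply/DA.
    by exists (A P).
  exists (~` A (fun w => ~ P w)); first exact: open_closedC.
  apply/seteqP; split=> z [Dz h]; split => //.
    by move=> [e e0 He]; apply: (He z (self z e e0)); exact/(DA z Dz).
  by apply/DA => //; apply: contrapT => nP; apply: h; exact: Pc.
by move=> z Dz; apply/(DA z Dz); move: Dz; rewrite -{1}E => -[].
Qed.

Lemma lconv_limit (D : set C^o) (u : nat -> C -> S) (g : C^o -> S) : connected D ->
  (forall z, D z -> lconv u g z) -> meromorphic_on D g \/ forall z, D z -> g z = None.
Proof.
move=> Dc cv; have [||H|H] := @connected_split D (none_near g) Dc.
- move=> z _ [e e0 He]; exists (e / 2); first by rewrite divr_gt0.
  move=> w hw; exists (e / 2); first by rewrite divr_gt0.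
  by move=> y hy; apply: He; have := nm_tri w y z; move: hw hy; clear; lra.
- move=> z Dz nP; apply: contrapT => no; apply: nP; apply: (none_near_closed (cv z Dz)) => e e0.
  apply: contrapT => none; apply: no; exists e => // w hw nw; apply: none; by exists w.
- by right=> z /H [e e0]; apply; rewrite subrr nm0.
left=> z Dz; case: (lconv_pole (cv z Dz) (H z Dz)) => [/chart0_regular|/polar_pole].
  by left.
by right.
Qed.

End SphericalConvergence.

Theorem theorem1p3 (R : realType) (D : set R[i]^o)
    (F : set (R[i]^o -> sphere R)) (n k : nat) (a : R[i]^o -> R[i]^o) (b : R[i]^o)
    (hD : domain D)
    (hF : forall f, F f -> meromorphic_on D f)
    (hn : (2 < n)%N) (hk : (0 < k)%N)
    (hb : b != 0)
    (ha : holomorphic_on D a) (ha0 : forall z, D z -> a z != 0)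
    (hzeros : forall f, F f -> zeros_multiplicity_ge D f (2 * k + 1)%N)
    (hone : forall f, F f -> at_most_one_zero D (diff_poly a b n k f)) :
  normal_family D F.
Proof.
case: hD => Do Dc _.
have Dopen z : D z -> exists2 r : R, 0 < r & forall w : R[i], nm (w - z) < r -> D w.
  by move=> Dz; apply/nbhsC_P; exact: open_nbhs_nbhs.
have ahol z : D z -> exists2 r : R, 0 < r & holomorphic z r a.
  move=> /Dopen [r r0 Hr]; exists r => // w /Hr /ha aw; exact/derivable_exists.
have FD (f : R[i] -> sphere R) z : F f -> D z -> mero f z /\ zmult k f z.
  move=> Ff Dz; split; first exact: meromorphic_mero (hF f Ff) Dz.
  exact: zeros_zmult (hzeros f Ff) Dz.
(* The alternative to a bound is a rescaled sequence whose limit has a constant [k]-th derivative,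
   which [zalcman_contra] excludes. *)
have bound z : D z -> exists r M, [/\ 0 < r, 0 < M & forall f, F f -> sph_le M f z r].
  move=> /Dopen [r r0 Hr]; have [//|[f [w [t [zs [g Z]]]]]] := zalcman r0 Hr FD.
  have [c gc] := zalcman_const Dopen ahol ha0 hk hn hb hone Z.
  by case: (zalcman_contra Dopen _ Z gc) => f' z' Ff Dz; exact: (FD f' z' Ff Dz).2.
move=> u Fu; have [z /bound [r [M [r0 M0 H]]]|phi [inc [g cv]]] := @marty R D u.
  by exists r, M, 0%N; split => // j _; exact: H.
exists phi; split => //; exists g; split; first exact: lconv_limit cv.
exact: lconv_uniform.
Qed.
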